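(* Let $n\ge 2$, let $\widehat X_n$ be the bordification of Outer space $X_n$, let $Y_n\subset X_n$ be the subspace of graphs with no separating edges, and let $\widehat Y_n$ be the closure of $Y_n$ in $\widehat X_n$. Then $\widehat X_n$ equivariantly (with respect to $Out(F_n)$) deformation retracts onto $\widehat Y_n$. Under this retraction, the image $\widehat Z_n$ of $\partial\widehat X_n$ is the union of $\partial\widehat Y_n$ with the set of graphs in the interior $Y_n$ which have a cut vertex.
   Context: Outer space $X_n$: points are equivalence classes of marked metric graphs, i.e. finite connected graphs $\Gamma$ (multiple edges and loops allowed) with all vertices of valence at least $3$ and fundamental group free of rank $n$, with a positive length assigned to each edge, total length (volume) $1$, and a marking (a homotopy equivalence from a fixed wedge of $n$ circles to $\Gamma$), where marked metric graphs are equivalent if there is an isometry commuting with the markings up to homotopy. $Out(F_n)$ acts by changing the marking. A separating edge is one whose removal disconnects its component; a cut vertex of a connected graph $\Gamma$ is a vertex $v$ such that the topological space $\Gamma\setminus\{v\}$ is disconnected. A core graph is a (not necessarily connected) graph with no separating edges and no vertices of valence $0$ or $1$. A point of $\widehat X_n$ is an equivalence class of: a marked graph $\Gamma_0$ (connected, rank $n$, all valences at least $3$), a properly nested, possibly empty, sequence $\Gamma_0\supsetneq\Gamma_1\supsetneq\cdots\supsetneq\Gamma_k$ with each $\Gamma_i$ ($i\ge1$) a nonempty core subgraph of $\Gamma_0$, and for each $i$ a metric $m_i$ on $\Gamma_i$ of volume $1$ (a nonnegative length for each edge, summing to $1$), such that for $1\le i\le k$ the graph $\Gamma_i$ is the subgraph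 of $\Gamma_{i-1}$ spanned by all edges of $m_{i-1}$-length $0$, and every edge of $\Gamma_0$ has nonzero length in exactly one $m_i$ (in particular $m_k$ is positive on all edges of $\Gamma_k$). Points with $k=0$ form $X_n$. Put $\partial\widehat X_n=\widehat X_n\setminus X_n$ and $\partial\widehat Y_n=\widehat Y_n\setminus Y_n$. $Out(F_n)$ acts on $\widehat X_n$ by changing the marking. Topology: for a marked trivalent graph $\Gamma$ of rank $n$, the closed cell $\widehat\Sigma_\Gamma$ consists of all points of $\widehat X_n$ whose $\Gamma_0$ is obtained from $\Gamma$ by collapsing a (possibly empty) subforest, with the induced marking; collapsed edges are given length $0$. For a point of $\widehat\Sigma_\Gamma$ and a subgraph $C\subset\Gamma$ that is either a nonempty core subgraph or $\Gamma$ itself, the level of $C$ is the unique $l$ such that $m_l$ is defined on (the image of) $C$ and not identically zero on it. For two points $x,x'\in\widehat\Sigma_\Gamma$ with metrics $m_i,m'_i$ and levels $l,l'$ of $C$, put $d_C(x,x')=\sum_{e\in E(C)}\left|\frac{m_l(e)}{m_l(C)}-\frac{m'_{l'}(e)}{m'_{l'}(C)}\right|$, and $d(x,x')=\sum_C d_C(x,x')$ over all such $C$ (including $\Gamma$). This metric gives the topology of $\widehat\Sigma_\Gamma$, and $\widehat X_n$ is the union of these closed cells, with a set closed if and only if its intersection with each $\widehat\Sigma_\Gamma$ is closed. *)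

(* Defs.v *)
From HB Require Import structures.
From mathcomp Require Import all_boot all_order all_algebra.
From mathcomp Require Import all_classical all_reals all_analysis.
From Corelib Require Setoid Morphisms.
Set Implicit Arguments.
Unset Strict Implicit.
Unset Printing Implicit Defensive.
Import Order.TTheory GRing.Theory Num.Theory.
Import numFieldNormedType.Exports.
Local Open Scope ring_scope.

(* Finite graphs, with loops and multiple edges.  The orientation given by    *)
(* [src] and [tgt] is auxiliary: isomorphisms are allowed to reverse edges.   *)
Record graph := Graph {
  vertex : finType;
  edge : finType;
  src : edge -> vertex;
  tgt : edge -> vertex }.

Section Walks.
Variable G : graph.

(* [(e, false)] is [e] traversed from [src e] to [tgt e], [(e, true)] is its  *)
(* reverse.                                                                   *)
Definition dart : Type := (edge G * bool)%type.
Definition drev (d : dart) : dart := (d.1, ~~ d.2).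
Definition dorg (d : dart) : vertex G := if d.2 then tgt d.1 else src d.1.
Definition dend (d : dart) : vertex G := dorg (drev d).

Fixpoint walk (u : vertex G) (p : seq dart) (v : vertex G) : bool :=
  if p is d :: p' then (dorg d == u) && walk (dend d) p' v else u == v.

Definition prev (p : seq dart) : seq dart := rev (map drev p).

(* Edge-path homotopy rel endpoints: insertion and deletion of backtracks.    *)
(* The intermediate words are not required to be walks; as words have unique  *)
(* reduced forms, this gives the same relation on walks.                      *)
Inductive hpath : seq dart -> seq dart -> Prop :=
| hpath_refl p : hpath p p
| hpath_sym p q : hpath p q -> hpath q p
| hpath_trans p q r : hpath p q -> hpath q r -> hpath p r
| hpath_cancel p d q : hpath (p ++ d :: drev d :: q) (p ++ q).

(* A subgraph without isolated vertices is encoded by its set of edges.       *)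
Definition adj (C : {set edge G}) : rel (vertex G) := fun u v =>
  [exists e in C, ((src e == u) && (tgt e == v))
               || ((src e == v) && (tgt e == u))].

Definition connected_graph : bool :=
  [forall u, forall v, connect (adj [set: edge G]) u v].

(* Loops count twice. *)
Definition valence (C : {set edge G}) (v : vertex G) : nat :=
  \sum_(e in C) ((src e == v) + (tgt e == v))%N.

Definition separating (C : {set edge G}) (e : edge G) : bool :=
  (e \in C) && [exists u, exists v,
    connect (adj C) u v && ~~ connect (adj (C :\ e)) u v].

(* The vertices of the subgraph [C] are the endpoints of its edges, so no     *)
(* vertex of [C] has valence 0.                                               *)
Definition core (C : {set edge G}) : bool :=
  [forall e in C, ~~ separating C e] && [forall v, valence C v != 1%N].

Definition forest (F : {set edge G}) : Prop :=
  forall (v : vertex G) (p : seq dart), p != [::] -> walk v p v ->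
    all (fun d => d.1 \in F) p -> ~~ uniq (map fst p).

(* The space G \ {v} is the union of the cells of G (vertices and open edges) *)
(* other than v; its components are generated by the incidence of an edge     *)
(* with its endpoints different from v.                                       *)
Definition incident_off (v : vertex G) : rel (vertex G + edge G)%type :=
  fun a b => match a, b with
    | inl w, inr e | inr e, inl w => (w != v) && ((src e == w) || (tgt e == w))
    | _, _ => false
    end.

Definition cut_vertex (v : vertex G) : bool :=
  [exists a : (vertex G + edge G)%type, exists b : (vertex G + edge G)%type,
    [&& a != inl v, b != inl v & ~~ connect (incident_off v) a b]].

End Walks.

(* Cellular maps up to homotopy: each edge is sent to an edge-path. *)
Record gmap (G H : graph) := Gmap {
  gv :> vertex G -> vertex H;
  ge : edge G -> seq (dart H);
  ge_walk : forall e, walk (gv (src e)) (ge e) (gv (tgt e)) }.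

Definition gdart G H (f : gmap G H) (d : dart G) : seq (dart H) :=
  if d.2 then prev (ge f d.1) else ge f d.1.

Definition gpath G H (f : gmap G H) (p : seq (dart G)) : seq (dart H) :=
  flatten (map (gdart f) p).

(* [h v] is the track of the vertex [v] under the homotopy. *)
Definition homotopic G H (f g : gmap G H) : Prop :=
  exists h : vertex G -> seq (dart H),
    (forall v, walk (f v) (h v) (g v)) /\
    (forall e, hpath (ge f e ++ h (tgt e)) (h (src e) ++ ge g e)).

Section WalkTheory.
Variable G : graph.
Implicit Types (p q : seq (dart G)).

#[global] Instance hpath_equiv : RelationClasses.Equivalence (@hpath G).
Proof.
split; [exact: hpath_refl|exact: hpath_sym|exact: hpath_trans].
Qed.

#[global] Instance cat_hpath :
  Morphisms.Proper (Morphisms.respectful (@hpath G)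
    (Morphisms.respectful (@hpath G) (@hpath G))) (@cat (dart G)).
Proof.
move=> p p' pp' q q' qq'; apply: (@hpath_trans _ _ (p' ++ q)).
  elim: p p' / pp' =>
    [p|p r _|p r s _ IH1 _ IH2|p d r]; [exact: hpath_refl|exact: hpath_sym| |].
    exact: hpath_trans IH1 IH2.
  by rewrite -!catA !cat_cons; exact: hpath_cancel.
elim: q q' / qq' =>
  [q|q r _|q r s _ IH1 _ IH2|q d r]; [exact: hpath_refl|exact: hpath_sym| |].
  exact: hpath_trans IH1 IH2.
by rewrite !catA; exact: hpath_cancel.
Qed.

Lemma drevK : involutive (@drev G).
Proof. by case=> e b; rewrite /drev /= negbK. Qed.

Lemma dend_drev (d : dart G) : dend (drev d) = dorg d.
Proof. by rewrite /dend drevK. Qed.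

Lemma prev_cat p q : prev (p ++ q) = prev q ++ prev p.
Proof. by rewrite /prev map_cat rev_cat. Qed.

Lemma prev_cons d p : prev (d :: p) = prev p ++ [:: drev d].
Proof. by rewrite /prev /= rev_cons cats1. Qed.

Lemma prevK : involutive (@prev G).
Proof.
by move=> p; rewrite /prev map_rev revK -map_comp (eq_map drevK) map_id.
Qed.

Lemma hpath_prev_r p : hpath (p ++ prev p) [::].
Proof.
elim: p => [|d p IH]; first exact: hpath_refl.
rewrite prev_cons catA (_ : (d :: p) ++ prev p = [:: d] ++ (p ++ prev p))//.
by rewrite IH; exact: (hpath_cancel [::] d [::]).
Qed.

Lemma hpath_prev_l p : hpath (prev p ++ p) [::].
Proof. by rewrite -{2}[p]prevK; exact: hpath_prev_r. Qed.

#[global] Instance prev_hpath : 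
  Morphisms.Proper (Morphisms.respectful (@hpath G) (@hpath G)) (@prev G).
Proof.
move=> p q pq; elim: p q / pq =>
  [p|p r _|p r s _ IH1 _ IH2|p d r]; [exact: hpath_refl|exact: hpath_sym| |].
  exact: hpath_trans IH1 IH2.
rewrite !prev_cat !prev_cons drevK -!catA.
exact: (hpath_cancel (prev r) d (prev p)).
Qed.

Lemma walk_cat u p w q v : walk u p w -> walk w q v -> walk u (p ++ q) v.
Proof.
elim: p u => [u /eqP-> //|d p IH u] /=.
by case/andP=> -> /= pw qv; exact: IH.
Qed.

Lemma walk_prev u p v : walk u p v -> walk v (prev p) u.
Proof.
elim: p u => [u /eqP->|d p IH u]; first exact: eqxx.
case/andP=> /eqP<- pw.
rewrite prev_cons; apply: walk_cat (IH _ pw) _ => /=.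
by rewrite dend_drev !eqxx.
Qed.

End WalkTheory.

Section MapTheory.
Variables G H : graph.

Lemma gpath_cat (f : gmap G H) p q : gpath f (p ++ q) = gpath f p ++ gpath f q.
Proof. by rewrite /gpath map_cat flatten_cat. Qed.

Lemma gdart_drev (f : gmap G H) d : gdart f (drev d) = prev (gdart f d).
Proof. by case: d => e []; rewrite /gdart /= ?prevK. Qed.

Lemma gpath_prev (f : gmap G H) p : gpath f (prev p) = prev (gpath f p).
Proof.
elim: p => [//|d p IH].
rewrite prev_cons gpath_cat IH /gpath /= cats0 gdart_drev.
by rewrite -prev_cat.
Qed.

Lemma gpath1 (f : gmap G H) e : gpath f [:: (e, false)] = ge f e.
Proof. by rewrite /gpath /= cats0. Qed.

#[global] Instance gpath_hpath (f : gmap G H) :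
  Morphisms.Proper (Morphisms.respectful (@hpath G) (@hpath H)) (gpath f).
Proof.
move=> p q pq; elim: p q / pq =>
  [p|p r _|p r s _ IH1 _ IH2|p d r]; [exact: hpath_refl|exact: hpath_sym| |].
  exact: hpath_trans IH1 IH2.
rewrite -cat1s -(cat1s (drev d)) !gpath_cat /gpath /= !cats0 gdart_drev.
rewrite (catA (gdart f d)) hpath_prev_r; exact: hpath_refl.
Qed.

Lemma gdart_walk (f : gmap G H) d : walk (f (dorg d)) (gdart f d) (f (dend d)).
Proof.
case: d => e [] /=; rewrite /gdart /dend /dorg /=; last exact: ge_walk.
exact: walk_prev (ge_walk f e).
Qed.

Lemma gpath_walk (f : gmap G H) u p v :
  walk u p v -> walk (f u) (gpath f p) (f v).
Proof.
elim: p u => [u /eqP->|d p IH u] /=; first by rewrite eqxx.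
by case/andP=> /eqP<- /IH; apply: walk_cat; exact: gdart_walk.
Qed.

End MapTheory.

Definition gcomp G H K (g : gmap H K) (f : gmap G H) : gmap G K :=
  @Gmap G K (fun v => g (f v)) (fun e => gpath g (ge f e))
    (fun e => gpath_walk g (ge_walk f e)).

Lemma gpath_comp G H K (g : gmap H K) (f : gmap G H) p :
  gpath (gcomp g f) p = gpath g (gpath f p).
Proof.
elim: p => [//|d p IH].
rewrite {1}/gpath /= -/(gpath _ _) IH gpath_cat; congr cat.
by rewrite /gdart; case: d.2; rewrite //= gpath_prev.
Qed.

Section HomotopyTheory.
Variables G H : graph.

Lemma homotopic_refl (f : gmap G H) : homotopic f f.
Proof.
exists (fun=> [::]); split=> [v /=|e]; first exact: eqxx.
by rewrite cats0; exact: hpath_refl.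
Qed.

Lemma homotopic_eq (f g : gmap G H) : f =1 g ->
  (forall e, hpath (ge f e) (ge g e)) -> homotopic f g.
Proof.
move=> fg fge; exists (fun=> [::]); split=> [v /=|e]; first by rewrite fg.
rewrite cats0; exact: fge.
Qed.

Lemma homotopic_sym (f g : gmap G H) : homotopic f g -> homotopic g f.
Proof.
case=> h [hw he]; exists (fun v => prev (h v)); split=> [v|e] /=.
  exact: walk_prev (hw v).
have := he e; move: (h (src e)) (h (tgt e)) => a b ab.
rewrite -{1}[ge g e]cat0s -(hpath_prev_l a) -!catA (catA a) -ab.
rewrite -catA hpath_prev_r cats0; exact: hpath_refl.
Qed.

Lemma homotopic_trans (f g k : gmap G H) :
  homotopic f g -> homotopic g k -> homotopic f k.
Proof.
case=> h [hw he] [h' [hw' he']].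
exists (fun v => h v ++ h' v); split=> [v|e]; first exact: walk_cat (hw v) _.
rewrite catA he -catA he' catA; exact: hpath_refl.
Qed.

Lemma homotopic_natural (f g : gmap G H) (h : vertex G -> seq (dart H)) :
  (forall e, hpath (ge f e ++ h (tgt e)) (h (src e) ++ ge g e)) ->
  forall u p v, walk u p v -> hpath (gpath f p ++ h v) (h u ++ gpath g p).
Proof.
move=> he; suff hd d : hpath (gdart f d ++ h (dend d)) (h (dorg d) ++ gdart g d).
  move=> u p v; elim: p u => [u /eqP->|d p IH u] /=.
    by rewrite cats0; exact: hpath_refl.
  case/andP=> /eqP<- /IH {}IH.
  rewrite /gpath /= -/(gpath f p) -/(gpath g p) -catA IH.
  rewrite catA hd catA; exact: hpath_refl.
case: d => e []; rewrite /gdart /dend /dorg /=; last exact: he.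
have := he e; move: (h (src e)) (h (tgt e)) => a b ab.
rewrite -{1}[a]cats0 -(hpath_prev_r (ge g e)) (catA a) -ab.
rewrite -!catA catA hpath_prev_l; exact: hpath_refl.
Qed.

End HomotopyTheory.

Lemma gcomp_homotopic G H K (g g' : gmap H K) (f f' : gmap G H) :
  homotopic g g' -> homotopic f f' -> homotopic (gcomp g f) (gcomp g' f').
Proof.
case=> h [hw he] [k [kw ke]].
apply: (@homotopic_trans _ _ _ (gcomp g f')).
  exists (fun v => gpath g (k v)); split=> [v|e] /=; first exact: gpath_walk.
  rewrite -!gpath_cat ke; exact: hpath_refl.
exists (fun v => h (f' v)); split=> [v|e] /=; first exact: hw.
exact: (homotopic_natural he) (ge_walk f' e).
Qed.

Lemma gid_walk G (e : edge G) : walk (src e) [:: (e, false)] (tgt e).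
Proof. by rewrite /= !eqxx. Qed.

Definition gid G : gmap G G := @Gmap G G id (fun e => [:: (e, false)]) (@gid_walk G).

Definition homotopy_equivalence G H (f : gmap G H) : Prop :=
  exists g : gmap H G,
    homotopic (gcomp g f) (gid G) /\ homotopic (gcomp f g) (gid H).

Lemma gpath_id G p : gpath (gid G) p = p.
Proof.
by elim: p => [//|[e []] p IH]; rewrite /gpath /= -/(gpath _ _) IH.
Qed.

Lemma gcomp_id_l G H (f : gmap G H) : homotopic (gcomp (gid H) f) f.
Proof. apply: homotopic_eq => // e /=; rewrite gpath_id; exact: hpath_refl. Qed.

Lemma gcomp_id_r G H (f : gmap G H) : homotopic (gcomp f (gid G)) f.
Proof. apply: homotopic_eq => // e /=; rewrite gpath1; exact: hpath_refl. Qed.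

Lemma gcompA G H K L (f : gmap K L) (g : gmap H K) (k : gmap G H) :
  homotopic (gcomp f (gcomp g k)) (gcomp (gcomp f g) k).
Proof. apply: homotopic_eq => // e /=; rewrite gpath_comp; exact: hpath_refl. Qed.

Lemma homotopy_equivalence_comp G H K (f : gmap H K) (g : gmap G H) :
  homotopy_equivalence f -> homotopy_equivalence g ->
  homotopy_equivalence (gcomp f g).
Proof.
suff aux A B C (a : gmap A B) (a' : gmap B A) (b : gmap B C) (b' : gmap C B) :
    homotopic (gcomp a' a) (gid A) -> homotopic (gcomp b' b) (gid B) ->
    homotopic (gcomp (gcomp a' b') (gcomp b a)) (gid A).
  by case=> f' [f'f ff'] [g' [g'g gg']]; exists (gcomp g' f'); split; apply: aux.
move=> a'a b'b; apply: homotopic_trans a'a.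
apply: homotopic_trans (homotopic_sym (gcompA _ _ _)) _.
apply: gcomp_homotopic (homotopic_refl _) _.
apply: homotopic_trans (gcompA _ _ _) _.
apply: homotopic_trans (gcomp_id_l _).
exact: gcomp_homotopic b'b (homotopic_refl _).
Qed.

Record giso (G H : graph) := Giso {
  iv : vertex G -> vertex H;
  ie : edge G -> edge H;
  iflip : edge G -> bool;
  iv_bij : bijective iv;
  ie_bij : bijective ie;
  iorg : forall d : dart G,
    dorg ((ie d.1, iflip d.1 (+) d.2) : dart H) = iv (dorg d) }.

Lemma giso_walk G H (f : giso G H) (e : edge G) :
  walk (iv f (src e)) [:: (ie f e, iflip f e)] (iv f (tgt e)).
Proof.
have /= := iorg f (e, false); rewrite addbF => -> /=.
have /= := iorg f (e, true); rewrite addbT /dend /drev /= => ->.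
by rewrite !eqxx.
Qed.

Coercion gmap_of_giso G H (f : giso G H) : gmap G H := 
  @Gmap G H (iv f) (fun e => [:: (ie f e, iflip f e)]) (giso_walk f).

Lemma giso_id_org G (d : dart G) : dorg ((d.1, false (+) d.2) : dart G) = dorg d.
Proof. by []. Qed.

Definition giso_id G : giso G G :=
  @Giso G G id id (fun=> false) (inv_bij (fun=> erefl)) (inv_bij (fun=> erefl))
    (@giso_id_org G).

Lemma giso_comp_org G H K (g : giso H K) (f : giso G H) (d : dart G) :
  dorg ((ie g (ie f d.1), (iflip g (ie f d.1) (+) iflip f d.1) (+) d.2) : dart K)
  = iv g (iv f (dorg d)).
Proof. by rewrite -iorg -iorg /= addbA. Qed.

Definition giso_comp G H K (g : giso H K) (f : giso G H) : giso G K :=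
  @Giso G K (iv g \o iv f) (ie g \o ie f)
    (fun e => iflip g (ie f e) (+) iflip f e)
    (bij_comp (iv_bij g) (iv_bij f)) (bij_comp (ie_bij g) (ie_bij f))
    (giso_comp_org g f).

Lemma gcomp_giso G H K (g : giso H K) (f : giso G H) :
  homotopic (giso_comp g f) (gcomp g f).
Proof.
apply: homotopic_eq => // e /=; rewrite /gpath /= cats0 /gdart /=.
by case: (iflip f e); rewrite ?addbT ?addbF; exact: hpath_refl.
Qed.

Lemma giso_inv G H (f : giso G H) : exists g : giso H G,
  [/\ homotopic (gcomp g f) (gid G), cancel (ie f) (ie g)
    & cancel (ie g) (ie f)].
Proof.
have [iv' ivK ivK'] := iv_bij f; have [ie' ieK ieK'] := ie_bij f.
have org (d : dart H) :
    dorg ((ie' d.1, iflip f (ie' d.1) (+) d.2) : dart G) = iv' (dorg d).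
  apply: (can_inj ivK); rewrite -iorg /= addbA addbb /= ieK' ivK'.
  by case: d.
exists (@Giso H G iv' ie' (fun e => iflip f (ie' e)) (Bijective ivK' ivK) (Bijective ieK' ieK) org); split=> //.
apply: homotopic_eq => [v|e] /=; first exact: ivK.
rewrite /gpath /= cats0 /gdart /= ieK.
by case: (iflip f e); rewrite ?/prev /= /drev /=; exact: hpath_refl.
Qed.

Definition rose (n : nat) : graph :=
  @Graph unit 'I_n (fun=> tt) (fun=> tt).

(* The elements of the free group F_n are represented by the edge-paths of    *)
(* the rose, up to [hpath].                                                   *)
Definition word (n : nat) : Type := seq (dart (rose n)).

Lemma rose_walk n u (p : word n) v : walk u p v.
Proof.
have tt_eq (x y : vertex (rose n)) : x == y by case: x; case: y.
by elim: p u => [|d p IH] u /=; rewrite ?tt_eq.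
Qed.

Definition rose_map n (phi : 'I_n -> word n) : gmap (rose n) (rose n) :=
  @Gmap (rose n) (rose n) id phi (fun e => @rose_walk n tt (phi e) tt).

(* [gpath (rose_map phi)] is the endomorphism of F_n with [i |-> phi i]. *)
Record free_aut (n : nat) := FreeAut {
  aut_gen :> 'I_n -> word n;
  aut_gen_inv : exists psi : 'I_n -> word n, forall i,
    hpath (gpath (rose_map aut_gen) (psi i)) [:: (i, false)] /\
    hpath (gpath (rose_map psi) (aut_gen i)) [:: (i, false)] }.

HB.instance Definition _ n := gen_eqMixin (free_aut n).
HB.instance Definition _ n := gen_choiceMixin (free_aut n).

(* Equality modulo inner automorphisms. *)
Definition outer_eq n (phi psi : free_aut n) : Prop :=
  exists w : word n, forall i, hpath (phi i) (w ++ psi i ++ prev w).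

Lemma outer_homotopic n (phi psi : free_aut n) :
  outer_eq phi psi <-> homotopic (rose_map phi) (rose_map psi).
Proof.
split=> [[w ww]|[h [_ he]]].
  exists (fun=> w); split=> [v|i] /=; first exact: rose_walk.
  rewrite ww -!catA hpath_prev_l cats0; exact: hpath_refl.
exists (h tt) => i; have /= := he i.
rewrite catA => <-; rewrite -catA hpath_prev_r cats0; exact: hpath_refl.
Qed.

Definition outer_eqb n : rel (free_aut n) := fun phi psi => `[< outer_eq phi psi >].

Lemma outer_eqb_refl n : reflexive (@outer_eqb n).
Proof. by move=> phi; apply/asboolP/outer_homotopic; exact: homotopic_refl. Qed.

Lemma outer_eqb_sym n : symmetric (@outer_eqb n).
Proof.
by move=> phi psi; apply/idP/idP => /asboolP/outer_homotopic h;
  apply/asboolP/outer_homotopic; exact: homotopic_sym.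
Qed.

Lemma outer_eqb_trans n : transitive (@outer_eqb n).
Proof.
move=> psi phi chi /asboolP/outer_homotopic h /asboolP/outer_homotopic h'.
by apply/asboolP/outer_homotopic; exact: homotopic_trans h h'.
Qed.

Canonical outer_equiv n :=
  EquivRel (@outer_eqb n) (@outer_eqb_refl n) (@outer_eqb_sym n)
           (@outer_eqb_trans n).

Definition Out (n : nat) : Type := {eq_quot @outer_equiv n}%qT.

HB.instance Definition _ n := Choice.on (Out n).
HB.instance Definition _ n := Quotient.on (Out n).
HB.instance Definition _ n := EqQuotient.on (Out n).

Lemma rose_map_aut n (phi : free_aut n) : homotopy_equivalence (rose_map phi).
Proof.
case: phi => phi [psi phipsi]; exists (rose_map psi).
by split; apply: homotopic_eq => // i; case: (phipsi i).
Qed.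

(* A chain of subgraphs [stratum 0], ..., [stratum depth], with the length    *)
(* function [mlen i] on [stratum i].  The values of [stratum i] and [mlen i]  *)
(* for [i > depth], and of [mlen i] off [stratum i], are irrelevant.          *)
Record strata (R : realType) (G : graph) := Strata {
  depth : nat;
  stratum : nat -> {set edge G};
  mlen : nat -> edge G -> R }.

Record strata_valid (R : realType) (G : graph) (s : strata R G) : Prop := {
  stratum_top : stratum s 0 = [set: edge G];
  stratum_core : forall i, (i < depth s)%N ->
    [/\ stratum s i.+1 \proper stratum s i, stratum s i.+1 != finset.set0
      & core (stratum s i.+1)];
  stratum_succ : forall i, (i < depth s)%N ->
    stratum s i.+1 = [set e in stratum s i | mlen s i e == 0];
  mlen_ge0 : forall i e, (i <= depth s)%N -> e \in stratum s i ->
    0 <= mlen s i e;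
  mlen_volume : forall i, (i <= depth s)%N ->
    \sum_(e in stratum s i) mlen s i e = 1;
  mlen_unique : forall e, exists! i,
    [/\ (i <= depth s)%N, e \in stratum s i & mlen s i e != 0] }.

Record marked_strata (R : realType) (n : nat) := MarkedStrata {
  mgraph : graph;
  marking : gmap (rose n) mgraph;
  mstrata :> strata R mgraph }.

(* The rank is n because the marking is a homotopy equivalence. *)
Record marked_valid (R : realType) (n : nat) (r : marked_strata R n) : Prop := {
  marked_connected : connected_graph (mgraph r);
  marked_valence : forall v, (3 <= valence [set: edge (mgraph r)] v)%N;
  marked_equivalence : homotopy_equivalence (marking r);
  marked_strata_valid : strata_valid r }.

Definition marked_iso (R : realType) (n : nat) (r r' : marked_strata R n) : Prop :=
  exists f : giso (mgraph r) (mgraph r'),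
    [/\ homotopic (gcomp f (marking r)) (marking r'),
        depth r = depth r',
        forall i, (i <= depth r)%N -> [set ie f e | e in stratum r i] = stratum r' i
      & forall i e, (i <= depth r)%N -> e \in stratum r i ->
          mlen r' i (ie f e) = mlen r i e].

Lemma marked_iso_refl R n (r : marked_strata R n) : marked_iso r r.
Proof.
exists (giso_id _); split=> // [|i _]; last by rewrite imset_id.
exact: gcomp_id_l.
Qed.

Lemma marked_iso_sym R n (r r' : marked_strata R n) :
  marked_iso r r' -> marked_iso r' r.
Proof.
case=> f [hf dE sE lE]; have [g [gf fK gK]] := giso_inv f.
exists g; split=> // [|i ile|i e ile].
- apply: homotopic_trans (gcomp_homotopic (homotopic_refl _) (homotopic_sym hf)) _.
  apply: homotopic_trans (gcompA _ _ _) _.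
  apply: homotopic_trans (gcomp_id_l _).
  exact: gcomp_homotopic gf (homotopic_refl _).
- rewrite -sE ?dE// -imset_comp -[RHS]imset_id.
  by apply: eq_imset => e /=; rewrite fK.
- rewrite -dE in ile; rewrite -sE// => /imsetP[e' e's ->].
  by rewrite fK lE.
Qed.

Lemma marked_iso_trans R n (r1 r2 r3 : marked_strata R n) :
  marked_iso r1 r2 -> marked_iso r2 r3 -> marked_iso r1 r3.
Proof.
case=> f [hf dE sE lE] [g [hg dE' sE' lE']].
exists (giso_comp g f); split=> [||i ile|i e ile es].
- apply: homotopic_trans hg.
  apply: homotopic_trans (gcomp_homotopic (homotopic_refl _) hf).
  apply: homotopic_trans (homotopic_sym (gcompA _ _ _)).
  exact: gcomp_homotopic (gcomp_giso _ _) (homotopic_refl _).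
- by rewrite dE.
- by rewrite /= imset_comp sE// sE'// -dE.
- by rewrite /= lE' ?lE -?dE// -sE// imset_f.
Qed.

(* Points are represented on graphs with vertices and edges numbered by       *)
(* ordinals; every finite graph is isomorphic to one of these.  Using all of  *)
(* [graph] here would put [marked_point] above the universe of [choiceType].  *)
Record numbered_graph := NumberedGraph {
  vsize : nat;
  esize : nat;
  nsrc : 'I_esize -> 'I_vsize;
  ntgt : 'I_esize -> 'I_vsize }.

Coercion graph_of_numbered (g : numbered_graph) : graph :=
  @Graph 'I_(vsize g) 'I_(esize g) (@nsrc g) (@ntgt g).

Record marked_point (R : realType) (n : nat) := MarkedPoint {
  pgraph : numbered_graph;
  pmarking : gmap (rose n) pgraph;
  pstrata : strata R pgraph;
  point_valid : marked_valid (MarkedStrata pmarking pstrata) }.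

Coercion marked_of_point R n (r : marked_point R n) : marked_strata R n :=
  MarkedStrata (pmarking r) (pstrata r).

HB.instance Definition _ R n := gen_eqMixin (marked_point R n).
HB.instance Definition _ R n := gen_choiceMixin (marked_point R n).

Definition point_eqb R n : rel (marked_point R n) :=
  fun r r' => `[< marked_iso r r' >].

Lemma point_eqb_refl R n : reflexive (@point_eqb R n).
Proof. by move=> r; apply/asboolP; exact: marked_iso_refl. Qed.

Lemma point_eqb_sym R n : symmetric (@point_eqb R n).
Proof.
by move=> r r'; apply/idP/idP => /asboolP h; apply/asboolP; exact: marked_iso_sym.
Qed.

Lemma point_eqb_trans R n : transitive (@point_eqb R n).
Proof.
move=> r2 r1 r3 /asboolP h /asboolP h'.
by apply/asboolP; exact: marked_iso_trans h h'.
Qed.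

Canonical point_equiv R n :=
  EquivRel (@point_eqb R n) (@point_eqb_refl R n) (@point_eqb_sym R n)
           (@point_eqb_trans R n).

(* The bordification of Outer space. *)
Definition Xhat (R : realType) (n : nat) : Type := {eq_quot @point_equiv R n}%qT.

HB.instance Definition _ R n := Choice.on (Xhat R n).
HB.instance Definition _ R n := Quotient.on (Xhat R n).
HB.instance Definition _ R n := EqQuotient.on (Xhat R n).

Definition point_class R n (r : marked_point R n) : Xhat R n := (\pi_(Xhat R n) r)%qT.

Section Contraction.
Variables (G : graph) (F : {set edge G}).

Definition fcomp (v : vertex G) : {set vertex G} := [set w | connect (adj F) v w].

Definition contract_vertex : finType :=
  {B : {set vertex G} | B \in [set fcomp v | v : vertex G]}.

Definition contract_edge : finType := {e : edge G | e \notin F}.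

Lemma fcomp_in (v : vertex G) : fcomp v \in [set fcomp w | w : vertex G].
Proof. by apply/imsetP; exists v. Qed.

Definition contract_class (v : vertex G) : contract_vertex := Sub (fcomp v) (fcomp_in v).

Definition contract : graph :=
  @Graph contract_vertex contract_edge
    (fun e => contract_class (src (val e))) (fun e => contract_class (tgt (val e))).

Definition collapse_edge (e : edge G) : seq (dart contract) :=
  if insub e : option contract_edge is Some e' then [:: (e', false)] else [::].

Lemma adj_sym : symmetric (adj F).
Proof. by move=> u v; apply: eq_existsb => e; rewrite orbC. Qed.

Lemma collapse_walk (e : edge G) :
  walk (contract_class (src e) : vertex contract) (collapse_edge e)
       (contract_class (tgt e)).
Proof.
rewrite /collapse_edge; case: insubP => [e' _ ee'|].
  by rewrite /= /dend /dorg /= ee' !eqxx.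
rewrite negbK => eF; apply/eqP/val_inj/setP => w /=; rewrite !inE.
apply: same_connect; first exact: sym_connect_sym adj_sym.
by apply: connect1; apply/existsP; exists e; rewrite eF !eqxx.
Qed.

Definition collapse : gmap G contract :=
  @Gmap G contract contract_class collapse_edge collapse_walk.

End Contraction.

Record marked_trivalent (n : nat) := MarkedTrivalent {
  tgraph :> graph;
  tmarking : gmap (rose n) tgraph;
  tgraph_connected : connected_graph tgraph;
  tgraph_trivalent : forall v, valence [set: edge tgraph] v = 3%N;
  tmarking_equivalence : homotopy_equivalence tmarking }.

Local Open Scope classical_set_scope.

Section Cells.
Variables (R : realType) (n : nat) (T : marked_trivalent n).

(* Coordinates of a point in the closed cell of T: the collapsed forest and   *)
(* the metrics on the quotient graph.                                         *)
Record cell_coord := CellCoord {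
  cforest : {set edge T};
  cstrata : strata R (contract cforest) }.

Definition coord_marked (a : cell_coord) : marked_strata R n :=
  MarkedStrata (gcomp (collapse (cforest a)) (tmarking T)) (cstrata a).

(* [a] is the coordinate of [x].  The marking makes it unique, up to the      *)
(* irrelevant values of [stratum] and [mlen].                                 *)
Definition coord_of (a : cell_coord) (x : Xhat R n) : Prop :=
  forest (cforest a) /\
  exists2 r : marked_point R n, point_class r = x & marked_iso (coord_marked a) r.

Definition clen (a : cell_coord) (i : nat) (e : edge T) : R :=
  if insub e : option (contract_edge (cforest a)) is Some e'
  then mlen (cstrata a) i e' else 0.

Definition cdefined (a : cell_coord) (C : {set edge T}) (i : nat) : bool :=
  [set e : edge (contract (cforest a)) | val e \in C]%SET \subset stratum (cstrata a) i.

Definition level (a : cell_coord) (C : {set edge T}) : nat :=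
  odflt ord0 [pick l : 'I_(depth (cstrata a)).+1 |
    cdefined a C l && [exists e in C, clen a l e != 0]].

Definition rel_len (a : cell_coord) (C : {set edge T}) (e : edge T) : R :=
  clen a (level a C) e / \sum_(e' in C) clen a (level a C) e'.

Definition dist_at (C : {set edge T}) (a b : cell_coord) : R :=
  \sum_(e in C) `|rel_len a C e - rel_len b C e|.

Definition cell_dist (a b : cell_coord) : R :=
  \sum_(C : {set edge T} |
        ((C != finset.set0) && core C) || (C == [set: edge T]%SET)) dist_at C a b.

Definition cell_open (U : set (Xhat R n)) : Prop :=
  forall a x, coord_of a x -> U x ->
    exists2 eps : R, 0 < eps &
      forall b y, coord_of b y -> cell_dist a b < eps -> U y.

End Cells.

(* The weak topology: a set is open (equivalently, closed) if and only if its *)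
(* trace on each closed cell is.                                              *)
Definition Xhat_open (R : realType) (n : nat) (U : set (Xhat R n)) : Prop :=
  forall T : marked_trivalent n, cell_open T U.

Lemma Xhat_openT R n : Xhat_open [set: Xhat R n].
Proof. by move=> T a x _ _; exists 1. Qed.

Lemma Xhat_openI R n : setI_closed (@Xhat_open R n).
Proof.
move=> U V oU oV T a x ax [Ux Vx].
have [e e0 eU] := oU T a x ax Ux; have [d d0 dV] := oV T a x ax Vx.
exists (Num.min e d); first by rewrite lt_min e0.
by move=> b y bY; rewrite lt_min => /andP[/(eU b y bY)? /(dV b y bY)?].
Qed.

Lemma Xhat_open_bigU R n (I : Type) (f : I -> set (Xhat R n)) :
  (forall i, Xhat_open (f i)) -> Xhat_open (\bigcup_i f i).
Proof.
move=> of_ T a x ax [i _ fix_]; have [e e0 eU] := of_ i T a x ax fix_.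
by exists e => // b y bY /(eU b y bY) fy; exists i.
Qed.

HB.instance Definition _ (R : realType) (n : nat) :=
  isOpenTopological.Build (Xhat R n) (@Xhat_openT R n) (@Xhat_openI R n)
    (@Xhat_open_bigU R n).

Section Action.
Variables (R : realType) (n : nat).

Definition remark (r : marked_strata R n) (phi : 'I_n -> word n) : marked_strata R n :=
  MarkedStrata (gcomp (marking r) (rose_map phi)) (mstrata r).

Lemma remark_valid (r : marked_point R n) (phi : free_aut n) :
  marked_valid (remark r phi).
Proof.
case: r => g m s [conn val3 equ str]; split=> //=.
exact: homotopy_equivalence_comp equ (rose_map_aut phi).
Qed.

Definition point_act (r : marked_point R n) (phi : free_aut n) : marked_point R n :=
  @MarkedPoint R n (pgraph r) (gcomp (pmarking r) (rose_map phi)) (pstrata r)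
    (remark_valid r phi).

(* Precomposition of the marking gives a right action. *)
Definition out_act (x : Xhat R n) (phi : Out n) : Xhat R n :=
  point_class (point_act (repr x) (repr phi)).

Lemma out_act_class (r : marked_point R n) (phi : free_aut n) :
  out_act (point_class r) (\pi_(Out n) phi)%qT = point_class (point_act r phi).
Proof.
rewrite /out_act /point_class; apply/eqquotP/asboolP.
set r' := repr _; set phi' := repr _.
have /eqquotP/asboolP [f [hf dE sE lE]] : (\pi_(Xhat R n) r' = \pi_(Xhat R n) r)%qT.
  by rewrite reprK.
have /eqquotP/asboolP/outer_homotopic h :
    (\pi_(Out n) phi' = \pi_(Out n) phi)%qT by rewrite reprK.
exists f; split=> //=.
by apply: homotopic_trans (gcompA _ _ _) _; exact: gcomp_homotopic.
Qed.

End Action.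

Section Subspaces.
Variables (R : realType) (n : nat).

Definition Xn : set (Xhat R n) :=
  [set point_class r | r in [set r : marked_point R n | depth r = 0%N]].

Definition Yn : set (Xhat R n) :=
  [set point_class r | r in [set r : marked_point R n | depth r = 0%N /\
     forall e, ~~ separating [set: edge (mgraph r)]%SET e]].

Definition Yhat : set (Xhat R n) := closure Yn.

Definition boundary_Xhat : set (Xhat R n) := ~` Xn.

Definition boundary_Yhat : set (Xhat R n) := Yhat `\` Yn.

Definition Yn_cut : set (Xhat R n) :=
  [set point_class r | r in [set r : marked_point R n |
     [/\ depth r = 0%N,
         forall e, ~~ separating [set: edge (mgraph r)]%SET e
       & exists v : vertex (mgraph r), cut_vertex v]]].

End Subspaces.

(* [H (x, t)] is only meaningful for t in [0, 1]; A is fixed pointwise        *)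
(* throughout the homotopy.                                                   *)
Record deformation_retraction (R : realType) (X : topologicalType) (A : set X)
    (H : X * R -> X) : Prop := {
  defret_continuous :
    {within [set p : X * R | 0 <= p.2 <= 1], continuous H};
  defret_start : forall x, H (x, 0) = x;
  defret_end : forall x, A (H (x, 1));
  defret_fixed : forall x t, A x -> 0 <= t <= 1 -> H (x, t) = x }.

(* Main.v *)
(* The separating edges of Gamma_0 are shrunk linearly, from their total length s to
   (1 - t) s, and the nonseparating core receives the remaining volume 1 - (1 - t) s,
   distributed in proportion to its relative metric, i.e. the restriction of m_0 if
   s < 1, and m_1 if s = 1.  Hence a point of the boundary whose m_0 is carried by
   separating edges moves up one stratum as soon as t > 0, and at t = 1 the separating
   edges, which form a forest, are collapsed.  Inside a closed cell the relative metric
   on a core subgraph C is constant along the flow, and the metric on the whole graph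
   is a Lipschitz function of t and of the relative metrics on the whole graph and on
   its nonseparating core.  So the flow is Lipschitz in t and the distance of the cell;
   compactness of time intervals then gives joint continuity for the weak topology.
   The closure of Y_n consists of the points with no separating edge in Gamma_0: such a
   point is the limit of the metrics proportional to the sum of the d^i m_i as d tends
   to 0.  The boundary points that flow into Y_n have depth 1 and s = 1; collapsing a
   bridge makes a cut vertex, and conversely splitting a cut vertex produces a bridge,
   to which m_0 is given. *)

From Corelib Require Setoid Morphisms.
From mathcomp Require Import all_boot all_order all_algebra.
From mathcomp Require Import all_classical all_reals all_analysis.
From mathcomp Require Import fintype finset.
From mathcomp Require Import ring lra zify.
Require Import Defs.
Import Order.TTheory GRing.Theory Num.Theory.
Import numFieldNormedType.Exports.
Set Implicit Arguments.
Unset Strict Implicit.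
Unset Printing Implicit Defensive.
Local Open Scope ring_scope.

(** * Connectivity and forests *)

(** A point is a class of numbered graphs, while the cell distance lives on a trivalent graph that
    merely collapses onto such a graph. The flow therefore has to be one formula that makes sense on
    every graph presenting a point. This is the purpose of [presents]: levels and lengths on any
    marked graph, the edges of length 0 being a forest to collapse. A surviving edge is a bridge
    before a collapse exactly when it is one after it, so the formula commutes with collapses, and
    [presents_inj] turns equal data into equal points. Independence of the representative,
    equivariance and the description in a cell all come from these two facts.

    A bridge of positive length always has level 0, since deeper strata are cores. The sudden drop
    of a level when t leaves 0 does no harm because the distance compares only ratios of lengths
    inside each core.

    The weak topology is tested cell by cell, but the product with the time interval is not given in
    this form. So the neighbourhood of a point is taken to be the set of all points whose flow stays
    in a given open set during a whole compact interval; its openness can be tested in one cell at a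
    time. *)

Section Connectivity.
Variable G : graph.
Implicit Types (C D F : {set edge G}) (u v : vertex G) (p : seq (dart G)).

Definition path_in C p := all (fun d : dart G => d.1 \in C) p.

Lemma path_in_cat C p q : path_in C (p ++ q) = path_in C p && path_in C q.
Proof. exact: all_cat. Qed.

Lemma path_in_prev C p : path_in C (prev p) = path_in C p.
Proof. by rewrite /path_in /prev all_rev all_map; apply: eq_all => -[]. Qed.

Lemma path_inS C D p : C \subset D -> path_in C p -> path_in D p.
Proof. by move=> /fintype.subsetP CD; apply: sub_all => d; exact: CD. Qed.

Lemma adj_dart C (d : dart G) : d.1 \in C -> adj C (dorg d) (dend d).
Proof.
move=> dC; apply/existsP; exists d.1; rewrite dC /dend /dorg /drev /=.
by case: d.2; rewrite /= !eqxx ?orbT.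
Qed.

Lemma adjP C u v :
  reflect (exists d : dart G, [/\ d.1 \in C, dorg d = u & dend d = v]) (adj C u v).
Proof.
apply: (iffP idP) => [/existsP[e /andP[eC]] | [d [dC <- <-]]]; last exact: adj_dart.
case/orP=> /andP[/eqP eu /eqP ev]; [exists (e, false)|exists (e, true)].
  by [].
by [].
Qed.

Lemma connect_walkP C u v :
  reflect (exists2 p, walk u p v & path_in C p) (connect (adj C) u v).
Proof.
apply: (iffP idP) => [/connectP[s + ->]|[p]].
  elim: s u => [|w s IH] u /=; first by exists [::] => /=.
  case/andP=> /adjP[d [dC <- <-]] /IH[p pw pC].
  by exists (d :: p) => /=; rewrite ?eqxx ?dC.
elim: p u => [|d p IH] u /=; first by move=> /eqP-> _; exact: connect0.
case/andP=> /eqP<- pw /andP[dC pC]; apply: connect_trans (IH _ pw pC).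
exact/connect1/adj_dart.
Qed.

Lemma connect_adjC C : connect_sym (adj C).
Proof. exact/sym_connect_sym/adj_sym. Qed.

Lemma connect_adjS C D u v : C \subset D ->
  connect (adj C) u v -> connect (adj D) u v.
Proof.
move=> CD /connect_walkP[p pw pC]; apply/connect_walkP; exists p => //.
exact: path_inS pC.
Qed.

Lemma connect_edge C e : e \in C -> connect (adj C) (src e) (tgt e).
Proof. by move=> eC; apply/connect1/(@adj_dart C (e, false)). Qed.

Lemma connect_dart C (d : dart G) :
  d.1 \in C -> connect (adj C) (dorg d) (dend d).
Proof. by move=> dC; apply/connect1/adj_dart. Qed.

Lemma connect_org_end C (d : dart G) :
  connect (adj C) (dorg d) (dend d) = connect (adj C) (src d.1) (tgt d.1).
Proof. by case: d => e []; rewrite /dend /dorg //= connect_adjC. Qed.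

(** The usual way below to disprove connectivity: a Boolean [P] cuts the vertices in two, and no
    edge of [C] crosses the cut. *)
Lemma connect_invariant (T : eqType) (P : vertex G -> T) C u v :
  (forall e, e \in C -> P (src e) = P (tgt e)) ->
  connect (adj C) u v -> P u = P v.
Proof.
move=> Pe /connect_walkP[p]; elim: p u => [|d p IH] u /=; first by move/eqP->.
case/andP=> /eqP<- pw /andP[dC pC]; rewrite -(IH _ pw pC).
by case: d dC {pw} => e [] /= /Pe; rewrite /dend /dorg /=.
Qed.

Lemma connect_remove C e u v :
  connect (adj (C :\ e)) (src e) (tgt e) ->
  connect (adj C) u v -> connect (adj (C :\ e)) u v.
Proof.
move=> ce cuv; rewrite -(connect_invariant (P := connect (adj (C :\ e)) u) _ cuv)//.
move=> f fC; apply: (same_connect_r (connect_adjC _)).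
have [->//|fe] := eqVneq f e.
by apply: connect_edge; rewrite !inE fe.
Qed.

Lemma separatingE C e : e \in C ->
  separating C e = ~~ connect (adj (C :\ e)) (src e) (tgt e).
Proof.
move=> eC; rewrite /separating eC /=; apply/existsP/idP => [[u /existsP[v]]|ce].
  by case/andP=> cuv; apply: contra => ce; exact: connect_remove cuv.
by exists (src e); apply/existsP; exists (tgt e); rewrite connect_edge.
Qed.

(** The condition on valences is automatic: once the only edge at a vertex of valence 1 is removed,
    that vertex is isolated, so the edge was separating. *)
Lemma coreP C :
  reflect (forall e, e \in C -> connect (adj (C :\ e)) (src e) (tgt e)) (core C).
Proof.
apply: (iffP andP) => [[/forallP sC _] e eC|cC].
  by have := sC e; rewrite eC separatingE// negbK.
split; first by apply/forallP => e; apply/implyP => eC; rewrite separatingE ?negbK ?cC.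
apply/forallP => v; apply/negP => /eqP v1.
have [e /andP[eC ev]|none] := pickP (fun e => (e \in C) && (0 < (src e == v) + (tgt e == v))%N);
  last first.
  move: v1; rewrite /valence big1// => e eC; apply/eqP.
  by have := none e; rewrite eC /= lt0n => /negbFE.
move: v1; rewrite /valence (bigD1 e)//=.
case E: ((_ + _)%N) ev => [//|[|//]] _ [/eqP].
rewrite sum_nat_eq0 => /forallP v0.
pose P (w : vertex G) := w == v.
have : P (src e) = P (tgt e).
  apply: (connect_invariant _ (cC _ eC)) => f; rewrite !inE => /andP[fe fC].
  have := v0 f; rewrite fe fC /= addn_eq0 !eqb0 => /andP[/negbTE fs /negbTE ft].
  by rewrite /P fs ft.
by rewrite /P; move: E; do 2!case: eqP.
Qed.

Lemma connect_setD1 C e u v : e \in C -> connect (adj C) u v ->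
  ~~ connect (adj (C :\ e)) u v ->
  (connect (adj (C :\ e)) u (src e) && connect (adj (C :\ e)) (tgt e) v) ||
  (connect (adj (C :\ e)) u (tgt e) && connect (adj (C :\ e)) (src e) v).
Proof.
move=> eC cuv ncuv; set r := connect (adj (C :\ e)).
have rsym x y : r x y = r y x by rewrite /r connect_adjC.
have rtr : transitive r by exact: connect_trans.
have step f : f \in C -> f != e -> r (src f) (tgt f).
  by move=> fC fe; apply: connect_edge; rewrite !inE fe.
(* [P] describes the vertices reached from [u] by crossing [e] at most once; no edge of [C] leaves
   this set. *)
pose P w := r u w || (r u (src e) && r (tgt e) w) || (r u (tgt e) && r (src e) w).
have : P u = P v.
  apply: connect_invariant cuv => f fC; rewrite /P.
  have [->|fe] := eqVneq f e; last first.
    have sf w : r w (src f) = r w (tgt f).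
      exact: (same_connect_r (@connect_adjC _) (step f fC fe) w).
    by rewrite !sf.
  rewrite /r !connect0 !andbT.
  by case: (connect _ u (src e)); case: (connect _ u (tgt e)); rewrite ?orbT.
rewrite {1}/P {1}/r connect0 /= => /esym; rewrite /P.
by rewrite [r u v](negbTE ncuv).
Qed.

End Connectivity.

Section Forests.
Variable G : graph.
Implicit Types (C D F : {set edge G}) (u v : vertex G) (p : seq (dart G)).

Definition bridges : {set edge G} := [set e | separating [set: edge G] e].

Lemma bridgesE e :
  (e \in bridges) = ~~ connect (adj ([set: edge G] :\ e)) (src e) (tgt e).
Proof. by rewrite inE separatingE ?inE. Qed.

Lemma core_nonbridge C e : core C -> e \in C -> e \notin bridges.
Proof.
move=> /coreP cC eC; rewrite bridgesE negbK.
by apply: connect_adjS (cC e eC); apply: setSD; exact: subsetT.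
Qed.

(** The point is that deleting all bridges together creates no new bridge. They are deleted one by
    one, and a nonbridge [e] keeps a cycle through it at each stage. *)
Lemma core_bridgesC : core (~: bridges).
Proof.
apply/coreP => e; rewrite inE => eN.
suff aux (s : seq (edge G)) : {subset s <= bridges} ->
    connect (adj (~: [set f in s] :\ e)) (src e) (tgt e).
  have -> : bridges = [set f in enum bridges] by apply/setP => f; rewrite inE mem_enum.
  by apply: aux => f; rewrite mem_enum.
elim: s => [_|a s IH sub].
  move: eN; rewrite bridgesE negbK; congr connect.
  by congr (adj (_ :\ _)); apply/setP => f; rewrite !inE.
have aB : a \in bridges by apply: sub; rewrite inE eqxx.
have ae : a != e by apply: contraNneq eN => <-.
have {}IH : connect (adj (~: [set f in s] :\ e)) (src e) (tgt e).
  by apply: IH => f fs; apply: sub; rewrite inE fs orbT.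
have -> : ~: [set f in a :: s] :\ e = (~: [set f in s] :\ e) :\ a.
  by apply/setP => f; rewrite !inE negb_or; case: (f != a); rewrite ?andbF.
set C := ~: _ :\ e in IH *.
have [aC|aC] := boolP (a \in C); last first.
  rewrite (_ : C :\ a = C)//; apply/setP => f; rewrite in_setD1.
  by have [->|//] := eqVneq f a; rewrite (negbTE aC).
(* Otherwise the path joining the ends of [e] crosses [a]; its two halves and [e] then join the ends
   of [a] without using [a], against [a] being a bridge. *)
apply/negPn/negP => /(connect_setD1 aC IH) H.
move: aB; rewrite bridgesE => /negP; apply.
have sub' : C :\ a \subset [set: edge G] :\ a by apply: setSD; exact: subsetT.
have ce : connect (adj ([set: edge G] :\ a)) (src e) (tgt e).
  by apply: connect_edge; rewrite !inE eq_sym ae.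
case/orP: H => /andP[/(connect_adjS sub') h1 /(connect_adjS sub') h2].
  rewrite connect_adjC; apply: connect_trans h2 _.
  by rewrite connect_adjC; apply: connect_trans ce; rewrite connect_adjC.
apply: connect_trans h2 _; apply: connect_trans h1.
by rewrite connect_adjC.
Qed.

Definition acyclic F : bool :=
  [forall e in F, ~~ connect (adj (F :\ e)) (src e) (tgt e)].

Lemma acyclicP F :
  reflect (forall e, e \in F -> ~~ connect (adj (F :\ e)) (src e) (tgt e)) (acyclic F).
Proof.
by apply: (iffP forallP) => h e; [move=> eF; have := h e; rewrite eF|apply/implyP/h].
Qed.

Lemma acyclicS F D : D \subset F -> acyclic F -> acyclic D.
Proof.
move=> DF /acyclicP aF; apply/acyclicP => e eD.
apply: contra (aF e (fintype.subsetP DF _ eD)); apply: connect_adjS; exact: setSD.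
Qed.

Lemma acyclic0 : acyclic set0.
Proof. by apply/acyclicP => e; rewrite inE. Qed.

Lemma acyclic_bridges : acyclic bridges.
Proof.
apply/acyclicP => e; rewrite bridgesE; apply: contra; apply: connect_adjS.
by apply: setSD; exact: subsetT.
Qed.

Lemma core_not_acyclic C F : core C -> C != set0 -> acyclic F -> ~~ (C \subset F).
Proof.
move=> /coreP cC /set0Pn[e eC] aF; apply/negP => CF.
have /acyclicP/(_ e eC) := acyclicS CF aF.
by rewrite cC.
Qed.

Lemma connect_uniq_walk C u v : connect (adj C) u v ->
  exists p, [/\ walk u p v, path_in C p & uniq (map fst p)].
Proof.
case/connectP => s0 ps0 ->; case/shortenP: ps0 => s ps us _.
(* The induction carries the fact that all darts have their ends on the simple vertex path: an edge
   used twice would revisit [u]. *)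
suff [p [wp pC up _]] : exists p, [/\ walk u p (last u s), path_in C p,
    uniq (map fst p) & all (fun d => (dorg d \in u :: s) && (dend d \in u :: s)) p].
  by exists p.
elim: s u ps us => [|w s IH] u; first by exists [::] => /=; rewrite eqxx.
move=> /= /andP[/adjP[d [dC du dw]] ps].
rewrite -[(u \notin _) && _]/((u \notin w :: s) && uniq (w :: s)) => /andP[us uws].
have [p [wp pC up /allP ap]] := IH w ps uws.
exists (d :: p); split => /=.
- by rewrite du eqxx dw.
- by rewrite dC.
- rewrite up andbT; apply/mapP => -[d' d'p dd'].
  have ud' : u = dorg d' \/ u = dend d'.
    move: du; case: d d' dd' {dC dw d'p} => [e b] [e' b'] /= -> <-.
    by rewrite /dend /dorg /=; case: b b' => -[] /=; auto.
  by have /andP[h1 h2] := ap d' d'p; case: ud' us => ->; rewrite ?h1 ?h2.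
- rewrite du dw !inE !eqxx orbT /=; apply/allP => d' /ap /andP[h1 h2].
  by rewrite !(@in_cons _ u) h1 h2 !orbT.
Qed.

End Forests.

Section Loops.
Variable G : graph.
Implicit Types (C D F : {set edge G}) (u v : vertex G) (p : seq (dart G)).

#[global] Instance cons_hpath (d : dart G) :
  Morphisms.Proper (Morphisms.respectful (@hpath G) (@hpath G)) (cons d).
Proof. by move=> p q pq; rewrite -cat1s pq; exact: hpath_refl. Qed.

(** A closed walk in a forest has to return through its first edge. At the first return the edge is
    crossed backwards, as crossing it forwards would close a cycle; the pieces between and after the
    two crossings are shorter closed walks. *)
Lemma acyclic_hpath F u p : acyclic F -> walk u p u -> path_in F p -> hpath p [::].
Proof.
move=> /acyclicP aF; have [k] := ubnP (size p).
elim: k u p => // k IH u [|d p]; first by move=> *; exact: hpath_refl.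
rewrite /= ltnS => sp /andP[/eqP du pw] /andP[dF pF].
have [] := boolP (has (fun d' : dart G => d'.1 == d.1) p); last first.
  move=> /hasPn dp; have := aF _ dF; rewrite -connect_org_end => /negP[].
  rewrite connect_adjC du; apply/connect_walkP; exists p => //.
  by apply/allP => d' d'p; rewrite !inE dp//= (allP pF).
rewrite has_find => dp; set i := find _ p in dp.
have d1 : (nth d p i).1 == d.1.
  by apply: (nth_find d (a := fun d' : dart G => d'.1 == d.1)); rewrite has_find.
have ni : path_in (F :\ d.1) (take i p).
  apply/allP => d' d'p; rewrite !inE (allP pF) ?(mem_take d'p)// andbT.
  apply/negP => /eqP dd'.
  have si : (index d' (take i p) < i)%N.
    by rewrite -{2}(size_takel (ltnW dp)) index_mem.
  have := before_find d si; rewrite /= -(nth_take d si) nth_index//.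
  by rewrite dd' eqxx.
move: pw pF sp; rewrite -{1 2 3 4}(cat_take_drop i p) (drop_nth d dp).
move: (take i p) (drop i.+1 p) (nth d p i) d1 ni => {i dp p} p1 p2 d' /eqP dd' p1F.
have split_walk x p q y : walk x (p ++ q) y -> exists2 w, walk x p w & walk w q y.
  elim: p x => [|a p IHp] x /=; first by exists x.
  by case/andP=> -> /IHp[w pw qw]; exists w.
case/split_walk => w p1w /= /andP[/eqP d'w p2w].
rewrite path_in_cat /= size_cat /= => /andP[p1F' /andP[d'F p2F]] sp.
have [d'E|d'E] : d' = d \/ d' = drev d.
  by case: d d' dd' {du p1w d'w p2w d'F p2F p1F dF} => e b [e' b'] /= ->;
    case: b b' => -[]; auto.
  have /negP[] := aF _ dF; rewrite -connect_org_end connect_adjC.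
  have -> : dorg d = w by rewrite -d'w d'E.
  by apply/connect_walkP; exists p1.
have wE : w = dend d by rewrite -d'w d'E.
rewrite wE in p1w.
have p1_0 : hpath p1 [::].
  apply: IH p1w p1F'; apply: leq_ltn_trans sp; exact: leq_addr.
have p2_0 : hpath p2 [::].
  rewrite d'E dend_drev du in p2w; apply: IH p2w p2F.
  apply: leq_ltn_trans sp; exact: leq_trans (leqnSn _) (leq_addl _ _).
rewrite p1_0 p2_0 d'E; exact: (hpath_cancel [::] d [::]).
Qed.

(** The coefficient of [e] in the 1-chain of [p], an invariant of edge-path homotopy. *)
Definition crossings (e : edge G) p : int :=
  \sum_(d <- p | d.1 == e) (if d.2 then -1 else 1).

Lemma hpath_crossings e p q : hpath p q -> crossings e p = crossings e q.
Proof.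
elim: p q / => [//|//|p q r _ -> _ ->//|p d q].
rewrite /crossings !big_cat !big_cons /=; congr (_ + _).
by case: eqP => // _; case: d.2 => /=; ring.
Qed.

(** If the ends of [e] were joined in [F] without [e], the resulting loop would cross [e] exactly
    once and so have a nonzero coefficient there. *)
Lemma acyclic_loops F :
  (forall u p, walk u p u -> path_in F p -> hpath p [::]) -> acyclic F.
Proof.
move=> triv; apply/acyclicP => e eF; apply/negP => /connect_walkP[p pw pF].
have w : walk (tgt e) ((e, true) :: p) (tgt e) by rewrite /= eqxx.
have pF' : path_in F ((e, true) :: p).
  by rewrite /= eF; apply: path_inS pF; exact: subsetDl.
have /(hpath_crossings e) := triv _ _ w pF'.
rewrite /crossings big_cons big_nil /= eqxx big1_seq ?addr0// => d /andP[/eqP de /(allP pF)].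
by rewrite de !inE eqxx.
Qed.

Lemma forestP F : forest F <-> acyclic F.
Proof.
split=> [fF|/acyclicP aF v [//|d p] _ /= /andP[/eqP<- pw] /andP[dF pF]].
  apply/acyclicP => e eF; apply/negP => /connect_uniq_walk[p [pw pF up]].
  have w : walk (tgt e) ((e, true) :: p) (tgt e) by rewrite /= eqxx.
  have pF' : path_in F ((e, true) :: p).
    by rewrite /= eF; apply: path_inS pF; exact: subsetDl.
  have /negP := fF _ ((e, true) :: p) isT w pF'; apply.
  rewrite /= up andbT; apply/mapP => -[d /(allP pF) + /= de].
  by rewrite -de !inE eqxx.
apply/negP => /andP[dp _]; have /negP[] := aF _ dF.
rewrite -connect_org_end connect_adjC; apply/connect_walkP; exists p => //.
apply/allP => d' d'p; rewrite !inE (allP pF)// andbT.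
by apply: contraNneq dp => <-; exact: map_f.
Qed.

End Loops.

(* A map collapsing each component of the subgraph outside the image of [ci]  *)
(* to a vertex; [ci] and [cfl] identify the edges of H with the other edges.  *)
Record collapsing (G H : graph) := Collapsing {
  cv : vertex G -> vertex H;
  ci : edge H -> edge G;
  cfl : edge H -> bool;
  ci_inj : injective ci;
  cv_surj : forall w, exists v, cv v = w;
  cv_fiber : forall u v,
    (cv u == cv v) = connect (adj (~: [set ci e | e : edge H])) u v;
  cv_org : forall d : dart H,
    cv (dorg ((ci d.1, cfl d.1 (+) d.2) : dart G)) = dorg d }.

Section Collapsing.
Variables (G H : graph) (c : collapsing G H).

Definition collapsed : {set edge G} := ~: [set ci c e | e : edge H].

Definition cdart (d : dart H) : dart G := (ci c d.1, cfl c d.1 (+) d.2).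

Lemma ci_ncollapsed e : ci c e \notin collapsed.
Proof. by rewrite inE negbK imset_f. Qed.

Lemma collapsedP (e : edge G) : e \in collapsed \/ exists e', e = ci c e'.
Proof.
rewrite inE; case: imsetP => [[e' _ ->]|]; last by left.
by right; exists e'.
Qed.

Lemma cv_end d : cv c (dend (cdart d)) = dend d.
Proof. by have := cv_org c (drev d); rewrite /= addbN. Qed.

Lemma cv_collapsed e : e \in collapsed -> cv c (src e) = cv c (tgt e).
Proof. by move=> eF; apply/eqP; rewrite cv_fiber; exact: connect_edge. Qed.

Lemma cv_src e : cv c (src (ci c e)) = dorg ((e, cfl c e) : dart H).
Proof. by rewrite -(cv_org c) /= addbb. Qed.

Lemma cv_tgt e : cv c (tgt (ci c e)) = dend ((e, cfl c e) : dart H).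
Proof. by rewrite -cv_end /cdart /dend /drev /= addbb. Qed.

Lemma collapsedS (D : {set edge H}) : collapsed \subset ~: (ci c @: D).
Proof. by rewrite setCS; apply/imsetS/fintype.subsetP. Qed.

(** Stated with complements, since the preimage in G of the subgraph [~: D] contains all the
    collapsed edges. *)
Lemma connect_collapse (D : {set edge H}) u v :
  connect (adj (~: D)) (cv c u) (cv c v) = connect (adj (~: (ci c @: D))) u v.
Proof.
have fib x y : cv c x = cv c y -> connect (adj (~: (ci c @: D))) x y.
  move=> /eqP; rewrite cv_fiber; apply: connect_adjS; exact: collapsedS.
apply/idP/idP => [/connect_walkP[p]|].
  elim: p u => [u /eqP/fib//|d p IH u] /= /andP[/eqP du pw] /andP[dD pD].
  have ud : connect (adj (~: (ci c @: D))) u (dorg (cdart d)).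
    by apply: fib; rewrite cv_org.
  apply: connect_trans ud _; apply: connect_trans (connect_dart _) (IH _ _ pD).
    by move: dD; rewrite /= !inE (mem_imset _ _ (@ci_inj _ _ c)).
  by rewrite cv_end.
move=> uv; rewrite -(connect_invariant (P := fun w => connect (adj (~: D)) (cv c u) (cv c w)) _ uv).
  exact: connect0.
move=> e; have [/cv_collapsed ->//|[e' ->]] := collapsedP e.
rewrite inE (mem_imset _ _ (@ci_inj _ _ c)) => e'D.
apply: (same_connect_r (@connect_adjC _ _)); rewrite cv_src cv_tgt.
by apply: connect_dart; rewrite inE.
Qed.

Lemma connect_lift (D : {set edge H}) e :
  connect (adj D) (src e) (tgt e) =
  connect (adj (collapsed :|: ci c @: D)) (src (ci c e)) (tgt (ci c e)).
Proof.
have -> : collapsed :|: ci c @: D = ~: (ci c @: ~: D).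
  apply/setP => f; rewrite in_setU; have [fF|[f' ->]] := collapsedP f.
    by rewrite fF (fintype.subsetP (collapsedS _) _ fF).
  by rewrite (negbTE (ci_ncollapsed _)) in_setC !(mem_imset _ _ (@ci_inj _ _ c)) inE negbK.
by rewrite -connect_collapse setCK cv_src cv_tgt connect_org_end.
Qed.

Lemma separating_collapse e :
  separating [set: edge H] e = separating [set: edge G] (ci c e).
Proof.
rewrite !separatingE ?inE// !setTD.
have := connect_collapse [set e] (src (ci c e)) (tgt (ci c e)).
by rewrite imset_set1 cv_src cv_tgt connect_org_end => ->.
Qed.

Lemma connected_collapse : connected_graph H = connected_graph G.
Proof.
have TC K : [set: edge K] = ~: set0 by apply/setP => e; rewrite !inE.
apply/forallP/forallP => h u; apply/forallP => v.
  have := forallP (h (cv c u)) (cv c v).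
  by rewrite !TC connect_collapse imset0.
have [u' <-] := cv_surj c u; have [v' <-] := cv_surj c v.
by have := forallP (h u') v'; rewrite !TC connect_collapse imset0.
Qed.

Definition cpath (e : edge G) : seq (dart H) :=
  if [pick e' | ci c e' == e] is Some e' then [:: (e', cfl c e')] else [::].

Lemma cpath_ci e : cpath (ci c e) = [:: (e, cfl c e)].
Proof.
by rewrite /cpath; case: pickP => [e' /eqP/ci_inj->//|/(_ e)]; rewrite eqxx.
Qed.

Lemma cpath_collapsed e : e \in collapsed -> cpath e = [::].
Proof.
rewrite /cpath; case: pickP => // e' /eqP<-.
by rewrite (negbTE (ci_ncollapsed e')).
Qed.

Lemma cpath_walk e : walk (cv c (src e)) (cpath e) (cv c (tgt e)).
Proof.
have [eF|[e' ->]] := collapsedP e; first by rewrite cpath_collapsed//= cv_collapsed.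
by rewrite cpath_ci cv_src cv_tgt /= !eqxx.
Qed.

Definition gmap_of_collapsing : gmap G H := @Gmap G H (cv c) cpath cpath_walk.

End Collapsing.

Coercion gmap_of_collapsing : collapsing >-> gmap.

Section CollapsingTheory.

Lemma gdart_cdart G H (c : collapsing G H) d : gdart c (cdart c d) = [:: d].
Proof.
by case: d => e b; rewrite /gdart /cdart /= cpath_ci /=; case: b; case: (cfl c e).
Qed.

Lemma gpath_collapsed G H (c : collapsing G H) p :
  path_in (collapsed c) p -> gpath c p = [::].
Proof.
elim: p => [//|d p IH] /= /andP[dF /IH]; rewrite /gpath /= => ->.
by rewrite cats0 /gdart /= cpath_collapsed//; case: d.2.
Qed.

(* A homotopy inverse sends an edge to its lift, extended inside the collapsed
   trees to chosen lifts of its ends. *)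
Lemma collapsing_inverse G H (c : collapsing G H) : acyclic (collapsed c) ->
  exists g : gmap H G, homotopic (gcomp g c) (gid G) /\ homotopic (gcomp c g) (gid H).
Proof.
move=> aF.
have [s sK] := choice (cv_surj c).
have /choice[tau tauP] u : exists p, walk (s (cv c u)) p u /\ path_in (collapsed c) p.
  suff /connect_walkP[p] : connect (adj (collapsed c)) (s (cv c u)) u by exists p.
  by rewrite -cv_fiber sK.
pose lift (e : edge H) : seq (dart G) :=
  tau (dorg (cdart c (e, false))) ++
  cdart c (e, false) :: prev (tau (dend (cdart c (e, false)))).
have tau_walk d : walk (s (dorg d)) (tau (dorg (cdart c d))) (dorg (cdart c d)).
  by have [+ _] := tauP (dorg (cdart c d)); rewrite cv_org.
have lift_walk e : walk (s (src e)) (lift e) (s (tgt e)).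
  apply: walk_cat (tau_walk (e, false)) _; rewrite /= eqxx /=.
  apply: walk_prev; have [+ _] := tauP (dend (cdart c (e, false))).
  by rewrite cv_end.
exists (@Gmap H G s lift lift_walk); split; last first.
  apply: homotopic_eq => [v|e] /=; first exact: sK.
  have [_ p1] := tauP (dorg (cdart c (e, false))).
  have [_ p2] := tauP (dend (cdart c (e, false))).
  rewrite /lift gpath_cat -cat1s gpath_cat gpath_prev.
  rewrite (gpath_collapsed p1) (gpath_collapsed p2).
  by rewrite /gpath /= gdart_cdart cats0; exact: hpath_refl.
exists tau; split=> [v|e]; first by case: (tauP v).
rewrite /=; have [eF|[e' ->]] := collapsedP c e.
  rewrite cpath_collapsed//= -[tau (tgt e)]cat0s.
  have q0 : hpath (tau (src e) ++ (e, false) :: prev (tau (tgt e))) [::].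
    have [w1 p1] := tauP (src e); have [w2 p2] := tauP (tgt e).
    apply: (acyclic_hpath (u := s (cv c (src e))) aF); last first.
      by rewrite path_in_cat p1 /= eF path_in_prev.
    apply: walk_cat w1 _; rewrite /= eqxx /= cv_collapsed//.
    exact: walk_prev.
  apply: hpath_trans (cat_hpath (hpath_sym q0) (hpath_refl _)) _.
  rewrite -catA cat_cons hpath_prev_l; exact: hpath_refl.
rewrite cpath_ci /gpath /= cats0 /gdart /lift /cdart /= addbF.
case: (cfl c e') => /=; rewrite /dend /dorg /drev /=.
  rewrite prev_cat prev_cons prevK -!catA hpath_prev_l cats0; exact: hpath_refl.
rewrite -cat1s -!catA hpath_prev_l cats0; exact: hpath_refl.
Qed.

Lemma collapsing_equivalence G H (c : collapsing G H) :
  acyclic (collapsed c) -> homotopy_equivalence c.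
Proof. by move=> /collapsing_inverse[g [h1 h2]]; exists g. Qed.

Section Comp.
Variables (G H K : graph) (c2 : collapsing H K) (c1 : collapsing G H).

Lemma ccomp_inj : injective (ci c1 \o ci c2).
Proof. by apply: inj_comp; exact: ci_inj. Qed.

Lemma ccomp_surj w : exists v, cv c2 (cv c1 v) = w.
Proof.
by have [v <-] := cv_surj c2 w; have [u <-] := cv_surj c1 v; exists u.
Qed.

Lemma ccomp_fiber u v : (cv c2 (cv c1 u) == cv c2 (cv c1 v)) =
  connect (adj (~: [set (ci c1 \o ci c2) e | e : edge K])) u v.
Proof. by rewrite cv_fiber connect_collapse -imset_comp. Qed.

Lemma ccomp_org (d : dart K) : cv c2 (cv c1 (dorg ((ci c1 (ci c2 d.1),
   (cfl c1 (ci c2 d.1) (+) cfl c2 d.1) (+) d.2) : dart G))) = dorg d.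
Proof.
by rewrite -addbA (cv_org c1 (ci c2 d.1, cfl c2 d.1 (+) d.2)) cv_org.
Qed.

Definition ccomp : collapsing G K :=
  @Collapsing G K (cv c2 \o cv c1) (ci c1 \o ci c2)
    (fun e => cfl c1 (ci c2 e) (+) cfl c2 e) ccomp_inj ccomp_surj ccomp_fiber ccomp_org.

Lemma collapsed_comp : collapsed ccomp = collapsed c1 :|: ci c1 @: collapsed c2.
Proof.
apply/setP => e; rewrite in_setU; have [eF|[e' ->]] := collapsedP c1 e.
  rewrite eF inE; apply/negP => /imsetP[e2 _ ee2].
  by move: eF; rewrite ee2 /= (negbTE (ci_ncollapsed _ _)).
rewrite (negbTE (ci_ncollapsed _ _)) /= mem_imset; last exact: ci_inj.
rewrite !inE; congr (~~ _); apply/imsetP/imsetP => -[e2 _]; last by move=> ->; exists e2.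
by move/(@ci_inj _ _ c1) => ->; exists e2.
Qed.

Lemma ccomp_homotopic : homotopic ccomp (gcomp c2 c1).
Proof.
apply: homotopic_eq => // e /=.
have [eF|[e' ->]] := collapsedP c1 e.
  by rewrite !cpath_collapsed ?collapsed_comp ?in_setU ?eF//; exact: hpath_refl.
rewrite (cpath_ci c1) /gpath /= cats0.
have [e'F|[e2 ->]] := collapsedP c2 e'.
  rewrite /gdart /= !cpath_collapsed ?collapsed_comp ?in_setU ?imset_f ?orbT//.
  by case: (cfl _ _); exact: hpath_refl.
rewrite (cpath_ci ccomp) /gdart /= cpath_ci.
by case: (cfl c1 _); case: (cfl c2 _); exact: hpath_refl.
Qed.

(* A loop in the collapsed edges has a trivial image, and the composite of the
   homotopy inverse with the collapse is homotopic to the identity. *)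
Lemma acyclic_comp :
  acyclic (collapsed c1) -> acyclic (collapsed c2) -> acyclic (collapsed ccomp).
Proof.
move=> a1 a2; apply: acyclic_loops => u p pw pF.
have [g [[h [_ he]] _]] := collapsing_inverse a1.
have p2 : path_in (collapsed c2) (gpath c1 p).
  elim: p pF {pw} => [//|d p IH] /= /andP[dF /IH{}IH].
  rewrite /gpath /= -/(gpath c1 p) path_in_cat IH andbT.
  move: dF; rewrite collapsed_comp in_setU /gdart => /orP[dF|/imsetP[e eF ->]].
    by rewrite /= cpath_collapsed//; case: d.2.
  by rewrite /= cpath_ci; case: d.2; rewrite /= eF.
have h0 : hpath (gpath c1 p) [::] by apply: acyclic_hpath (gpath_walk c1 pw) p2.
have := homotopic_natural he pw.
rewrite gpath_id gpath_comp h0 /= => hu.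
rewrite -[p]cat0s -(hpath_prev_l (h u)) -catA -hu hpath_prev_l; exact: hpath_refl.
Qed.

End Comp.

(** Isomorphisms become collapses of nothing, so a change of representative is handled by composing
    collapses. *)
Lemma collapsing_of_giso G H (f : giso G H) : exists c : collapsing G H,
  [/\ cancel (ie f) (ci c), cancel (ci c) (ie f), collapsed c = set0 & homotopic c f].
Proof.
have [ie' ieK ieK'] := ie_bij f; have [iv' ivK ivK'] := iv_bij f.
have im : [set ie' e | e : edge H] = [set: edge G].
  by apply/setP => e; rewrite inE -(ieK e) imset_f.
have fib u v : (iv f u == iv f v) = connect (adj (~: [set ie' e | e : edge H])) u v.
  rewrite im finset.setCT (inj_eq (can_inj ivK)); apply/eqP/connect_walkP.
    by move=> ->; exists [::] => //=.
  by case=> -[|d p] /=; [move/eqP|rewrite inE].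
have org (d : dart H) :
    iv f (dorg ((ie' d.1, iflip f (ie' d.1) (+) d.2) : dart G)) = dorg d.
  by rewrite -iorg /= addbA addbb ieK' /= -surjective_pairing.
have surj w : exists v, iv f v = w by exists (iv' w).
pose c := @Collapsing G H (iv f) ie' (fun e => iflip f (ie' e)) (can_inj ieK') surj fib org.
exists c; split=> //; first by rewrite /collapsed /= im finset.setCT.
apply: homotopic_eq => // e; rewrite /= -{1}(ieK e) -[ie' _]/(ci c (ie f e)) cpath_ci.
by rewrite /= ieK; exact: hpath_refl.
Qed.

(** Both targets are the quotient of G by the same edges. Vertices and edges are transferred through
    lifts to G, and the flip compares the two orientations given to one edge of G. *)
Lemma giso_of_collapsings G H1 H2 (c1 : collapsing G H1) (c2 : collapsing G H2) :
  collapsed c1 = collapsed c2 ->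
  exists f : giso H1 H2,
    (forall e, ci c2 (ie f e) = ci c1 e) /\ homotopic (gcomp f c1) c2.
Proof.
move=> F12.
have half K1 K2 (k1 : collapsing G K1) (k2 : collapsing G K2) :
    collapsed k1 = collapsed k2 -> exists (iv : vertex K1 -> vertex K2) ie,
    (forall u, iv (cv k1 u) = cv k2 u) /\ (forall e, ci k2 (ie e) = ci k1 e).
  move=> kF.
  have [s sK] := choice (cv_surj k1).
  have /choice[ie ieP] e : exists e', ci k2 e' = ci k1 e.
    have [|[e' ->]] := collapsedP k2 (ci k1 e); last by exists e'.
    by rewrite -kF (negbTE (ci_ncollapsed _ _)).
  exists (cv k2 \o s), ie; split=> // u /=; apply/eqP.
  by rewrite cv_fiber -/(collapsed k2) -kF -cv_fiber sK.
have [iv12 [ie12 [ivP ieP]]] := half _ _ _ _ F12.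
have [iv21 [ie21 [ivP' ieP']]] := half _ _ _ _ (esym F12).
have ivK : cancel iv12 iv21.
  by move=> w; have [u <-] := cv_surj c1 w; rewrite ivP ivP'.
have ivK' : cancel iv21 iv12.
  by move=> w; have [u <-] := cv_surj c2 w; rewrite ivP' ivP.
have ieK : cancel ie12 ie21 by move=> e; apply: (@ci_inj _ _ c1); rewrite ieP' ieP.
have ieK' : cancel ie21 ie12 by move=> e; apply: (@ci_inj _ _ c2); rewrite ieP ieP'.
pose fl e := cfl c1 e (+) cfl c2 (ie12 e).
have org (d : dart H1) : dorg ((ie12 d.1, fl d.1 (+) d.2) : dart H2) = iv12 (dorg d).
  rewrite -(cv_org c1 d) ivP -(cv_org c2) /= /fl ieP.
  by congr (cv c2 (dorg _)); congr pair; case: (cfl c1 _) (cfl c2 _) d.2 => -[] [].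
exists (@Giso H1 H2 iv12 ie12 fl (Bijective ivK ivK') (Bijective ieK ieK') org).
split=> //; apply: homotopic_eq => //= e.
have [eF|[e' ->]] := collapsedP c1 e.
  by rewrite !cpath_collapsed// -?F12//; exact: hpath_refl.
rewrite cpath_ci -ieP cpath_ci /gpath /= /gdart /= /fl.
by case: (cfl c1 _) (cfl c2 _) => -[] /=; exact: hpath_refl.
Qed.

Lemma contract_fiber G (F : {set edge G}) u v :
  (contract_class F u == contract_class F v) =
  connect (adj (~: [set val (e : contract_edge F) | e : edge (contract F)])) u v.
Proof.
have -> : ~: [set val (e : contract_edge F) | e : edge (contract F)] = F.
  apply/setP => e; rewrite inE; apply/idP/idP => [|eF].
    by apply: contraR => eF; apply/imsetP; exists (Sub e eF); rewrite ?SubK.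
  by apply/imsetP => -[[e' e'F] _ /= ee']; rewrite -ee' eF in e'F.
rewrite -val_eqE /=; apply/eqP/idP => [/setP/(_ v)|uv].
  by rewrite !inE connect0.
by apply/setP => w; rewrite !inE; exact: (same_connect (@connect_adjC _ _)).
Qed.

Lemma contract_surj G (F : {set edge G}) (w : vertex (contract F)) :
  exists v, contract_class F v = w.
Proof.
case: w => B BP; have /imsetP[v _ E] := BP.
by exists v; apply: val_inj; rewrite /= E.
Qed.

Lemma contract_org G (F : {set edge G}) (d : dart (contract F)) :
  contract_class F (dorg ((val d.1, false (+) d.2) : dart G)) = dorg d.
Proof. by case: d => e []. Qed.

Definition contraction G (F : {set edge G}) : collapsing G (contract F) :=
  @Collapsing G (contract F) (contract_class F) val (fun=> false) val_inj
    (@contract_surj G F) (@contract_fiber G F) (@contract_org G F).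

Lemma collapsed_contraction G (F : {set edge G}) : collapsed (contraction F) = F.
Proof.
apply/setP => e; rewrite inE; apply/idP/idP => [|eF].
  by apply: contraR => eF; apply/imsetP; exists (Sub e eF); rewrite ?SubK.
by apply/imsetP => -[[e' e'F] _ /= ee']; rewrite -ee' eF in e'F.
Qed.

Lemma contraction_homotopic G (F : {set edge G}) : homotopic (contraction F) (collapse F).
Proof.
apply: homotopic_eq => // e /=; rewrite /collapse_edge; case: insubP => [e' _ <-|].
  by rewrite -[val e']/(ci (contraction F) e') cpath_ci; exact: hpath_refl.
rewrite negbK => eF; rewrite cpath_collapsed ?collapsed_contraction//.
exact: hpath_refl.
Qed.

Lemma numbering G : exists g : numbered_graph, exists f : giso G g, True.
Proof.
pose g := @NumberedGraph #|vertex G| #|edge G|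
  (fun i => enum_rank (src (enum_val i))) (fun i => enum_rank (tgt (enum_val i))).
have org (d : dart G) :
    dorg ((enum_rank d.1, false (+) d.2) : dart g) = enum_rank (dorg d).
  by case: d => e []; rewrite /dorg /= enum_rankK.
exists g; have vb : bijective (enum_rank : vertex G -> vertex g).
  by exists enum_val; [exact: enum_rankK|exact: enum_valK].
have eb : bijective (enum_rank : edge G -> edge g).
  by exists enum_val; [exact: enum_rankK|exact: enum_valK].
by exists (@Giso G g enum_rank enum_rank (fun=> false) vb eb org).
Qed.

End CollapsingTheory.

(** * Valences and trivalent expansions *)

Section Valence.
Variable G : graph.
Implicit Types (F : {set edge G}) (u v w : vertex G).

Lemma connect_adj0 u v : connect (adj (set0 : {set edge G})) u v = (u == v).
Proof.
apply/connect_walkP/eqP => [[[|d p] /=]|->]; first by move/eqP.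
  by rewrite inE.
by exists [::] => /=.
Qed.

Lemma connect_add F e u v : e \in F -> connect (adj F) u v =
  [|| connect (adj (F :\ e)) u v,
      connect (adj (F :\ e)) u (src e) && connect (adj (F :\ e)) (tgt e) v
    | connect (adj (F :\ e)) u (tgt e) && connect (adj (F :\ e)) (src e) v].
Proof.
move=> eF; have sub x y : connect (adj (F :\ e)) x y -> connect (adj F) x y.
  by apply: connect_adjS; exact: subD1set.
apply/idP/idP => [uv|/or3P[/sub//||] /andP[/sub ux /sub yv]].
- by have [//|/= /(connect_setD1 eF uv)] := boolP (connect (adj (F :\ e)) u v).
- exact: connect_trans ux (connect_trans (connect_edge eF) yv).
- apply: connect_trans ux (connect_trans _ yv).
  by rewrite connect_adjC; exact: connect_edge.
Qed.

(** The valence, in the quotient by [F], of the vertex to which the component of [v] is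
    collapsed. *)
Definition component_valence F v : nat :=
  \sum_(e | e \notin F) (connect (adj F) v (src e) + connect (adj F) v (tgt e)).

(* Joining two components of valences a and b by an edge gives a component of
   valence a + b - 2. *)
Lemma forest_valence F v : (forall w, 3 <= valence [set: edge G] w)%N ->
  acyclic F -> (3 <= component_valence F v)%N.
Proof.
move=> val3; have [k] := ubnP #|F|; elim: k F v => // k IH F v; rewrite ltnS => Fk aF.
have [F0|[e eF]] := set_0Vmem F.
  rewrite (leq_trans (val3 v))// /component_valence F0 /valence leq_eqVlt; apply/orP; left.
  apply/eqP; apply: eq_big => [e|e _]; first by rewrite !inE.
  by rewrite !connect_adj0 ![v == _]eq_sym.
have F'k : (#|F :\ e| < k)%N by move: Fk; rewrite (cardsD1 e) eF.
have aF' : acyclic (F :\ e) by apply: acyclicS aF; exact: subD1set.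
have {}IH w : (3 <= component_valence (F :\ e) w)%N by exact: IH.
have sep : ~~ connect (adj (F :\ e)) (src e) (tgt e) by exact: (acyclicP _ aF).
have split w : component_valence (F :\ e) w =
    ((connect (adj (F :\ e)) w (src e) + connect (adj (F :\ e)) w (tgt e)) +
    \sum_(f | f \notin F)
      (connect (adj (F :\ e)) w (src f) + connect (adj (F :\ e)) w (tgt f)))%N.
  rewrite /component_valence (bigD1 e) ?inE ?eqxx//=; congr addn.
  by apply: eq_bigl => f; rewrite !inE; case: eqVneq => [->|]; rewrite ?eF//= ?andbT.
set r := connect (adj (F :\ e)) in split sep.
have rC x y : r x y = r y x by rewrite /r connect_adjC.
have nst : r (src e) (tgt e) = false by exact: negbTE.
have [|nv] := boolP (r v (src e) || r v (tgt e)); last first.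
  have [n1 n2] := norP nv.
  suff -> : component_valence F v = component_valence (F :\ e) v by [].
  rewrite split (negbTE n1) (negbTE n2) add0n /component_valence.
  by apply: eq_bigr => f _; rewrite !(connect_add _ _ eF) -/r (negbTE n1) (negbTE n2) !orbF.
move=> vc; have E w : connect (adj F) v w = r (src e) w || r (tgt e) w.
  rewrite (connect_add _ _ eF) -/r.
  case/orP: vc => vs.
    have -> : r v w = r (src e) w by exact: (same_connect (@connect_adjC _ _) vs).
    have -> : r v (tgt e) = r (src e) (tgt e) by exact: (same_connect (@connect_adjC _ _) vs).
    by rewrite vs nst !orbF.
  have -> : r v w = r (tgt e) w by exact: (same_connect (@connect_adjC _ _) vs).
  have -> : r v (src e) = r (tgt e) (src e) by exact: (same_connect (@connect_adjC _ _) vs).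
  by rewrite vs [r (tgt e) (src e)]rC nst /= orbC.
have dis w : ((r (src e) w || r (tgt e) w) = r (src e) w + r (tgt e) w :> nat)%N.
  have [sw|//] := boolP (r (src e) w).
  have [tw|//] := boolP (r (tgt e) w).
  case/negP: sep; apply: connect_trans sw _; by rewrite -/(r _ _) rC.
have : (6 <= component_valence (F :\ e) (src e) + component_valence (F :\ e) (tgt e))%N.
  exact: (leq_add (IH (src e)) (IH (tgt e))).
rewrite !split /component_valence.
under [X in (3 <= X)%N]eq_bigr => f _ do rewrite !E !dis addnACA.
rewrite [X in _ -> (2 < X)%N]big_split /= [r (tgt e) (src e)]rC nst /r !connect0 -/r.
lia.
Qed.

(* Otherwise the edges on that side of the bridge form a forest with a component
   of valence 1. *)
Lemma bridge_side (d : dart G) : (forall w, 3 <= valence [set: edge G] w)%N ->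
  d.1 \in bridges G -> exists f, [/\ f \notin bridges G, f != d.1
    & connect (adj ([set: edge G] :\ d.1)) (dorg d) (src f)].
Proof.
move=> val3 dB; set r := connect (adj (setT :\ d.1)).
have [f /and3P[fB fd rf]|none] := pickP
    (fun f => [&& f \notin bridges G, f != d.1 & r (dorg d) (src f)]).
  by exists f.
pose F := [set f in bridges G | (f != d.1) && r (dorg d) (src f)].
have aF : acyclic F.
  apply: acyclicS (acyclic_bridges G); apply/fintype.subsetP => f.
  by rewrite !inE => /andP[].
have Fr x y : connect (adj F) x y -> r x y.
  by apply: connect_adjS; apply/fintype.subsetP => f; rewrite !inE => /and3P[_ ->].
(* Without such an [f], the only edge outside [F] at the component of [dorg d] is [d.1], and by one
   end only: the valence is at most 1 instead of at least 3. *)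
have := forest_valence (dorg d) val3 aF.
rewrite /component_valence (bigD1 d.1) ?inE ?eqxx ?andbF//= big1 ?addn0 => [|f /andP[fF fd]].
  have sep : ~~ connect (adj F) (dorg d) (dend d).
    apply/negP => /Fr; rewrite /r connect_org_end.
    by move: dB; rewrite bridgesE => /negbTE ->.
  move: sep; rewrite /dorg /dend /dorg /drev /=.
  by case: (d.2) => /= /negbTE ->; rewrite ?addn0 ?add0n; case: connect.
have nrs : ~~ r (dorg d) (src f).
  apply/negP => rf; have := none f; rewrite fd rf !andbT => /negbFE fB.
  by move: fF; rewrite inE fB fd rf.
have nrt : ~~ r (dorg d) (tgt f).
  apply: contra nrs => rt; apply: connect_trans rt _; rewrite connect_adjC.
  by apply: connect_edge; rewrite !inE fd.
by do 2 (rewrite [connect _ _ _](negbTE (contra (@Fr _ _) _))//).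
Qed.

(** If every edge were a bridge, the whole graph would be a forest whose components have valence
    0. *)
Lemma nonbridge_exists (v : vertex G) : (forall w, 3 <= valence [set: edge G] w)%N ->
  exists e, e \notin bridges G.
Proof.
move=> val3; have [e eB|all] := pickP (fun e => e \notin bridges G); first by exists e.
have := forest_valence v val3 (acyclic_bridges G).
by rewrite /component_valence big_pred0.
Qed.

End Valence.

Section CollapsedValence.
Variables (G H : graph) (c : collapsing G H).

Lemma big_collapse (T : Type) (idx : T) (op : Monoid.com_law idx) (P : pred (edge G))
    (f : edge G -> T) :
  \big[op/idx]_(e | (e \notin collapsed c) && P e) f e =
  \big[op/idx]_(e' | P (ci c e')) f (ci c e').
Proof.
rewrite big_mkcondr [RHS]big_mkcond /=.
under eq_bigl do rewrite inE negbK.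
by rewrite big_imset //= => e e' _ _; exact: ci_inj.
Qed.

Lemma valence_collapse (v : vertex G) :
  valence [set: edge H] (cv c v) = component_valence (collapsed c) v.
Proof.
rewrite /valence /component_valence.
under [RHS]eq_bigl do rewrite -[_ \notin _]andbT.
rewrite (big_collapse addn xpredT) /=; apply: eq_big => [e|e _]; first by rewrite inE.
rewrite -!cv_fiber cv_src cv_tgt ![cv c v == _]eq_sym /dend /dorg /drev /=.
by case: (cfl c e); rewrite // addnC.
Qed.

Lemma valence_collapse_ge3 w : (forall v, 3 <= valence [set: edge G] v)%N ->
  acyclic (collapsed c) -> (3 <= valence [set: edge H] w)%N.
Proof.
move=> val3 aF; have [v <-] := cv_surj c w.
rewrite valence_collapse; exact: forest_valence.
Qed.

End CollapsedValence.

Lemma big_option (T : finType) (f : option T -> nat) :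
  (\sum_x f x = f None + \sum_x f (Some x))%N.
Proof.
rewrite (bigD1 None)//=; congr addn.
transitivity (\sum_(x in [set Some y | y in [set: T]]) f x)%N; last first.
  rewrite big_imset /= => [|x y _ _ [//]].
  by apply: eq_bigl => x; rewrite inE.
apply: eq_bigl => -[x|] /=; first by rewrite imset_f ?inE.
by apply/esym/negP => /imsetP[].
Qed.

Section Split.
Variables (G : graph) (v : vertex G) (D : pred (dart G)).

Definition moved (d : dart G) := (dorg d == v) && D d.

Definition split_end (d : dart G) : option (vertex G) :=
  if moved d then None else Some (dorg d).

(* The darts of D at v are moved to a new vertex, joined to v by a new edge. *)
Definition split_graph : graph := @Graph (option (vertex G)) (option (edge G))
  (fun e => if e is Some e' then split_end (e', false) else Some v)
  (fun e => if e is Some e' then split_end (e', true) else None).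

Lemma split_ci_codom :
  ~: [set (Some e : edge split_graph) | e : edge G] = [set None].
Proof.
apply/setP => -[e|]; rewrite !inE; first by rewrite imset_f.
by apply/negP => /imsetP[].
Qed.

Lemma split_connect (u w : vertex split_graph) :
  connect (adj [set None : edge split_graph]) u w = (odflt v u == odflt v w).
Proof.
apply/idP/idP => [uw|].
  rewrite -(connect_invariant (P := fun w : vertex split_graph => odflt v u == odflt v w) _ uw)//.
  by move=> e; rewrite inE => /eqP->.
have vN : connect (adj [set None : edge split_graph]) (Some v) None.
  by apply: (@connect_edge _ _ (None : edge split_graph)); rewrite inE.
case: u w => [u|] [w|] /= /eqP => [->|->|<-|_]; rewrite ?connect0//.
by rewrite (@connect_adjC split_graph).
Qed.

Lemma split_fiber (u w : vertex split_graph) : (odflt v u == odflt v w) =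
  connect (adj (~: [set (Some e : edge split_graph) | e : edge G])) u w.
Proof. by rewrite split_ci_codom split_connect. Qed.

Lemma split_surj (w : vertex G) : exists u : vertex split_graph, odflt v u = w.
Proof. by exists (Some w). Qed.

Lemma split_dorg e b : dorg ((Some e, b) : dart split_graph) = split_end (e, b).
Proof. by case: b. Qed.

Lemma split_org (d : dart G) :
  odflt v (dorg ((Some d.1, false (+) d.2) : dart split_graph)) = dorg d.
Proof.
rewrite split_dorg /split_end /moved; case: d => e b /=.
by case: eqP => [->|//]; case: (D _).
Qed.

Definition split_collapse : collapsing split_graph G :=
  @Collapsing split_graph G (odflt v) Some (fun=> false) (@Some_inj _) split_surj
    split_fiber split_org.

Lemma collapsed_split : collapsed split_collapse = [set None].
Proof. exact: split_ci_codom. Qed.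

Lemma acyclic_split : acyclic (collapsed split_collapse).
Proof.
rewrite collapsed_split; apply/acyclicP => e; rewrite inE => /eqP->.
by rewrite setDv connect_adj0.
Qed.

Lemma sum_edges (K : graph) (f : dart K -> nat) :
  (\sum_(e in [set: edge K]) (f (e, false) + f (e, true)) = \sum_d f d)%N.
Proof.
rewrite (eq_bigr (fun d => f (d.1, d.2))) => [|[]//].
rewrite -(pair_big xpredT xpredT (fun e b => f (e, b))) /=.
by apply: eq_big => [e|e _]; rewrite ?inE// big_bool addnC.
Qed.

Lemma valence_darts (K : graph) (u : vertex K) :
  (valence [set: edge K] u = \sum_(d : dart K) (dorg d == u))%N.
Proof. by rewrite -sum_edges. Qed.

Lemma split_valence u : (valence [set: edge split_graph] u =
  (Some v == u) + (None == u) + \sum_d (split_end d == u))%N.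
Proof.
rewrite -(sum_edges (fun d => split_end d == u : nat)) /valence.
under [LHS]eq_bigl do rewrite inE.
by rewrite big_option /=; congr addn; apply: eq_bigl => e; rewrite inE.
Qed.

Lemma split_valence_new :
  (valence [set: edge split_graph] None = (\sum_d moved d).+1)%N.
Proof.
rewrite split_valence add1n; congr S; apply: eq_bigr => d _.
by rewrite /split_end; case: moved.
Qed.

Lemma split_valence_old : (valence [set: edge split_graph] (Some v) +
  \sum_d moved d = (valence [set: edge G] v).+1)%N.
Proof.
rewrite split_valence eqxx /= addn0 add1n addSn valence_darts -big_split /=; congr S.
apply: eq_bigr => d _; rewrite /split_end /moved.
case: (eqVneq (dorg d) v) => [->|nd] /=; first by case: (D d); rewrite /= ?eqxx.
by rewrite (inj_eq Some_inj) addn0 (negbTE nd).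
Qed.

Lemma split_valence_other u : u != v ->
  valence [set: edge split_graph] (Some u) = valence [set: edge G] u.
Proof.
move=> uv; rewrite split_valence (inj_eq Some_inj) eq_sym (negbTE uv) valence_darts.
apply: eq_bigr => d _; rewrite /split_end /moved.
case: (eqVneq (dorg d) v) => [->|_] /=; last by rewrite (inj_eq Some_inj).
by rewrite [v == u]eq_sym (negbTE uv); case: (D d); rewrite //= (inj_eq Some_inj) [v == u]eq_sym (negbTE uv).
Qed.

End Split.

(* Splitting off a pair of darts replaces a vertex of valence k > 3 by vertices of
   valence 3 and k - 1. *)
Lemma trivalent_expansion (G : graph) :
  (forall v, 3 <= valence [set: edge G] v)%N ->
  exists (T : graph) (c : collapsing T G), acyclic (collapsed c) /\
    forall v, valence [set: edge T] v = 3%N.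
Proof.
have [k] := ubnP (\sum_v (valence [set: edge G] v - 3))%N.
elim: k G => // k IH G; rewrite ltnS => Gk val3.
have [v v4|all3] := pickP (fun v => (3 < valence [set: edge G] v)%N); last first.
  have [c [_ _ c0 _]] := collapsing_of_giso (giso_id G).
  exists G, c; rewrite c0 acyclic0; split=> // v.
  by apply/eqP; rewrite eqn_leq val3 leqNgt all3.
have : (1 < #|[set d : dart G | dorg d == v]|)%N.
  rewrite cardsE -sum1_card big_mkcond /=.
  by move: v4; rewrite valence_darts => /ltnW/ltnW.
case/card_gt1P => d1 [d2 []]; rewrite !inE => /eqP d1v /eqP d2v d12.
pose D := pred2 d1 d2.
have mD : (\sum_d moved v D d = 2)%N.
  rewrite (bigD1 d1)//= (bigD1 d2) 1?eq_sym//= big1 => [|d /andP[n1 n2]].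
    by rewrite /moved /= d1v d2v !eqxx orbT.
  by rewrite /moved /= (negbTE n1) (negbTE n2) andbF.
have vN := split_valence_new v D; have vO := split_valence_old v D.
rewrite mD in vN vO.
have val' u : (3 <= valence [set: edge (split_graph v D)] u)%N.
  case: u => [u|]; last by rewrite vN.
  have [->|uv] := eqVneq u v; first lia.
  by rewrite split_valence_other.
(* The induction is on the total excess of the valences over 3: the new vertex has excess 0 and the
   old one loses 1. *)
have [|T [c [aF T3]]] := IH (split_graph v D) _ val'.
  apply: leq_trans Gk; rewrite big_option vN subnn add0n.
  rewrite (bigD1 v)//= [X in (_ < X)%N](bigD1 v)//=.
  rewrite (eq_bigr (fun u => valence [set: edge G] u - 3)%N) => [|u uv].
    rewrite ltn_add2r ltn_sub2rE// -ltnS -vO addn2 //.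
  by rewrite split_valence_other.
exists T, (ccomp (split_collapse v D) c); split=> //.
by apply: acyclic_comp => //; exact: acyclic_split.
Qed.

(** * Strata as levels, and presentations of points *)

Section Levels.
Variables (R : realType) (G : graph).
Implicit Types (s : strata R G) (lev : edge G -> nat) (len : edge G -> R).

(* [slev s e] is the unique i with m_i(e) nonzero, and [slen s e] that length. *)
Definition slev s (e : edge G) : nat :=
  find (fun i => (e \in stratum s i) && (mlen s i e != 0)) (iota 0 (depth s).+1).

Definition slen s (e : edge G) : R := mlen s (slev s e) e.

(** The part of validity saying that the strata are determined by [slev] and [slen]. It passes
    through isomorphisms, so it also holds for the coordinates of a cell, whose strata are not
    assumed valid. *)
Record graded s : Prop := {
  slev_le : forall e, (slev s e <= depth s)%N;
  slen_gt0 : forall e, 0 < slen s e;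
  stratumE : forall i e, (i <= depth s)%N -> (e \in stratum s i) = (i <= slev s e)%N;
  mlenE : forall i e, (i <= depth s)%N -> (i <= slev s e)%N ->
    mlen s i e = if slev s e == i then slen s e else 0 }.

Lemma slev_eq s e i : (i <= depth s)%N -> e \in stratum s i -> mlen s i e != 0 ->
  (forall j, (j <= depth s)%N -> e \in stratum s j -> mlen s j e != 0 -> j = i) ->
  slev s e = i.
Proof.
move=> ik es ei uniq; rewrite /slev; set P := fun i => _.
have hP : has P (iota 0 (depth s).+1).
  by apply/hasP; exists i; rewrite ?mem_iota ?ltnS// /P es.
have fk := hP; rewrite has_find size_iota in fk.
have := nth_find 0%N hP; rewrite nth_iota// add0n => /andP[fs fm].
exact: uniq.
Qed.

(** By induction on the level, an edge leaves the chain just after the single level on which its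
    length is nonzero. *)
Lemma strata_valid_graded s : strata_valid s -> graded s.
Proof.
case=> top _ succ ge0 _ uniq.
have slevP e : [/\ (slev s e <= depth s)%N, e \in stratum s (slev s e) &
    mlen s (slev s e) e != 0] /\
  forall i, (i <= depth s)%N -> e \in stratum s i -> mlen s i e != 0 -> i = slev s e.
  have [i [[ik es ei] iu]] := uniq e.
  have -> : slev s e = i.
    by apply: slev_eq => // j jk js je; apply/esym/iu; split.
  by split=> [|j jk js je]; [split|apply/esym/iu; split].
have strE i e : (i <= depth s)%N -> (e \in stratum s i) = (i <= slev s e)%N.
  elim: i => [_|i IH ik]; first by rewrite top inE.
  have [[ek es em] eu] := slevP e.
  rewrite succ// inE IH ?(ltnW ik)//; have [ie|ei|ie] := ltngtP i (slev s e); rewrite //=.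
    have eis : e \in stratum s i by rewrite IH ?(ltnW ik)// ltnW.
    apply/negPn/negP => /(eu _ (ltnW ik) eis) ie'.
    by rewrite ie' ltnn in ie.
  by rewrite ie (negbTE em).
split=> // [e|e|i e ik ie].
- by have [[]] := slevP e.
- by have [[ek es em] _] := slevP e; rewrite lt_def em ge0.
- have [_ eu] := slevP e.
  case: eqVneq => [<-//|]; apply: contraNeq => em; apply/eqP/esym.
  by apply: eu => //; rewrite strE.
Qed.

Lemma slev_volume s i : strata_valid s -> (i <= depth s)%N ->
  \sum_(e | slev s e == i) slen s e = 1.
Proof.
move=> vs ik; have gs := strata_valid_graded vs.
rewrite -(mlen_volume vs ik) [RHS]big_mkcond [LHS]big_mkcond /=.
apply: eq_bigr => e _; rewrite stratumE//.
case: leqP => [ie|ie]; first by rewrite mlenE.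
by case: eqVneq ie => // ->; rewrite ltnn.
Qed.

Lemma slev_core s i : strata_valid s -> (0 < i <= depth s)%N ->
  core [set e | (i <= slev s e)%N].
Proof.
move=> vs /andP[i0 ik]; have gs := strata_valid_graded vs.
have <- : stratum s i = [set e | (i <= slev s e)%N].
  by apply/setP => e; rewrite inE stratumE.
by case: i i0 ik => // i _ ik; have [] := stratum_core vs ik.
Qed.

Definition level_strata k lev len : strata R G :=
  Strata k (fun i => [set e | (i <= lev e)%N])
    (fun i e => if lev e == i then len e else 0).

Section LevelStrata.
Variables (k : nat) (lev : edge G -> nat) (len : edge G -> R).
Hypothesis lev_le : forall e, (lev e <= k)%N.
Hypothesis len_gt0 : forall e, 0 < len e.

Lemma slev_level_strata e : slev (level_strata k lev len) e = lev e.
Proof.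
apply: slev_eq => //= [||j _ _]; first by rewrite inE.
  by rewrite eqxx gt_eqF.
by case: (eqVneq (lev e) j) => // _; rewrite eqxx.
Qed.

Lemma slen_level_strata e : slen (level_strata k lev len) e = len e.
Proof. by rewrite /slen slev_level_strata /= eqxx. Qed.

Lemma level_strata_graded : graded (level_strata k lev len).
Proof.
split=> [e|e|i e _|i e _]; rewrite ?slev_level_strata ?slen_level_strata//.
by rewrite inE.
Qed.

Lemma level_strata_valid :
  (forall i, (i <= k)%N -> \sum_(e | lev e == i) len e = 1) ->
  (forall i, (0 < i <= k)%N -> core [set e | (i <= lev e)%N]) ->
  strata_valid (level_strata k lev len).
Proof.
move=> vol cor.
have ex i : (i <= k)%N -> exists e, lev e = i.
  move=> ik; have [e /eqP le|none] := pickP (fun e => lev e == i); first by exists e.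
  by have := vol i ik; rewrite big_pred0// => /esym/eqP; rewrite oner_eq0.
split=> /=.
- by apply/setP => e; rewrite !inE.
- move=> i ik; split; last exact: cor.
    apply/properP; split; first by apply/fintype.subsetP => e; rewrite !inE; exact: ltnW.
    by have [e le] := ex i (ltnW ik); exists e; rewrite inE le ?ltnn.
  by have [e le] := ex i.+1 ik; apply/set0Pn; exists e; rewrite inE le.
- move=> i ik; apply/setP => e; rewrite !inE; case: ltngtP => //= ie.
    by rewrite eqxx.
  by rewrite gt_eqF.
- by move=> i e _ _; case: ifP => // _; exact: ltW.
- move=> i ik; rewrite -[RHS](vol i ik) big_mkcond [RHS]big_mkcond /=.
  apply: eq_bigr => e _; rewrite inE.
  by case: eqVneq => [->|]; rewrite ?leqnn// if_same.
- move=> e; exists (lev e); split; first by rewrite lev_le inE leqnn eqxx gt_eqF.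
  by move=> j [_ _]; case: (eqVneq (lev e) j) => //; rewrite eqxx.
Qed.

End LevelStrata.

(* A weighted levelled graph whose edges of positive length form, after the edges
   of length 0 are collapsed, a chain of metric core graphs of volume 1. *)
Record admissible (k : nat) lev len : Prop := {
  adm_ge0 : forall e, 0 <= len e;
  adm_le : forall e, len e != 0 -> (lev e <= k)%N;
  adm_acyclic : acyclic [set e | len e == 0];
  adm_volume : forall i, (i <= k)%N -> \sum_(e | lev e == i) len e = 1;
  adm_core : forall i e, (0 < i)%N -> (i <= lev e)%N -> len e != 0 ->
    connect (adj ([set f | (len f == 0) || (i <= lev f)%N] :\ e)) (src e) (tgt e) }.

(** An edge of positive length on a positive level lies on a cycle made of its stratum and of
    collapsed edges; a bridge lies on no cycle. *)
Lemma admissible_bridge k lev len e :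
  admissible k lev len -> e \in bridges G -> len e != 0 -> lev e = 0%N.
Proof.
move=> adm eB e0; apply/eqP; rewrite -leqn0 leqNgt; apply/negP => le.
have := adm_core adm (ltn0Sn 0) le e0; apply/negP; move: eB; rewrite bridgesE.
apply: contra; apply: connect_adjS; apply: setSD; exact: subsetT.
Qed.

End Levels.

Section Isomorphism.
Variables (R : realType) (n : nat).
Implicit Types M : marked_strata R n.

Lemma marked_iso_graded M M' : graded M' -> marked_iso M M' -> graded M /\
  exists f : giso (mgraph M) (mgraph M'),
    [/\ homotopic (gcomp f (marking M)) (marking M'), depth M = depth M'
      & forall e, slev M' (ie f e) = slev M e /\ slen M' (ie f e) = slen M e].
Proof.
move=> gM [f [hf dE sE lE]].
have [g [_ fK gK]] := giso_inv f.
have sE' i e : (i <= depth M)%N -> (ie f e \in stratum M' i) = (e \in stratum M i).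
  by move=> ik; rewrite -sE// mem_imset//; exact: can_inj fK.
have levE e : slev M' (ie f e) = slev M e.
  rewrite /slev dE; apply: eq_in_find => i; rewrite mem_iota add0n ltnS -dE => /andP[_ ik].
  by rewrite sE'//; have [es|//] := boolP (e \in stratum M i); rewrite lE.
have lev_le e : (slev M e <= depth M)%N by rewrite dE -levE slev_le.
have in_slev e : e \in stratum M (slev M e).
  by rewrite -sE'// stratumE -?dE// levE.
have lenE e : slen M' (ie f e) = slen M e.
  by rewrite /slen levE lE.
split; last by exists f; split.
split=> [e|e|i e ik|i e ik ie].
- exact: lev_le.
- by rewrite -lenE slen_gt0.
- by rewrite -sE'// stratumE -?dE// levE.
- have es : e \in stratum M i by rewrite -sE'// stratumE -?dE// levE.
  by rewrite -lE// mlenE -?dE ?levE// lenE.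
Qed.

Lemma graded_marked_iso M M' (f : giso (mgraph M) (mgraph M')) :
  graded M -> graded M' -> homotopic (gcomp f (marking M)) (marking M') ->
  depth M = depth M' ->
  (forall e, slev M' (ie f e) = slev M e /\ slen M' (ie f e) = slen M e) ->
  marked_iso M M'.
Proof.
move=> gM gM' hf dE le; exists f; split=> // [i ik|i e ik].
  have [g [_ fK gK]] := giso_inv f.
  apply/setP => e; rewrite stratumE -?dE//; apply/imsetP/idP => [[e' + ->]|le_ie].
    by rewrite stratumE// (le e').1.
  by exists (ie g e); rewrite ?gK// stratumE// -(le _).1 gK.
rewrite stratumE// => le_ie; rewrite !mlenE -?dE//; last by rewrite (le e).1.
by rewrite (le e).1 (le e).2.
Qed.

Lemma point_graded (r : marked_point R n) : graded r.
Proof. exact/strata_valid_graded/marked_strata_valid/(point_valid r). Qed.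

Lemma point_classP (r r' : marked_point R n) :
  point_class r = point_class r' <-> marked_iso r r'.
Proof.
by split=> [/eqquotP/asboolP//|h]; apply/eqquotP/asboolP.
Qed.

Lemma point_class_repr (x : Xhat R n) : point_class (repr x) = x.
Proof. exact: reprK. Qed.

End Isomorphism.

Section Presentations.
Variables (R : realType) (n : nat).

(* A point of the bordification is presented on a marked graph G by assigning levels
   and lengths to the edges of G and collapsing the edges of length 0; the levels of
   the latter are irrelevant. *)
Record presented_by (G : graph) (m : gmap (rose n) G) (k : nat) (lev : edge G -> nat)
    (len : edge G -> R) (r : marked_point R n) (c : collapsing G (mgraph r)) : Prop := {
  pres_acyclic : acyclic (collapsed c);
  pres_marking : homotopic (gcomp c m) (marking r);
  pres_depth : depth r = k;
  pres_collapsed : forall e, e \in collapsed c -> len e = 0;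
  pres_lev : forall e, slev r e = lev (ci c e);
  pres_len : forall e, slen r e = len (ci c e) }.

Definition presents G m k lev len (x : Xhat R n) : Prop :=
  exists (r : marked_point R n) (c : collapsing G (mgraph r)),
    point_class r = x /\ presented_by m k lev len c.

Lemma presented_collapsed G m k lev len (r : marked_point R n) (c : collapsing G (mgraph r)) :
  presented_by m k lev len c -> collapsed c = [set e | len e == 0].
Proof.
move=> pc; apply/setP => e; rewrite [in RHS]inE.
have [eF|[e' ->]] := collapsedP c e; first by rewrite eF (pres_collapsed pc)// eqxx.
rewrite (negbTE (ci_ncollapsed _ _)) -(pres_len pc) gt_eqF//.
exact: slen_gt0 (point_graded r) _.
Qed.

Lemma presents_self (r : marked_point R n) :
  presents (marking r) (depth r) (slev r) (slen r) (point_class r).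
Proof.
have [c [fK _ c0 hc]] := collapsing_of_giso (giso_id (mgraph r)).
exists r, c; split=> //; split=> //; rewrite ?c0 ?acyclic0//.
- apply: homotopic_trans (gcomp_id_l _).
  exact: gcomp_homotopic hc (homotopic_refl _).
- by move=> e; rewrite inE.
- by move=> e; rewrite [ci c e](fK e).
- by move=> e; rewrite [ci c e](fK e).
Qed.

Lemma presents_eq G (m : gmap (rose n) G) k lev len lev' len' x :
  len =1 len' -> (forall e, len e != 0 -> lev e = lev' e) ->
  presents m k lev len x -> presents m k lev' len' x.
Proof.
move=> lenE levE [r [c [rx pc]]]; exists r, c; split=> //.
have [aF hm dE cE leE lE] := pc; split=> // e.
- by rewrite -lenE; exact: cE.
- rewrite leE levE// -lE gt_eqF//; exact: slen_gt0 (point_graded r) _.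
- by rewrite -lenE.
Qed.

(** The edges collapsed are exactly those of length 0, so both points live on the same quotient of
    G, with the same marking and metrics. *)
Lemma presents_inj G (m : gmap (rose n) G) k lev len x x' :
  presents m k lev len x -> presents m k lev len x' -> x = x'.
Proof.
move=> [r [c [<- pc]]] [r' [c' [<- pc']]]; apply/point_classP.
have [|f [fE hf]] := @giso_of_collapsings _ _ _ c c'.
  by rewrite (presented_collapsed pc) (presented_collapsed pc').
apply: (graded_marked_iso (f := f)); rewrite ?(pres_depth pc) ?(pres_depth pc')//.
- exact: point_graded.
- exact: point_graded.
- apply: homotopic_trans (pres_marking pc').
  apply: homotopic_trans (gcomp_homotopic hf (homotopic_refl m)).
  apply: homotopic_trans (gcompA _ _ _).
  exact: gcomp_homotopic (homotopic_refl _) (homotopic_sym (pres_marking pc)).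
- by move=> e; rewrite (pres_lev pc) (pres_lev pc') (pres_len pc) (pres_len pc') fE.
Qed.

Lemma presents_representative G (m : gmap (rose n) G) k lev len x (r : marked_point R n) :
  point_class r = x -> presents m k lev len x ->
  exists c : collapsing G (mgraph r), presented_by m k lev len c.
Proof.
move=> rx [r0 [c0 [r0x pc0]]].
have /point_classP/(marked_iso_graded (point_graded r))[_ [f [hf dE fE]]] :
  point_class r0 = point_class r by rewrite r0x rx.
have [cf [_ cfK f0 hcf]] := collapsing_of_giso f.
pose c := ccomp cf c0.
have cF : collapsed c = collapsed c0 by rewrite collapsed_comp f0 imset0 setU0.
exists c; split.
- by rewrite cF; exact: pres_acyclic pc0.
- apply: homotopic_trans hf.
  apply: homotopic_trans (gcomp_homotopic (ccomp_homotopic cf c0) (homotopic_refl m)) _.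
  apply: homotopic_trans (homotopic_sym (gcompA _ _ _)) _.
  exact: gcomp_homotopic hcf (pres_marking pc0).
- by rewrite -dE (pres_depth pc0).
- by move=> e; rewrite cF => /(pres_collapsed pc0).
- by move=> e; rewrite -[ci c e]/(ci c0 (ci cf e)) -(pres_lev pc0) -(fE _).1 cfK.
- by move=> e; rewrite -[ci c e]/(ci c0 (ci cf e)) -(pres_len pc0) -(fE _).2 cfK.
Qed.

(** Pulls data back along a collapse, with length 0 on the collapsed edges: this is how a point is
    seen on an expansion of its graph. *)
Lemma presents_comp G H (m : gmap (rose n) G) (m' : gmap (rose n) H)
    (c : collapsing G H) k lev len lev' len' y :
  acyclic (collapsed c) -> homotopic (gcomp c m) m' ->
  (forall e, lev' e = lev (ci c e)) -> (forall e, len' e = len (ci c e)) ->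
  (forall e, e \in collapsed c -> len e = 0) ->
  presents m' k lev' len' y -> presents m k lev len y.
Proof.
move=> aF hc levE lenE cE [r [c' [ry pc]]]; exists r, (ccomp c' c); split=> //.
have [aF' hc' dE cE' levE' lenE'] := pc; split=> //.
- exact: acyclic_comp.
- apply: homotopic_trans hc'.
  apply: homotopic_trans (gcomp_homotopic (ccomp_homotopic c' c) (homotopic_refl m)) _.
  apply: homotopic_trans (homotopic_sym (gcompA _ _ _)) _.
  exact: gcomp_homotopic (homotopic_refl _) hc.
- move=> e; rewrite collapsed_comp in_setU => /orP[/cE//|/imsetP[e' e'F ->]].
  by rewrite -lenE cE'.
- by move=> e; rewrite levE' levE.
- by move=> e; rewrite lenE' lenE.
Qed.

Lemma presents_admissible G (m : gmap (rose n) G) k lev len x :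
  presents m k lev len x -> admissible k lev len.
Proof.
move=> [r [c [_ pc]]]; have cE := presented_collapsed pc.
have gr := point_graded r; have vr := marked_strata_valid (point_valid r).
split.
- move=> e; have [/(pres_collapsed pc)->//|[e' ->]] := collapsedP c e.
  by rewrite -(pres_len pc) ltW// slen_gt0.
- move=> e; have [/(pres_collapsed pc)->|[e' ->]] := collapsedP c e; first by rewrite eqxx.
  by rewrite -(pres_lev pc) -(pres_depth pc) slev_le.
- by rewrite -cE; exact: pres_acyclic pc.
- move=> i; rewrite -(pres_depth pc) => ik.
  rewrite -[RHS](slev_volume vr ik) (bigID (mem (collapsed c)))/=.
  rewrite big1 ?add0r => [|e /andP[_ /(pres_collapsed pc)]//].
  under eq_bigl do rewrite andbC.
  rewrite (big_collapse c +%R (fun e => lev e == i)) /=.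
  by apply: eq_big => [e|e _]; rewrite ?(pres_lev pc) ?(pres_len pc).
- move=> i e i0 ie; have [/(pres_collapsed pc)->|[e' eE]] := collapsedP c e.
    by rewrite eqxx.
  move=> _; rewrite eE in ie *; rewrite -(pres_lev pc) in ie.
  have ik : (i <= depth r)%N by apply: leq_trans ie _; rewrite slev_le.
  have /coreP/(_ e') := slev_core vr (introT andP (conj i0 ik)).
  rewrite inE ie => /(_ isT); rewrite (connect_lift c); apply: connect_adjS.
  apply/fintype.subsetP => f; rewrite in_setU => /orP[fF|/imsetP[f' + ->]].
    rewrite !inE (pres_collapsed pc fF) eqxx andbT.
    by apply: contraTneq fF => ->; exact: ci_ncollapsed.
  by rewrite !inE (inj_eq (@ci_inj _ _ c)) (pres_lev pc) => /andP[-> ->]; rewrite orbT.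
Qed.

(** The converse of [presents_admissible]: the point is realized on the numbered quotient by the
    edges of length 0, where valences stay at least 3 because a forest is collapsed. *)
Lemma presents_exists G (m : gmap (rose n) G) k lev len :
  connected_graph G -> (forall v, 3 <= valence [set: edge G] v)%N ->
  homotopy_equivalence m -> admissible k lev len ->
  exists x, presents m k lev len x.
Proof.
move=> conn val3 hm adm; set F := [set e | len e == 0].
have [g [f _]] := numbering (contract F).
have [cf [_ _ f0 _]] := collapsing_of_giso f.
pose c := ccomp cf (contraction F).
have cF : collapsed c = F.
  by rewrite /c collapsed_comp collapsed_contraction f0 imset0 setU0.
have aF : acyclic (collapsed c) by rewrite cF; exact: adm_acyclic adm.
have lenF e : (e \in collapsed c) = (len e == 0) by rewrite cF inE.
have len_ci e : len (ci c e) != 0 by rewrite -lenF ci_ncollapsed.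
have lev_le e : (lev (ci c e) <= k)%N by exact: (adm_le adm).
have len_gt0 e : 0 < len (ci c e) by rewrite lt_def len_ci (adm_ge0 adm).
have vs : strata_valid (level_strata k (lev \o ci c) (len \o ci c)).
  apply: level_strata_valid => // [i ik|i /andP[i0 ik]] /=.
    rewrite -(adm_volume adm ik) [RHS](bigID (mem (collapsed c)))/=.
    rewrite [X in _ = X + _]big1 ?add0r => [|e /andP[_]]; last by rewrite lenF => /eqP.
    under [RHS]eq_bigl do rewrite andbC.
    by rewrite (big_collapse c +%R (fun e => lev e == i)).
  apply/coreP => e; rewrite inE /= => ie; rewrite (connect_lift c).
  apply: connect_adjS (adm_core adm i0 ie (len_ci e)).
  apply/fintype.subsetP => f'; rewrite in_setD1 in_setU inE => /andP[fe].
  have [->//|[e' fE]] := collapsedP c f'; rewrite fE in fe *.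
  rewrite (negbTE (len_ci e')) /= => ie'.
  rewrite (mem_imset _ _ (@ci_inj _ _ c)).
  by rewrite !inE ie' -(inj_eq (@ci_inj _ _ c)) fe orbT.
have valid : marked_valid (@MarkedStrata R n g (gcomp c m)
    (level_strata k (lev \o ci c) (len \o ci c))).
  split=> //=; first by rewrite (connected_collapse c).
    by move=> w; exact: valence_collapse_ge3 aF.
  by apply: homotopy_equivalence_comp => //; exact: collapsing_equivalence.
exists (point_class (MarkedPoint valid)), (MarkedPoint valid), c; split=> //.
split=> //=.
- exact: homotopic_refl.
- by move=> e; rewrite lenF => /eqP.
- by move=> e; exact: slev_level_strata.
- by move=> e; exact: slen_level_strata.
Qed.

End Presentations.

(** * The flow *)

Lemma subn_eq_succ a d i : ((a - d)%N == i.+1) = (a == (i.+1 + d)%N).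
Proof. lia. Qed.

Lemma leq_pos_sub a d i : (0 < i)%N -> (i <= a - d)%N -> (i + d <= a)%N.
Proof. lia. Qed.

Section Flow.
Variables (R : realType) (G : graph) (t : R) (lev : edge G -> nat) (len : edge G -> R).

(* All the length on the lowest level is carried by bridges. *)
Definition flow_full : bool :=
  [forall e, (e \notin bridges G) && (len e != 0) ==> (0 < lev e)%N].

(** The case t = 0 is excluded because the flow must start at the identity: a full point loses its
    lowest level only once t is nonzero. *)
Definition flow_drop : nat := flow_full && (t != 0).

Definition flow_lev (e : edge G) : nat := (lev e - flow_drop)%N.

Definition bridge_len : R := \sum_(e in bridges G) len e.

Definition base_len : R :=
  \sum_(e | (e \notin bridges G) && (flow_lev e == 0%N)) len e.

(* When [base_len] is 0, [flow_full] holds and t = 0, so that no edge of positive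
   length outside the bridges has level 0. *)
Definition flow_len (e : edge G) : R :=
  if e \in bridges G then (1 - t) * len e
  else if flow_lev e == 0%N then (1 - (1 - t) * bridge_len) / base_len * len e
  else len e.

Variable k : nat.
Hypothesis adm : admissible k lev len.
Hypothesis nonbridge : exists2 e, e \notin bridges G & len e != 0.
Hypothesis t01 : 0 <= t <= 1.

Let ge0 := adm_ge0 adm.

Lemma flow_fullP e : flow_full -> e \notin bridges G -> len e != 0 -> (0 < lev e)%N.
Proof. by move=> /forallP/(_ e) + eB e0; rewrite eB e0. Qed.

Lemma bridge_len_add :
  bridge_len + \sum_(e | (e \notin bridges G) && (lev e == 0%N)) len e = 1.
Proof.
rewrite -(adm_volume adm (leq0n k)) [RHS](bigID (mem (bridges G)))/=; congr (_ + _).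
  rewrite /bridge_len [LHS]big_mkcond [RHS]big_mkcond /=; apply: eq_bigr => e _.
  have [eB|] := boolP (e \in bridges G); rewrite ?andbF ?andbT//.
  have [-> |e0] := eqVneq (len e) 0; first by rewrite if_same.
  by rewrite (admissible_bridge adm).
by apply: eq_bigl => e; rewrite andbC.
Qed.

Lemma bridge_len_ge0 : 0 <= bridge_len.
Proof. by apply: sumr_ge0 => e _; exact: ge0. Qed.

Lemma bridge_len_le1 : bridge_len <= 1.
Proof.
by rewrite -bridge_len_add lerDl; apply: sumr_ge0 => e _; exact: ge0.
Qed.

Lemma bridge_len_full : flow_full -> bridge_len = 1.
Proof.
move=> full; rewrite -[RHS]bridge_len_add [X in _ + X]big1 ?addr0// => e /andP[eB /eqP le].
by apply/eqP/negPn/negP => /(flow_fullP full eB); rewrite le.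
Qed.

Lemma full_depth : flow_full -> (0 < k)%N.
Proof.
move=> full; have [e eB e0] := nonbridge.
exact: leq_trans (flow_fullP full eB e0) (adm_le adm e0).
Qed.

Lemma bridge_len_nfull : ~~ flow_full -> bridge_len < 1.
Proof.
move=> /forallPn[e]; rewrite negb_imply -leqNgt leqn0 => /andP[/andP[eB e0] le].
rewrite -bridge_len_add ltrDl (bigD1 e) ?eB//=.
by apply: ltr_pwDl; [rewrite lt_def e0 ge0|apply: sumr_ge0 => f _; exact: ge0].
Qed.

(** After a drop, the nonbridges on the new level 0 are the old level 1, of volume 1; with no drop
    they are what the bridges leave of level 0. *)
Lemma base_lenE : base_len = if flow_full && (t != 0) then 1 else 1 - bridge_len.
Proof.
rewrite /base_len /flow_lev /flow_drop; case: ifP => [/andP[full _]|_]; last first.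
  by rewrite -bridge_len_add addrC addKr; apply: eq_bigl => e; rewrite subn0.
rewrite -(adm_volume adm (full_depth full)) [RHS](bigID (mem (bridges G)))/=.
rewrite [X in _ = X + _]big1 ?add0r => [|e /andP[le eB]]; last first.
  by apply/eqP/negPn/negP => /(admissible_bridge adm eB) l0; rewrite l0 in le.
rewrite [LHS]big_mkcond [RHS]big_mkcond /=; apply: eq_bigr => e _.
have [eB|eB] := boolP (e \in bridges G); rewrite ?andbF ?andbT//=.
have [->|/(flow_fullP full eB)] := eqVneq (len e) 0; first by rewrite !if_same.
by case: (lev e) => // j _; rewrite subn1 eqSS.
Qed.

Lemma bridge_share_le : (1 - t) * bridge_len <= 1.
Proof.
have /andP[t0 t1] := t01; have := bridge_len_le1; have := bridge_len_ge0.
by move=> ? ?; nra.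
Qed.

(** Nonbridges never collapse: in the full case the factor equals t, which is nonzero here, and
    otherwise the bridges have total length less than 1. *)
Lemma flow_factor_gt0 e : e \notin bridges G -> len e != 0 -> flow_lev e = 0%N ->
  0 < (1 - (1 - t) * bridge_len) / base_len.
Proof.
move=> eB e0 le; have /andP[t0 t1] := t01; have s0 := bridge_len_ge0.
rewrite base_lenE; have [full|nfull] := boolP flow_full => /=; last first.
  have s1 := bridge_len_nfull nfull; apply: divr_gt0; rewrite subr_gt0 //.
  by apply: le_lt_trans s1; rewrite ler_piMl// gerBl.
have tn0 : t != 0.
  apply/negP => /eqP t00; move: le; rewrite /flow_lev /flow_drop t00 eqxx andbF subn0.
  by have := flow_fullP full eB e0; case: (lev e).
by rewrite tn0 divr1 bridge_len_full// mulr1 subKr lt_def tn0.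
Qed.

Lemma flow_len_neq0 e : e \notin bridges G -> (flow_len e != 0) = (len e != 0).
Proof.
move=> eB; rewrite /flow_len (negbTE eB).
have [->|e0] := eqVneq (len e) 0; first by rewrite mulr0 if_same eqxx.
case: (eqVneq (flow_lev e) 0%N) => [le|_]; last by rewrite e0.
by rewrite mulf_neq0// gt_eqF// (flow_factor_gt0 eB).
Qed.

Lemma flow_len_eq0 e : len e = 0 -> flow_len e = 0.
Proof. by move=> e0; rewrite /flow_len e0 !mulr0 !if_same. Qed.

Lemma flow_lev_bridge e : e \in bridges G -> len e != 0 -> flow_lev e = 0%N.
Proof. by move=> eB e0; rewrite /flow_lev (admissible_bridge adm). Qed.

Lemma flow_len_ge0 e : 0 <= flow_len e.
Proof.
have /andP[t0 t1] := t01; rewrite /flow_len; case: ifP => _.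
  by rewrite mulr_ge0 ?subr_ge0.
case: ifP => // _; rewrite mulr_ge0// divr_ge0 ?subr_ge0 ?bridge_share_le//.
by apply: sumr_ge0 => f _; exact: ge0.
Qed.

Lemma flow_volume0 : \sum_(e | flow_lev e == 0%N) flow_len e = 1.
Proof.
rewrite (bigID (mem (bridges G)))/=.
have -> : \sum_(e | (flow_lev e == 0%N) && (e \in bridges G)) flow_len e =
    (1 - t) * bridge_len.
  rewrite /bridge_len mulr_sumr [LHS]big_mkcond [RHS]big_mkcond /=.
  apply: eq_bigr => e _; rewrite /flow_len.
  have [eB|] := boolP (e \in bridges G); rewrite ?andbF ?andbT//.
  have [->|e0] := eqVneq (len e) 0; first by rewrite mulr0 if_same.
  by rewrite flow_lev_bridge// eqxx.
rewrite (eq_bigr (fun e => (1 - (1 - t) * bridge_len) / base_len * len e)); last first.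
  by move=> e /andP[le eB]; rewrite /flow_len (negbTE eB) le.
rewrite -mulr_sumr (eq_bigl (fun e => (e \notin bridges G) && (flow_lev e == 0%N)));
  last by move=> e; rewrite andbC.
(* [base_len] vanishes only for a full point at t = 0, and then the bridges already have volume
   1. *)
rewrite -/base_len; have [b0|b0] := eqVneq base_len 0; last by rewrite divfK// addrC subrK.
move: b0; rewrite base_lenE; case: ifP => [_ /eqP|+ /eqP]; first by rewrite oner_eq0.
rewrite subr_eq0 => + /eqP s1; rewrite -s1 !mulr1 -[flow_full]negbK.
have [nfull|full] := boolP (~~ flow_full).
  by have := bridge_len_nfull nfull; rewrite -s1 ltxx.
by rewrite /= => /negbFE/eqP->; rewrite subr0 subrr mul0r mul0r addr0.
Qed.

(** Positive lengths mean that the flow is performed on the graph of the point itself; the edges of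
    length 0 it produces are then bridges, which form a forest. Other presentations are reached
    through [presents_comp]. *)
Lemma flow_admissible : (forall e, 0 < len e) ->
  admissible (k - flow_drop) flow_lev flow_len.
Proof.
move=> gt0; split.
- exact: flow_len_ge0.
- by move=> e _; rewrite leq_sub2r// (adm_le adm)// gt_eqF.
- apply: acyclicS (acyclic_bridges G); apply/fintype.subsetP => e; rewrite inE => e0.
  by apply: contraLR e0 => /flow_len_neq0 ->; rewrite gt_eqF.
- move=> [|i] ik; first exact: flow_volume0.
  rewrite (eq_bigl (fun e => lev e == (i.+1 + flow_drop)%N)); last first.
    by move=> e; rewrite /flow_lev subn_eq_succ.
  rewrite -(adm_volume adm (_ : i.+1 + flow_drop <= k)%N); last exact: (leq_pos_sub _ ik).
  apply: eq_bigr => e /eqP le; rewrite /flow_len /flow_lev le addnK /= ifF//.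
  by apply/negP => eB; have := admissible_bridge adm eB (lt0r_neq0 (gt0 e)); rewrite le.
- move=> i e i0 ie e0; have ie' : (i + flow_drop <= lev e)%N by exact: (leq_pos_sub i0 ie).
  apply: connect_adjS (adm_core adm (leq_trans i0 (leq_addr _ _)) ie' (lt0r_neq0 (gt0 e))).
  apply: setSD; apply/fintype.subsetP => f; rewrite !inE gt_eqF//= /flow_lev => fi.
  by rewrite (leq_trans _ (leq_sub2r _ fi)) ?addnK ?orbT.
Qed.

End Flow.

Section FlowNaturality.
Variables (R : realType) (G H : graph) (c : collapsing G H) (t : R).
Variables (lev : edge G -> nat) (len : edge G -> R).
Variables (lev' : edge H -> nat) (len' : edge H -> R).
Hypothesis levE : forall e, lev' e = lev (ci c e).
Hypothesis lenE : forall e, len' e = len (ci c e).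
Hypothesis len0 : forall e, e \in collapsed c -> len e = 0.

Lemma bridges_collapse e : (e \in bridges H) = (ci c e \in bridges G).
Proof. by rewrite !inE (separating_collapse c). Qed.

Lemma big_collapse0 (P : pred (edge G)) :
  \sum_(e | P e) len e = \sum_(e | P (ci c e)) len' e.
Proof.
rewrite (bigID (mem (collapsed c)))/= big1 ?add0r => [|e /andP[_ /len0]//].
under eq_bigl do rewrite andbC.
by rewrite (big_collapse c +%R P); apply: eq_bigr => e _; rewrite lenE.
Qed.

Lemma flow_full_collapse : flow_full lev' len' = flow_full lev len.
Proof.
apply/forallP/forallP => h e; last by rewrite bridges_collapse lenE levE; exact: h.
have [/len0->|[e' ->]] := collapsedP c e; first by rewrite eqxx andbF.
by rewrite -bridges_collapse -lenE -levE; exact: h.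
Qed.

Lemma flow_lev_collapse e : flow_lev t lev' len' e = flow_lev t lev len (ci c e).
Proof. by rewrite /flow_lev /flow_drop flow_full_collapse levE. Qed.

Lemma flow_len_collapse e : flow_len t lev' len' e = flow_len t lev len (ci c e).
Proof.
rewrite /flow_len -bridges_collapse flow_lev_collapse lenE.
have -> : bridge_len len' = bridge_len len.
  rewrite /bridge_len big_collapse0; apply: eq_bigl => e'.
  exact: bridges_collapse.
suff -> : base_len t lev' len' = base_len t lev len by [].
rewrite /base_len big_collapse0; apply: eq_bigl => e'.
by rewrite bridges_collapse flow_lev_collapse.
Qed.

End FlowNaturality.

Section FlowPoints.
Variables (R : realType) (n : nat).

Lemma point_nonbridge (r : marked_point R n) : exists e, e \notin bridges (mgraph r).
Proof.
apply: (nonbridge_exists (marking r tt)).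
exact: marked_valence (point_valid r).
Qed.

Lemma presents_nonbridge G (m : gmap (rose n) G) k lev len (x : Xhat R n) :
  presents m k lev len x -> exists2 e, e \notin bridges G & len e != 0.
Proof.
move=> [r [c [_ pc]]]; have [e eB] := point_nonbridge r.
exists (ci c e); first by rewrite -bridges_collapse.
by rewrite -(pres_len pc) gt_eqF// slen_gt0//; exact: point_graded.
Qed.

(* The default value x can only occur for t outside [0, 1]. *)
Definition flow (x : Xhat R n) (t : R) : Xhat R n :=
  let r := repr x in
  xget x (presents (marking r) (depth r - flow_drop t (slev r) (slen r))
    (flow_lev t (slev r) (slen r)) (flow_len t (slev r) (slen r))).

(** This is independence of the representative: any graph presenting x collapses onto that of
    [repr x], and levels and lengths of the flow pull back along this collapse. *)
Lemma flow_presents G (m : gmap (rose n) G) k lev len x t : 0 <= t <= 1 ->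
  presents m k lev len x ->
  presents m (k - flow_drop t lev len) (flow_lev t lev len) (flow_len t lev len)
    (flow x t).
Proof.
move=> t01 px; set r := repr x.
have self : presents (marking r) (depth r) (slev r) (slen r) x.
  by have := presents_self r; rewrite point_class_repr.
have pr : presents (marking r) (depth r - flow_drop t (slev r) (slen r))
    (flow_lev t (slev r) (slen r)) (flow_len t (slev r) (slen r)) (flow x t).
  rewrite /flow -/r; set P := presents _ _ _ _.
  suff [y Py] : exists y, P y by exact: (xgetPex x (ex_intro _ y Py)).
  have [con val3 eqv _] := point_valid r; apply: presents_exists => //.
  apply: flow_admissible => //; first exact: presents_admissible self.
    exact: presents_nonbridge self.
  exact/slen_gt0/point_graded.
have [c pc] := presents_representative (point_class_repr x) px.
have levE := pres_lev pc; have lenE := pres_len pc; have len0 := pres_collapsed pc.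
have dropE : (k - flow_drop t lev len = depth r - flow_drop t (slev r) (slen r))%N.
  by rewrite -(pres_depth pc) /flow_drop (flow_full_collapse levE lenE len0).
rewrite dropE; apply: (presents_comp (c := c)) pr => [|||e|].
- exact: pres_acyclic pc.
- exact: pres_marking pc.
- exact: flow_lev_collapse levE lenE len0.
- exact: flow_len_collapse levE lenE len0 e.
- by move=> e /len0; exact: flow_len_eq0.
Qed.

End FlowPoints.

(** * Coordinates in a closed cell *)

Lemma eqn_sub_cancel a d l : (d <= a)%N -> (d <= l)%N -> ((a - d)%N == (l - d)%N) = (a == l).
Proof. lia. Qed.

Section RelativeLength.
Variables (R : realType) (G : graph).
Implicit Types (lev : edge G -> nat) (len : edge G -> R) (C : {set edge G}).

(** The level of a core is the least level of its edges, since the metric has to be defined on all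
    of them and nonzero on one. Edges of length 0 are skipped because their levels carry no
    meaning. *)
Definition is_level lev len C (L : nat) : Prop :=
  (forall e, e \in C -> len e != 0 -> (L <= lev e)%N) /\
  exists e, [/\ e \in C, len e != 0 & lev e = L].

Definition len_at lev len (L : nat) (e : edge G) : R :=
  if lev e == L then len e else 0.

Definition relative_len lev len L C (e : edge G) : R :=
  len_at lev len L e / \sum_(f in C) len_at lev len L f.

Variables (k : nat) (lev : edge G -> nat) (len : edge G -> R).
Hypothesis adm : admissible k lev len.

Lemma len_at_ge0 L e : 0 <= len_at lev len L e.
Proof. by rewrite /len_at; case: ifP => // _; exact: adm_ge0 adm _. Qed.

Lemma len_at_gt0 L C : is_level lev len C L -> 0 < \sum_(f in C) len_at lev len L f.
Proof.
move=> [_ [e [eC e0 le]]]; rewrite (bigD1 e)//=; apply: ltr_pwDl.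
  by rewrite /len_at le eqxx lt_def e0 (adm_ge0 adm).
by apply: sumr_ge0 => f _; exact: len_at_ge0.
Qed.

Lemma relative_len_ge0 L C e : 0 <= relative_len lev len L C e.
Proof.
by apply: divr_ge0; [|apply: sumr_ge0 => f _]; exact: len_at_ge0.
Qed.

Lemma relative_len_sum L C : is_level lev len C L ->
  \sum_(e in C) relative_len lev len L C e = 1.
Proof. by move=> /len_at_gt0 h; rewrite -mulr_suml divff// gt_eqF. Qed.

Lemma len_at0_sum : \sum_(e in [set: edge G]) len_at lev len 0 e = 1.
Proof.
rewrite -(adm_volume adm (leq0n k)) [RHS]big_mkcond.
by apply: eq_bigl => e; rewrite inE.
Qed.

Lemma relative_len_setT e : relative_len lev len 0 [set: edge G] e = len_at lev len 0 e.
Proof. by rewrite /relative_len len_at0_sum divr1. Qed.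

Lemma is_level_setT : is_level lev len [set: edge G] 0.
Proof.
split=> //; have [e /andP[/eqP le e0]|none] := pickP (fun e => (lev e == 0%N) && (len e != 0)).
  by exists e; split; rewrite ?inE.
have := adm_volume adm (leq0n k); rewrite big1 => [|e le]; first by move/esym/eqP; rewrite oner_eq0.
by have := none e; rewrite le /= => /negbFE/eqP.
Qed.

Lemma is_level_core C : core C -> C != set0 -> exists L, is_level lev len C L.
Proof.
move=> cC C0.
have /subsetPn[e eC] := core_not_acyclic cC C0 (adm_acyclic adm); rewrite inE => e0.
have exL : exists i, [exists f in C, (len f != 0) && (lev f == i)].
  by exists (lev e); apply/existsP; exists e; rewrite eC e0 eqxx.
have [L /existsP[f /and3P[fC f0 /eqP fL]] minL] := ex_minnP exL.
exists L; split=> [g gC g0|]; last by exists f.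
by apply: minL; apply/existsP; exists g; rewrite gC g0 eqxx.
Qed.

End RelativeLength.

Section FlowRelativeLength.
Variables (R : realType) (G : graph) (t : R) (k : nat).
Variables (lev : edge G -> nat) (len : edge G -> R).
Hypothesis adm : admissible k lev len.
Hypothesis nonbridge : exists2 e, e \notin bridges G & len e != 0.
Hypothesis t01 : 0 <= t <= 1.
Implicit Types (C : {set edge G}) (L : nat) (e : edge G).
Local Notation drop := (flow_drop t lev len).
Local Notation lev' := (flow_lev t lev len).
Local Notation len' := (flow_len t lev len).

Lemma flow_drop_le e : e \notin bridges G -> len e != 0 -> (drop <= lev e)%N.
Proof.
move=> eB e0; rewrite /flow_drop; have [full|//] := boolP (flow_full lev len).
by case: (t != 0); rewrite //= (flow_fullP full).
Qed.

Lemma flow_is_level C L : C \subset ~: bridges G -> is_level lev len C L ->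
  is_level lev' len' C (L - drop).
Proof.
move=> /fintype.subsetP CB [minL [e [eC e0 le]]].
have nB f : f \in C -> f \notin bridges G by move=> /CB; rewrite inE.
split=> [f fC|]; first by rewrite (flow_len_neq0 adm nonbridge t01) ?nB// => f0; rewrite leq_sub2r ?minL.
by exists e; rewrite (flow_len_neq0 adm nonbridge t01) ?nB// /flow_lev le.
Qed.

(** The flow multiplies all lengths of level [L] in [C] by one factor [K], which cancels in the
    ratio; [K] differs from 1 at most when [L] drops to level 0. *)
Lemma relative_len_flow C L e : C \subset ~: bridges G -> is_level lev len C L -> e \in C ->
  relative_len lev' len' (L - drop) C e = relative_len lev len L C e.
Proof.
move=> CB lC eC; have [minL [g [gC g0 lg]]] := lC.
have nB f : f \in C -> f \notin bridges G by move=> /(fintype.subsetP CB); rewrite inE.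
have dL : (drop <= L)%N by rewrite -lg flow_drop_le ?nB.
pose K := if (L - drop == 0)%N then (1 - (1 - t) * bridge_len len) / base_len t lev len else 1.
have K0 : K != 0.
  rewrite /K; case: (eqVneq (L - drop)%N 0%N) => [L0|_]; last exact: oner_neq0.
  by rewrite gt_eqF// (flow_factor_gt0 adm nonbridge t01 (nB _ gC) g0)// /flow_lev lg.
have atE f : f \in C -> len_at lev' len' (L - drop) f = K * len_at lev len L f.
  move=> fC; rewrite /len_at; have [f0|f0] := eqVneq (len f) 0.
    by rewrite flow_len_eq0// f0 !if_same mulr0.
  have df := flow_drop_le (nB _ fC) f0.
  have -> : (lev' f == L - drop)%N = (lev f == L) by rewrite /flow_lev eqn_sub_cancel.
  case: eqP => [fL|_]; last by rewrite mulr0.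
  rewrite /flow_len (negbTE (nB _ fC)) /flow_lev fL /K.
  by case: ifP => // _; rewrite mul1r.
by rewrite /relative_len atE// (eq_bigr _ atE) -mulr_sumr invfM mulrACA divff// mul1r.
Qed.

(** Outside the exceptional case [base_len] is nonzero, so some nonbridge of positive length ends on
    level 0; none can start below [flow_drop]. *)
Lemma flow_level_nonbridge L : is_level lev len (~: bridges G) L ->
  flow_full lev len && (t == 0) \/ L = drop.
Proof.
move=> [minL [e [eC e0 le]]]; rewrite in_setC in eC.
have [/andP[_ /eqP->]|nft] := boolP (flow_full lev len && (t == 0)); first by left.
right; apply/eqP; rewrite eqn_leq -{2}le flow_drop_le// andbT.
have b0 : base_len t lev len != 0.
  rewrite (base_lenE t adm nonbridge); case: ifP => [_|ft]; first exact: oner_neq0.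
  rewrite subr_eq0 gt_eqF//; apply: (bridge_len_nfull adm).
  by move: nft ft; case: (flow_full lev len); case: (t == 0).
have [f /and3P[fB lf f0]|none] := pickP
    (fun f => [&& f \notin bridges G, lev' f == 0%N & len f != 0]).
  by apply: leq_trans (minL f _ f0) _; rewrite ?in_setC// -subn_eq0.
move: b0; rewrite /base_len big1 ?eqxx// => f /andP[fB lf].
by have := none f; rewrite fB lf /= => /negbFE/eqP.
Qed.

(** The source of continuity: the new lowest metric is expressed by relative metrics without any
    case distinction. For a full point at t = 0 the formula still holds, because [bridge_len] is 1
    and the factor vanishes. *)
Lemma len_at_flow_nonbridge L e :
  is_level lev len (~: bridges G) L -> e \notin bridges G ->
  len_at lev' len' 0 e =
  (1 - (1 - t) * bridge_len len) * relative_len lev len L (~: bridges G) e.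
Proof.
move=> lN eB; case: (flow_level_nonbridge lN) => [/andP[full /eqP t0]|LE].
  rewrite (bridge_len_full adm full) t0 subr0 mul1r subrr mul0r /len_at.
  have [e0|e0] := eqVneq (len e) 0; first by rewrite flow_len_eq0// if_same.
  rewrite /flow_lev /flow_drop eqxx andbF subn0 ifF//.
  by apply/negbTE; rewrite -lt0n; exact: flow_fullP full eB e0.
have levE f : f \notin bridges G -> len f != 0 -> (lev' f == 0)%N = (lev f == drop).
  by move=> fB f0; rewrite /flow_lev subn_eq0 eqn_leq flow_drop_le// andbT.
have -> : relative_len lev len L (~: bridges G) e =
    len_at lev len drop e / base_len t lev len.
  rewrite /relative_len LE /base_len [in LHS]big_mkcond [in RHS]big_mkcond /=.
  congr (_ / _); apply: eq_bigr => f _; rewrite in_setC /len_at.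
  have [//|fB] := boolP (f \in bridges G).
  have [f0|f0] := eqVneq (len f) 0; first by rewrite f0 !if_same.
  by rewrite levE.
rewrite /len_at; have [e0|e0] := eqVneq (len e) 0.
  by rewrite flow_len_eq0// e0 !if_same mul0r mulr0.
rewrite levE//; case: eqP => [le|]; last by rewrite mul0r mulr0.
by rewrite /flow_len (negbTE eB) levE// le eqxx mulrA mulrAC.
Qed.

Lemma len_at_flow_bridge e : e \in bridges G ->
  len_at lev' len' 0 e = (1 - t) * len_at lev len 0 e.
Proof.
move=> eB; rewrite /len_at; have [e0|e0] := eqVneq (len e) 0.
  by rewrite flow_len_eq0// e0 !if_same mulr0.
by rewrite (flow_lev_bridge t adm)// (admissible_bridge adm)// /flow_len eB.
Qed.

End FlowRelativeLength.

Section Coordinates.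
Variables (R : realType) (n : nat) (T : marked_trivalent n).
Implicit Types (a : cell_coord R T) (x : Xhat R n) (C : {set edge T}).

Definition tlev a (e : edge T) : nat :=
  if insub e : option (contract_edge (cforest a)) is Some e'
  then slev (cstrata a) e' else 0.

Definition tlen a (e : edge T) : R :=
  if insub e : option (contract_edge (cforest a)) is Some e'
  then slen (cstrata a) e' else 0.

Lemma contract_edgeP a (e : edge T) :
  e \in cforest a \/ exists e' : edge (contract (cforest a)), e = val e'.
Proof.
have := collapsedP (contraction (cforest a)) e.
by rewrite collapsed_contraction.
Qed.

Lemma tlev_val a (e : edge (contract (cforest a))) : tlev a (val e) = slev (cstrata a) e.
Proof. by rewrite /tlev valK. Qed.

Lemma tlen_val a (e : edge (contract (cforest a))) : tlen a (val e) = slen (cstrata a) e.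
Proof. by rewrite /tlen valK. Qed.

Lemma clen_val a i (e : edge (contract (cforest a))) :
  clen a i (val e) = mlen (cstrata a) i e.
Proof. by rewrite /clen valK. Qed.

Lemma tlen_forest a e : e \in cforest a -> tlen a e = 0.
Proof. by move=> eF; rewrite /tlen insubN// negbK. Qed.

Lemma clen_forest a i e : e \in cforest a -> clen a i e = 0.
Proof. by move=> eF; rewrite /clen insubN// negbK. Qed.

Lemma coord_graded a x : coord_of a x -> graded (cstrata a).
Proof.
by move=> [_ [r _ /(marked_iso_graded (point_graded r))[]]].
Qed.

Lemma coord_presents a x : coord_of a x ->
  presents (tmarking T) (depth (cstrata a)) (tlev a) (tlen a) x.
Proof.
move=> [/forestP aF [r rx /(marked_iso_graded (point_graded r))[_ [f [hf dE fE]]]]].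
have [cf [_ cfK f0 hcf]] := collapsing_of_giso f.
pose c := ccomp cf (contraction (cforest a)).
have cF : collapsed c = cforest a.
  by rewrite collapsed_comp collapsed_contraction f0 imset0 setU0.
exists r, c; split=> //; split=> [||||e|e].
- by rewrite cF.
- apply: homotopic_trans hf.
  apply: homotopic_trans (gcomp_homotopic (ccomp_homotopic _ _) (homotopic_refl _)) _.
  apply: homotopic_trans (homotopic_sym (gcompA _ _ _)) _.
  apply: gcomp_homotopic hcf _.
  exact: gcomp_homotopic (contraction_homotopic _) (homotopic_refl _).
- by rewrite -dE.
- by move=> e; rewrite cF; exact: tlen_forest.
- by rewrite -{1}(cfK e) (fE _).1 -tlev_val.
- by rewrite -{1}(cfK e) (fE _).2 -tlen_val.
Qed.

Lemma coord_exists k lev len x : presents (tmarking T) k lev len x ->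
  exists a, [/\ coord_of a x, depth (cstrata a) = k, tlen a =1 len
    & forall e, len e != 0 -> tlev a e = lev e].
Proof.
move=> px; have adm := presents_admissible px; have [r [c [rx pc]]] := px.
have cE := presented_collapsed pc.
set F := collapsed c in cE.
have inF f : (f \in F) = (len f == 0) by rewrite cE inE.
have nF (e : edge (contract F)) : len (val e) != 0.
  by rewrite -inF; exact: valP e.
pose s := level_strata k (fun e : edge (contract F) => lev (val e))
  (fun e : edge (contract F) => len (val e)).
have le (e : edge (contract F)) : (lev (val e) <= k)%N by exact: (adm_le adm).
have gt0 (e : edge (contract F)) : 0 < len (val e) by rewrite lt_def nF (adm_ge0 adm).
pose a := @CellCoord R n T F s.
have [|f [fE hf]] := @giso_of_collapsings _ _ _ (contraction F) c.
  by rewrite collapsed_contraction.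
exists a; split=> [|//|e|e].
- split; first exact/forestP/(pres_acyclic pc).
  exists r => //; apply: (@graded_marked_iso _ _ (coord_marked a) r f).
  + exact: level_strata_graded.
  + exact: point_graded.
  + apply: homotopic_trans (pres_marking pc).
    apply: homotopic_trans (gcompA _ _ _) _.
    apply: gcomp_homotopic (homotopic_refl _).
    apply: homotopic_trans hf.
    exact: gcomp_homotopic (homotopic_refl _) (homotopic_sym (contraction_homotopic _)).
  + by rewrite (pres_depth pc).
  + move=> e; rewrite (pres_lev pc) (pres_len pc) fE.
    by rewrite slev_level_strata ?slen_level_strata.
- have [eF|[e' ->]] := contract_edgeP a e.
    by rewrite tlen_forest//; move: eF; rewrite /= inF => /eqP.
  by rewrite tlen_val slen_level_strata.
- have [eF|[e' ->]] := contract_edgeP a e.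
    by move: eF; rewrite /= inF => /eqP->; rewrite eqxx.
  by rewrite tlev_val slev_level_strata.
Qed.

(** Identifies the picked level with the minimum. The equality of lengths is claimed on [C] only,
    because [mlen] is arbitrary outside its stratum. *)
Lemma coord_level a x C L : coord_of a x -> is_level (tlev a) (tlen a) C L ->
  level a C = L /\ forall e, e \in C -> clen a L e = len_at (tlev a) (tlen a) L e.
Proof.
move=> ax [minL [g [gC g0 lg]]]; have gs := coord_graded ax; set s := cstrata a in gs.
have nF (e : edge (contract (cforest a))) : tlen a (val e) != 0.
  by rewrite tlen_val gt_eqF// slen_gt0.
have Lk : (L <= depth s)%N.
  have [gF|[g' gE]] := contract_edgeP a g; first by rewrite tlen_forest ?eqxx in g0.
  by rewrite -lg gE tlev_val slev_le.
have defP l : (l <= depth s)%N ->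
    reflect (forall e : edge (contract (cforest a)), val e \in C -> (l <= slev s e)%N)
      (cdefined a C l).
  move=> lk; apply: (iffP (fintype.subsetP)) => h e; have := h e; rewrite inE stratumE//.
have clenE l e : (l <= depth s)%N -> cdefined a C l -> e \in C ->
    clen a l e = len_at (tlev a) (tlen a) l e.
  move=> lk /(defP _ lk) dl; rewrite /len_at; have [eF _|[e' ->] eC] := contract_edgeP a e.
    by rewrite clen_forest// tlen_forest// if_same.
  by rewrite clen_val tlev_val tlen_val mlenE// dl.
have dL : cdefined a C L.
  by apply/defP => // e eC; rewrite -tlev_val minL.
split=> [|e]; last exact: clenE.
rewrite /level; case: pickP => [l /andP[dl /existsP[e /andP[eC]]]|].
  have lk : (l <= depth s)%N by rewrite -ltnS.
  rewrite clenE// /len_at; case: (eqVneq (tlev a e) l) => [le e0|_]; last by rewrite eqxx.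
  apply/eqP; rewrite eqn_leq -{2}le minL// andbT -lg.
  have [gF|[g' gE]] := contract_edgeP a g; first by rewrite tlen_forest ?eqxx in g0.
  by rewrite gE tlev_val (defP _ lk dl)// -gE.
move/(_ (Ordinal (Lk : (L < (depth s).+1)%N))); rewrite /= dL => /negbT/existsPn/(_ g).
by rewrite gC clenE// /len_at lg eqxx g0.
Qed.

Lemma rel_lenE a x C L e : coord_of a x -> is_level (tlev a) (tlen a) C L -> e \in C ->
  rel_len a C e = relative_len (tlev a) (tlen a) L C e.
Proof.
move=> ax lC eC; have [lE cE] := coord_level ax lC.
rewrite /rel_len lE cE// /relative_len; congr (_ / _); exact: eq_bigr.
Qed.

End Coordinates.

Section CellFlow.
Variables (R : realType) (n : nat) (T : marked_trivalent n).
Implicit Types (a b : cell_coord R T) (x y : Xhat R n) (C : {set edge T}) (t : R).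

Lemma coord_exists_rel k lev len x : presents (tmarking T) k lev len x ->
  exists2 a, coord_of a x & forall C L e, is_level lev len C L -> e \in C ->
    rel_len a C e = relative_len lev len L C e.
Proof.
move=> /coord_exists[a [ax _ lenE levE]]; exists a => // C L e [minL [f [fC f0 fL]]] eC.
have lC : is_level (tlev a) (tlen a) C L.
  split=> [g gC|]; first by rewrite lenE => g0; rewrite levE// minL.
  by exists f; rewrite lenE levE.
have atE g : len_at (tlev a) (tlen a) L g = len_at lev len L g.
  rewrite /len_at lenE; have [->|g0] := eqVneq (len g) 0; first by rewrite !if_same.
  by rewrite levE.
by rewrite (rel_lenE ax lC eC) /relative_len atE; congr (_ / _); exact: eq_bigr.
Qed.

Lemma coord_admissible a x : coord_of a x ->
  admissible (depth (cstrata a)) (tlev a) (tlen a).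
Proof. by move=> /coord_presents/presents_admissible. Qed.

Lemma trivalent_valence (v : vertex T) : (3 <= valence [set: edge T] v)%N.
Proof. by rewrite (tgraph_trivalent v). Qed.

Lemma nonbridges_neq0 : ~: bridges T != set0.
Proof.
have [e eB] := nonbridge_exists (tmarking T tt) trivalent_valence.
by apply/set0Pn; exists e; rewrite in_setC.
Qed.

Lemma core_nonbridges C : core C -> C \subset ~: bridges T.
Proof.
by move=> cC; apply/fintype.subsetP => e eC; rewrite in_setC; exact: core_nonbridge eC.
Qed.

Lemma rel_len_ge0 a x C e : coord_of a x -> (C != set0) && core C || (C == [set: edge T]) ->
  e \in C -> 0 <= rel_len a C e.
Proof.
move=> ax CI eC; have adm := coord_admissible ax.
have [L lC] : exists L, is_level (tlev a) (tlen a) C L.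
  case/orP: CI => [/andP[C0 cC]|/eqP->]; first exact: (is_level_core adm).
  by exists 0%N; exact: (is_level_setT adm).
by rewrite (rel_lenE ax lC)// (relative_len_ge0 adm).
Qed.

Lemma rel_len_sum a x C : coord_of a x -> (C != set0) && core C || (C == [set: edge T]) ->
  \sum_(e in C) rel_len a C e = 1.
Proof.
move=> ax CI; have adm := coord_admissible ax.
have [L lC] : exists L, is_level (tlev a) (tlen a) C L.
  case/orP: CI => [/andP[C0 cC]|/eqP->]; first exact: (is_level_core adm).
  by exists 0%N; exact: (is_level_setT adm).
by rewrite (eq_bigr _ (fun e => rel_lenE ax lC)) (relative_len_sum adm).
Qed.

Lemma flow_coord a x t : coord_of a x -> 0 <= t <= 1 ->
  exists a', [/\ coord_of a' (flow x t),
    forall C e, C != set0 -> core C -> e \in C -> rel_len a' C e = rel_len a C e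
  & forall e, rel_len a' [set: edge T] e =
      if e \in bridges T then (1 - t) * rel_len a [set: edge T] e
      else (1 - (1 - t) * \sum_(f in bridges T) rel_len a [set: edge T] f) *
           rel_len a (~: bridges T) e].
Proof.
move=> ax t01; have px := coord_presents ax; have adm := presents_admissible px.
have nb := presents_nonbridge px; have pf := flow_presents t01 px.
have admf := presents_admissible pf.
have [a' a'x relE] := coord_exists_rel pf; exists a'; split=> // [C e C0 cC eC|e].
  have [L lC] := is_level_core adm cC C0.
  have CB := core_nonbridges cC.
  rewrite (rel_lenE ax lC eC) (relE _ _ _ (flow_is_level adm nb t01 CB lC) eC).
  exact: (relative_len_flow adm nb t01 CB lC eC).
have eT (f : edge T) : f \in [set: edge T] by rewrite inE.
have relT f : rel_len a [set: edge T] f = len_at (tlev a) (tlen a) 0 f.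
  by rewrite (rel_lenE ax (is_level_setT adm))// (relative_len_setT adm).
rewrite (relE _ _ _ (is_level_setT admf) (eT e)) (relative_len_setT admf).
have [eB|eB] := boolP (e \in bridges T); first by rewrite (len_at_flow_bridge _ adm) ?relT.
have [L lN] := is_level_core adm (core_bridgesC T) nonbridges_neq0.
rewrite (len_at_flow_nonbridge t adm nb lN eB) (rel_lenE ax lN) ?in_setC//.
congr (_ * _); congr (1 - _ * _); apply: eq_bigr => f fB; rewrite relT /len_at.
by have [->|f0] := eqVneq (tlen a f) 0; rewrite ?if_same// (admissible_bridge adm).
Qed.

Lemma dist_at_ge0 C a b : 0 <= dist_at C a b.
Proof. by apply: sumr_ge0 => e _; exact: normr_ge0. Qed.

Lemma dist_at_le C a b : (C != set0) && core C || (C == [set: edge T]) ->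
  dist_at C a b <= cell_dist a b.
Proof.
move=> CI; rewrite /cell_dist (bigD1 C)//= lerDl.
by apply: sumr_ge0 => D _; exact: dist_at_ge0.
Qed.

Lemma cell_dist_ge0 a b : 0 <= cell_dist a b.
Proof. by apply: sumr_ge0 => D _; exact: dist_at_ge0. Qed.

Lemma cell_distxx a : cell_dist a a = 0.
Proof. by apply: big1 => C _; apply: big1 => e _; rewrite subrr normr0. Qed.

Lemma dist_mul (p q u v : R) : 0 <= p <= 1 -> 0 <= v ->
  `|p * u - q * v| <= `|u - v| + `|p - q| * v.
Proof.
move=> /andP[p0 p1] v0.
have -> : p * u - q * v = p * (u - v) + (p - q) * v by ring.
apply: le_trans (ler_normD _ _) _; rewrite !normrM (ger0_norm p0) (ger0_norm v0).
by rewrite lerD2r ler_piMl.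
Qed.

(** With D the distance restricted to the bridges, the bridges contribute at most D + |s - t|; the
    other edges contribute the distance on the nonbridge core plus the change of their total share,
    again at most D + |s - t|. Since D is at most [cell_dist a b], this gives 3 and 2. *)
Lemma flow_dist_setT a b x y s t a' b' : 0 <= s <= 1 -> 0 <= t <= 1 ->
  coord_of a x -> coord_of b y ->
  (forall e, rel_len a' [set: edge T] e =
      if e \in bridges T then (1 - s) * rel_len a [set: edge T] e
      else (1 - (1 - s) * \sum_(f in bridges T) rel_len a [set: edge T] f) *
           rel_len a (~: bridges T) e) ->
  (forall e, rel_len b' [set: edge T] e =
      if e \in bridges T then (1 - t) * rel_len b [set: edge T] e
      else (1 - (1 - t) * \sum_(f in bridges T) rel_len b [set: edge T] f) *
           rel_len b (~: bridges T) e) ->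
  dist_at [set: edge T] a' b' <= 3 * cell_dist a b + 2 * `|s - t|.
Proof.
move=> /andP[s0 s1] /andP[t0 t1] ax bx aE bE.
set sa := \sum_(f in _) rel_len a _ f in aE; set sb := \sum_(f in _) rel_len b _ f in bE.
have IT : ([set: edge T] != set0) && core [set: edge T] || ([set: edge T] == [set: edge T]).
  by rewrite eqxx orbT.
have IN : (~: bridges T != set0) && core (~: bridges T) || (~: bridges T == [set: edge T]).
  by rewrite core_bridgesC nonbridges_neq0.
have eT (f : edge T) : f \in [set: edge T] by rewrite inE.
have geT e : 0 <= rel_len b [set: edge T] e by exact: rel_len_ge0 bx IT (eT e).
have geTa e : 0 <= rel_len a [set: edge T] e by exact: rel_len_ge0 ax IT (eT e).
have split_sum (f : edge T -> R) : \sum_(e in [set: edge T]) f e =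
    \sum_(e in bridges T) f e + \sum_(e in ~: bridges T) f e.
  rewrite (bigID (mem (bridges T)))/=.
  by congr (_ + _); apply: eq_bigl => e; rewrite ?in_setC in_setT.
have sb01 : 0 <= sb <= 1.
  rewrite -(rel_len_sum bx IT) split_sum lerDl !sumr_ge0//.
have sa01 : 0 <= sa <= 1.
  rewrite -(rel_len_sum ax IT) split_sum lerDl !sumr_ge0//.
set dB := \sum_(e in bridges T) `|rel_len a [set: edge T] e - rel_len b [set: edge T] e|.
have dB_le : dB <= cell_dist a b.
  apply: le_trans (dist_at_le a b IT); rewrite /dist_at split_sum lerDl.
  by apply: sumr_ge0 => e _; exact: normr_ge0.
have sab : `|sa - sb| <= dB.
  rewrite /sa /sb -sumrB; exact: ler_norm_sum.
have part1 : \sum_(e in bridges T) `|rel_len a' [set: edge T] e - rel_len b' [set: edge T] e|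
    <= dB + `|s - t|.
  apply: le_trans (_ : \sum_(e in bridges T)
    (`|rel_len a [set: edge T] e - rel_len b [set: edge T] e| +
     `|s - t| * rel_len b [set: edge T] e) <= _).
    apply: ler_sum => e eB; rewrite aE bE eB.
    have -> : `|s - t| = `|(1 - s) - (1 - t)| by rewrite distrC; congr `|_|; ring.
    by apply: dist_mul => //; rewrite subr_ge0 s1 gerBl.
  rewrite big_split /= lerD2l -mulr_sumr -/sb ler_piMr//.
  by case/andP: sb01.
have part2 : \sum_(e in ~: bridges T) `|rel_len a' [set: edge T] e - rel_len b' [set: edge T] e|
    <= cell_dist a b + `|(1 - (1 - s) * sa) - (1 - (1 - t) * sb)|.
  apply: le_trans (_ : \sum_(e in ~: bridges T)
    (`|rel_len a (~: bridges T) e - rel_len b (~: bridges T) e| +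
     `|(1 - (1 - s) * sa) - (1 - (1 - t) * sb)| * rel_len b (~: bridges T) e) <= _).
    apply: ler_sum => e eN; have := eN; rewrite in_setC => eB.
    rewrite aE bE (negbTE eB); apply: dist_mul; last exact: rel_len_ge0 bx IN eN.
    have /andP[sa0 sa1] := sa01; apply/andP; split.
      by rewrite subr_ge0; apply: le_trans sa1; rewrite ler_piMl// gerBl.
    by rewrite gerBl mulr_ge0// subr_ge0.
  rewrite big_split /= -mulr_sumr (rel_len_sum bx IN) mulr1 lerD2r.
  exact: dist_at_le IN.
have part3 : `|(1 - (1 - s) * sa) - (1 - (1 - t) * sb)| <= dB + `|s - t|.
  have -> : (1 - (1 - s) * sa) - (1 - (1 - t) * sb) = - ((1 - s) * sa - (1 - t) * sb) by ring.
  rewrite normrN; apply: le_trans (dist_mul _ _ _ _) _.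
  - by rewrite subr_ge0 s1 gerBl.
  - by case/andP: sb01.
  have -> : `|1 - s - (1 - t)| = `|s - t| by rewrite distrC; congr `|_|; ring.
  by rewrite lerD// ler_piMr//; case/andP: sb01.
rewrite /dist_at split_sum; apply: le_trans (lerD part1 part2) _.
lra.
Qed.

(** The cardinal bounds the number of cores in the sum. The coordinate [a'] is fixed before [b]
    because [cell_open] gives a radius around one given coordinate. *)
Lemma flow_cell_dist a x s : coord_of a x -> 0 <= s <= 1 ->
  exists2 a' : cell_coord R T, coord_of a' (flow x s) &
    forall b y t, coord_of b y -> 0 <= t <= 1 ->
    exists2 b' : cell_coord R T, coord_of b' (flow y t) &
      cell_dist a' b' <= (3 * cell_dist a b + 2 * `|s - t|) * #|{set edge T}|%:R.
Proof.
move=> ax s01; have [a' [a'x aC aT]] := flow_coord ax s01; exists a' => // b y t bx t01.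
have [b' [b'x bC bT]] := flow_coord bx t01; exists b' => //.
have pos : 0 <= 3 * cell_dist a b + 2 * `|s - t|.
  by rewrite addr_ge0 ?mulr_ge0// cell_dist_ge0.
have distC C : (C != set0) && core C || (C == [set: edge T]) ->
    dist_at C a' b' <= 3 * cell_dist a b + 2 * `|s - t|.
  case/orP => [/andP[C0 cC]|/eqP->]; last exact: (flow_dist_setT s01 t01 ax bx aT bT).
  have -> : dist_at C a' b' = dist_at C a b.
    by apply: eq_bigr => e eC; rewrite aC ?bC.
  have := dist_at_le a b (introT orP (or_introl (introT andP (conj C0 cC)))).
  have := cell_dist_ge0 a b; have := normr_ge0 (s - t); lra.
rewrite {1}/cell_dist; apply: le_trans (ler_sum _ distC) _.
rewrite big_mkcond /=.
apply: le_trans (_ : \sum_(C : {set edge T}) (3 * cell_dist a b + 2 * `|s - t|) <= _).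
  by apply: ler_sum => C _; case: ifP.
by rewrite sumr_const mulr_natr.
Qed.

End CellFlow.

(** * Values of the flow and cut vertices *)

Section Cover.
Variables (R : realType) (n : nat).

(** The graph of x is expanded to a trivalent one, marked through a homotopy inverse of the
    collapse. *)
Lemma coord_cover (x : Xhat R n) :
  exists (T : marked_trivalent n) (a : cell_coord R T), coord_of a x.
Proof.
pose r := repr x; have [con val3 eqv _] := point_valid r.
have [T [c [aF T3]]] := trivalent_expansion val3.
have [g [gc cg]] := collapsing_inverse aF.
have Tcon : connected_graph T by rewrite -(connected_collapse c).
have Teqv : homotopy_equivalence (gcomp g (marking r)).
  by apply: homotopy_equivalence_comp => //; exists c.
pose T' := MarkedTrivalent Tcon T3 Teqv.
(* The default is taken on the collapsed edges: their length must be 0, and their level is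
   irrelevant. *)
pose pull (A : Type) (d : A) (f : edge (mgraph r) -> A) (e : edge T) : A :=
  if [pick e' | ci c e' == e] is Some e' then f e' else d.
have pull_ci A d (f : _ -> A) e : pull A d f (ci c e) = f e.
  by rewrite /pull; case: pickP => [e' /eqP/ci_inj->//|/(_ e)]; rewrite eqxx.
have pr : presents (marking r) (depth r) (slev r) (slen r) x.
  by have := presents_self r; rewrite point_class_repr.
exists T'; have [|a [ax _ _ _]] :=
    @coord_exists R n T' (depth r) (pull _ 0%N (slev r)) (pull _ 0 (slen r)) x; last by exists a.
apply: (presents_comp (c := c)) pr => [//||e|e|e eF].
- apply: homotopic_trans (gcompA _ _ _) _.
  apply: homotopic_trans (gcomp_id_l _).
  exact: gcomp_homotopic cg (homotopic_refl _).
- by rewrite pull_ci.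
- by rewrite pull_ci.
- rewrite /pull; case: pickP => // e' /eqP ee'.
  by move: eF; rewrite -ee' (negbTE (ci_ncollapsed _ _)).
Qed.

End Cover.

Section FlowValues.
Variables (R : realType) (n : nat).
Implicit Types (x y : Xhat R n) (r : marked_point R n) (t : R).

Lemma presents_repr x :
  presents (marking (repr x)) (depth (repr x)) (slev (repr x)) (slen (repr x)) x.
Proof. by have := presents_self (repr x); rewrite point_class_repr. Qed.

Lemma flow_start x : flow x 0 = x.
Proof.
have px := presents_repr x; have adm := presents_admissible px.
have nb := presents_nonbridge px.
have t01 : 0 <= (0 : R) <= 1 by rewrite lexx ler01.
apply: (presents_inj _ px).
have := flow_presents t01 px.
have dropE : flow_drop (0 : R) (slev (repr x)) (slen (repr x)) = 0%N.
  by rewrite /flow_drop eqxx andbF.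
rewrite dropE subn0; apply: presents_eq => e; last by rewrite /flow_lev dropE subn0.
rewrite /flow_len subr0 !mul1r; case: ifP => // /negbT eB; case: eqP => // le.
rewrite (base_lenE _ adm nb) eqxx andbF divff ?mul1r//.
rewrite subr_eq0 gt_eqF//; apply: (bridge_len_nfull adm).
apply/negP => full; move: le; rewrite /flow_lev dropE subn0 => le.
have := flow_fullP full eB; rewrite le gt_eqF => [/(_ isT)//|].
exact: slen_gt0 (point_graded _) _.
Qed.

Definition bridgeless x : Prop := forall e, e \notin bridges (mgraph (repr x)).

Lemma presents_bridgeless G (m : gmap (rose n) G) k lev len x :
  presents m k lev len x -> bridgeless x <-> (forall e, e \in bridges G -> len e = 0).
Proof.
move=> px; have [c pc] := presents_representative (point_class_repr x) px.
split=> [nB e eB|B0 e].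
  have [/(pres_collapsed pc)//|[e' ee']] := collapsedP c e.
  by move: eB; rewrite ee' -bridges_collapse (negbTE (nB e')).
apply/negP; rewrite (bridges_collapse c) => /B0 e0.
have := slen_gt0 (point_graded (repr x)) e.
by rewrite (pres_len pc) e0 ltxx.
Qed.

Lemma presents_depth G (m : gmap (rose n) G) k lev len x r :
  presents m k lev len x -> point_class r = x -> depth r = k.
Proof.
by move=> px rx; have [c pc] := presents_representative rx px; exact: pres_depth pc.
Qed.

Lemma XnE G (m : gmap (rose n) G) k lev len x :
  presents m k lev len x -> Xn x <-> k = 0%N.
Proof.
move=> px; split=> [[r r0 rx]|k0]; first by rewrite -(presents_depth px rx).
exists (repr x); last exact: point_class_repr.
by rewrite /= (presents_depth px (point_class_repr x)).
Qed.

Lemma bridgelessP r : bridgeless (point_class r) <->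
  forall e, ~~ separating [set: edge (mgraph r)]%SET e.
Proof.
rewrite (presents_bridgeless (presents_self r)); split=> h e.
  apply/negP => eB; have /h : e \in bridges (mgraph r) by rewrite inE.
  by apply/eqP; rewrite gt_eqF// slen_gt0//; exact: point_graded.
by rewrite inE (negbTE (h e)).
Qed.

Lemma YnE x : Yn x <-> Xn x /\ bridgeless x.
Proof.
split=> [[r [r0 rB] <-]|[Xx Bx]].
  by split; [exists r|exact/bridgelessP].
exists (repr x); last exact: point_class_repr.
split; last by apply/bridgelessP; rewrite point_class_repr.
exact/(XnE (presents_repr x)).
Qed.

Lemma flow_fixed x t : 0 <= t <= 1 -> bridgeless x -> flow x t = x.
Proof.
move=> t01 Bx; have px := presents_repr x; have adm := presents_admissible px.
have nb := presents_nonbridge px.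
have s0 : bridge_len (slen (repr x)) = 0.
  by apply: big1 => e eB; move: eB; rewrite (negbTE (Bx e)).
have nfull : flow_full (slev (repr x)) (slen (repr x)) = false.
  by apply/negP => /(bridge_len_full adm)/eqP; rewrite s0 eq_sym oner_eq0.
have dropE : flow_drop t (slev (repr x)) (slen (repr x)) = 0%N.
  by rewrite /flow_drop nfull.
apply: (presents_inj _ px); have := flow_presents t01 px.
rewrite dropE subn0; apply: presents_eq => e; last by rewrite /flow_lev dropE subn0.
rewrite /flow_len (negbTE (Bx e)); case: ifP => // _.
by rewrite (base_lenE _ adm nb) nfull s0 mulr0 subr0 divr1 mul1r.
Qed.

Lemma bridgeless_flow1 x : bridgeless (flow x 1).
Proof.
have t01 : 0 <= (1 : R) <= 1 by rewrite ler01 lexx.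
rewrite (presents_bridgeless (flow_presents t01 (presents_repr x))) => e eB.
by rewrite /flow_len eB subrr mul0r.
Qed.

Lemma presents_act G (m : gmap (rose n) G) k lev len x (phi : Out n) :
  presents m k lev len x ->
  presents (gcomp m (rose_map (repr phi))) k lev len (out_act x phi).
Proof.
move=> [r [c [rx pc]]].
have actE : out_act x phi = point_class (point_act r (repr phi)).
  by rewrite -out_act_class reprK rx.
exists (point_act r (repr phi)), c; split; first by rewrite actE.
have [aF hm dE cE lE leE] := pc; split=> //.
apply: homotopic_trans (gcompA _ _ _) _.
exact: gcomp_homotopic hm (homotopic_refl _).
Qed.

Lemma flow_equivariant x t (phi : Out n) : 0 <= t <= 1 ->
  flow (out_act x phi) t = out_act (flow x t) phi.
Proof.
move=> t01; have px := presents_repr x.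
apply: presents_inj (flow_presents t01 (presents_act phi px)) _.
exact: presents_act (flow_presents t01 px).
Qed.

End FlowValues.

(** * Bridges and cut vertices *)

Section CutVertex.
Variables (G H : graph) (c : collapsing G H) (e : edge G).
Hypotheses (eF : e \in collapsed c) (eB : e \in bridges G).

Let side (u : vertex G) := connect (adj ([set: edge G] :\ e)) (src e) u.

Let side_edge f : f != e -> side (src f) = side (tgt f).
Proof.
move=> fe; apply: (same_connect_r (@connect_adjC _ _)).
by apply: connect_edge; rewrite !inE fe.
Qed.

(** A collapsed component other than the one containing [e] stays on one side of the bridge. *)
Let side_fiber u v : cv c u = cv c v -> cv c u != cv c (src e) -> side u = side v.
Proof.
move=> uv ue; have cuv : connect (adj (collapsed c)) u v by rewrite -cv_fiber uv.
have sub x y : connect (adj (collapsed c :\ e)) x y -> connect (adj (collapsed c)) x y.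
  by apply: connect_adjS; exact: subD1set.
have [h|/(connect_setD1 eF cuv)] := boolP (connect (adj (collapsed c :\ e)) u v).
  apply: (same_connect_r (@connect_adjC _ _)); apply: connect_adjS h.
  by apply: setSD; exact: subsetT.
have ue' : ~~ connect (adj (collapsed c)) u (src e) by rewrite -cv_fiber.
case/orP => /andP[/sub h _]; first by rewrite h in ue'.
case/negP: ue'; apply: connect_trans h _; rewrite connect_adjC.
exact: connect_edge.
Qed.

(* The side of the bridge is constant along paths avoiding its image. *)
Lemma cut_vertex_collapse (f1 f2 : edge H) :
  connect (adj ([set: edge G] :\ e)) (src e) (src (ci c f1)) ->
  connect (adj ([set: edge G] :\ e)) (tgt e) (src (ci c f2)) ->
  cut_vertex (cv c (src e)).
Proof.
move=> s1 s2; have [l lK] := choice (cv_surj c).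
(* The side of a cell of H, read on a lift. For vertices other than the image of [e] it does not
   depend on the lift, by [side_fiber]. *)
pose P (a : (vertex H + edge H)%type) : bool :=
  match a with inl w => side (l w) | inr f => side (src (ci c f)) end.
have ne f : ci c f != e.
  by apply: contraTneq eF => <-; exact: ci_ncollapsed.
have Pwe w f : w != cv c (src e) -> (src f == w) || (tgt f == w) ->
    side (l w) = side (src (ci c f)).
  move=> we fw.
  have [u uw us] : exists2 u, cv c u = w & side u = side (src (ci c f)).
    have /orP[/eqP<-|/eqP<-] : (cv c (src (ci c f)) == w) || (cv c (tgt (ci c f)) == w).
      by rewrite cv_src cv_tgt /dend /dorg /drev /=; case: (cfl c f); rewrite // orbC.
    - by exists (src (ci c f)).
    - by exists (tgt (ci c f)) => //; rewrite -side_edge.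
  by rewrite -us; apply: side_fiber; rewrite lK ?uw.
have Pcl a b : incident_off (cv c (src e)) a b -> P a = P b.
  case: a b => [w|f] [w'|f'] //= /andP[we fw]; first exact: Pwe.
  by apply/esym; exact: Pwe.
apply/existsP; exists (inr f1); apply/existsP; exists (inr f2); rewrite /=.
apply/negP => /connectP[p pp pl].
have : P (inr f1) = P (inr f2).
  rewrite pl; elim: p (inr f1 : (vertex H + edge H)%type) pp {pl} => //= b p IH a.
  by case/andP => /Pcl-> /IH.
rewrite /= /side s1 => /esym h.
by move: eB; rewrite bridgesE; case/negP; apply: connect_trans h _; rewrite connect_adjC.
Qed.

End CutVertex.

Section CutSplit.
Variables (G : graph) (v : vertex G).
Hypothesis conn : connected_graph G.
Hypothesis val3 : forall w, (3 <= valence [set: edge G] w)%N.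
Hypothesis bridgeless_G : forall e : edge G, e \notin bridges G.
Implicit Types (d : dart G) (a : (vertex G + edge G)%type).

Let off_sym : connect_sym (incident_off v).
Proof. by apply: sym_connect_sym => -[u|e] [w|f]. Qed.

Lemma off_dart a d : dorg d != v ->
  connect (incident_off v) a (inl (dorg d)) = connect (incident_off v) a (inr d.1).
Proof.
move=> dv; apply: (same_connect_r off_sym); apply: connect1 => /=.
by rewrite dv /dorg; case: d.2; rewrite eqxx ?orbT.
Qed.

(** A component of G minus [v] that no edge at [v] belongs to would be invariant under all edges of
    G, against connectedness. *)
Lemma off_reaches a : a != inl v ->
  exists d : dart G, dorg d = v /\ connect (incident_off v) a (inr d.1).
Proof.
move=> av; apply: contrapT => none.
pose Q w := (w != v) && connect (incident_off v) a (inl w).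
have Qdart d : Q (dorg d) = connect (incident_off v) a (inr d.1).
  rewrite /Q; have [dv|dv] := eqVneq (dorg d) v; last exact: off_dart.
  by apply/esym/negP => h; apply: none; exists d.
have Qe e : e \in [set: edge G] -> Q (src e) = Q (tgt e).
  by move=> _; rewrite -[src e]/(dorg (e, false)) -[tgt e]/(dorg (e, true)) !Qdart.
have Q0 u : Q u = false.
  by rewrite (connect_invariant Qe (forallP (forallP conn u) v)) /Q eqxx.
case: a av @Q Qdart {Qe} Q0 {none} => [u uv Q _ Q0|e _ Q Qdart Q0].
  by have := Q0 u; rewrite /Q connect0 andbT (_ : u != v).
by have := Qdart (e, false); rewrite Q0 connect0.
Qed.

Variables (a b : (vertex G + edge G)%type).
Hypotheses (av : a != inl v) (bv : b != inl v).
Hypothesis ab : ~~ connect (incident_off v) a b.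

(** The darts at [v] leading into the component of [a] go to the new vertex, so that the new edge is
    the only link between this component and the rest. *)
Let D : pred (dart G) := fun d => connect (incident_off v) a (inr d.1).
Let G' := split_graph v D.

Lemma cut_split_bridges : bridges G' = [set None].
Proof.
apply/setP => -[e|]; rewrite in_set1; last first.
  rewrite bridgesE; apply/negP => h.
  (* The side of the new vertex: itself and the component of [a]. Old edges do not cross this
     cut. *)
  pose P (u : vertex G') := if u is Some w then
    (w != v) && connect (incident_off v) a (inl w) else true.
  have Pdart d : P (split_end v D d) = D d.
    rewrite /P /split_end /moved /D; have [dv|dv] := eqVneq (dorg d) v.
      by case: ifP => //=; rewrite dv eqxx.
    by rewrite /= dv off_dart.
  have : P (Some v) = P None.
    apply: (connect_invariant _ h) => -[e|]; last by rewrite !inE eqxx.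
    by move=> _; rewrite !Pdart.
  by rewrite /= eqxx.
rewrite -[Some e : edge G']/(ci (split_collapse v D) e) -bridges_collapse.
by rewrite (negbTE (bridgeless_G e)).
Qed.

(** Each end of the new edge meets an old edge, by [off_reaches] for [a] and for [b]. The old edges
    form a core, which has no vertex of valence 1, so they give at least 2, and the new edge gives 1
    more. *)
Lemma cut_split_valence w : (3 <= valence [set: edge G'] w)%N.
Proof.
have vE : valence [set: edge G'] w = ((Some v == w) + (None == w) +
    valence (~: bridges G') w)%N.
  rewrite /valence (bigD1 None) ?inE//=; congr addn.
  by apply: eq_bigl => e; rewrite cut_split_bridges !inE.
have v1 : valence (~: bridges G') w != 1%N.
  by have /andP[_ /forallP/(_ w)] := core_bridgesC G'.
have sE : valence (~: bridges G') w = (\sum_d (split_end v D d == w))%N.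
  by move: vE; rewrite split_valence => /eqP; rewrite eqn_add2l => /eqP.
have pos d : split_end v D d = w -> (0 < valence (~: bridges G') w)%N.
  by move=> dw; rewrite sE (bigD1 d)//= dw eqxx.
case: w vE v1 sE pos => [w|] vE v1 sE pos.
  have [wv|wv] := eqVneq w v; last by rewrite split_valence_other.
  have [d [dv bd]] := off_reaches bv.
  have nD : D d = false.
    by apply/negbTE; apply: contra ab => ad; apply: connect_trans ad _; rewrite off_sym.
  rewrite wv in vE v1 pos *; have := pos d.
  rewrite /split_end /moved nD andbF dv => /(_ erefl) p.
  by rewrite vE eqxx; move: p v1; case: (valence _ _) => [|[|j]].
have [d [dv ad]] := off_reaches av.
have := pos d; rewrite /split_end /moved /D ad dv eqxx => /(_ erefl) p.
by rewrite vE /=; move: p v1; case: (valence _ _) => [|[|j]].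
Qed.

End CutSplit.

(** * Topology *)

Local Open Scope classical_set_scope.

Section Continuity.
Variables (R : realType) (n : nat).
Implicit Types (x y : Xhat R n) (V : set (Xhat R n)).

Lemma nbhs_XhatE x V : nbhs x V <-> exists U, [/\ Xhat_open U, U x & U `<=` V].
Proof. by []. Qed.

Lemma flow_cell_open V (T : marked_trivalent n) (a : cell_coord R T) x s :
  Xhat_open V -> coord_of a x -> 0 <= s <= 1 -> V (flow x s) ->
  exists2 eps : R, 0 < eps & forall b y t, coord_of b y -> 0 <= t <= 1 ->
    cell_dist a b < eps -> `|s - t| < eps -> V (flow y t).
Proof.
move=> oV ax s01 Vxs; have [a' a'x lip] := flow_cell_dist ax s01.
have [eps eps0 Veps] := oV T a' _ a'x Vxs.
(* 5 is the sum of the Lipschitz constants 3 and 2, as both distances will be below the same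
   radius. *)
pose K : R := 5 * #|{set edge T}|%:R.
have K0 : 0 < K.
  by rewrite mulr_gt0// ltr0n; apply/card_gt0P; exists finset.set0.
exists (eps / K); first by rewrite divr_gt0.
move=> b y t bY t01 dab dst; have [b' b'y le] := lip b y t bY t01.
apply: (Veps b' _ b'y); apply: le_lt_trans le _.
have -> : eps = (3 * (eps / K) + 2 * (eps / K)) * #|{set edge T}|%:R.
  rewrite -mulrDl -mulrA mulrCA -natrD -/K.
  by rewrite [X in _ = X](_ : _ = eps / K * K); [rewrite divfK// gt_eqF|rewrite /K; ring].
rewrite ltr_pM2r; last by rewrite ltr0n; apply/card_gt0P; exists finset.set0.
by rewrite ltrD// ltr_pM2l.
Qed.

(** In one cell, each time of [J] has a radius that also serves nearby times, and compactness gives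
    one radius for all of [J]. The radius may depend on the cell. *)
Lemma flow_uniform_open V (J : set R) : Xhat_open V -> compact J ->
  (forall t, J t -> 0 <= t <= 1) ->
  Xhat_open [set x | forall t, J t -> V (flow x t)].
Proof.
move=> oV /compact_near_coveringP cJ J01 T a x ax VJ.
pose P (eps t : R) := 0 <= t <= 1 -> forall (b : cell_coord R T) y,
  coord_of b y -> cell_dist a b < eps -> V (flow y t).
have near_P : \forall eps \near (0 : R)^'+, J `<=` P eps.
  apply: cJ => s Js.
  have [eps eps0 Veps] := flow_cell_open oV ax (J01 s Js) (VJ s Js).
  exists (ball s eps, [set d | d < eps]) => /=.
    by split; [exact: nbhsx_ballx|exact: nbhs_right_lt].
  move=> [t d] [/= st de] t01 b y bY dab.
  by apply: (Veps b y t bY t01) => //; exact: lt_trans dab de.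
have [eps [epsJ eps0]] : exists eps : R, (J `<=` P eps) /\ 0 < eps.
  apply: (@filter_ex _ (0 : R)^'+); apply: filterI near_P _.
  exact: nbhs_right_gt.
by exists eps => // b y bY dab t Jt; exact: (epsJ t Jt (J01 t Jt) b y bY dab).
Qed.

Lemma flow_continuous :
  {within [set p : Xhat R n * R | 0 <= p.2 <= 1],
    continuous (fun p : Xhat R n * R => flow p.1 p.2)}.
Proof.
apply/subspace_continuousP => -[x s] /= s01 V /nbhs_XhatE[U [oU Ux UV]].
have [T [a ax]] := coord_cover x.
have [eps eps0 Ueps] := flow_cell_open oU ax s01 Ux.
(* Half the radius makes the closed interval [J] fit in the open one on which the flow of [x] stays
   in [U]; then [W] is an open neighbourhood of [x]. *)
pose J := [set t : R | 0 <= t <= 1 /\ `|s - t| <= eps / 2].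
have JE : J = `[Num.max 0 (s - eps / 2), Num.min 1 (s + eps / 2)].
  apply/seteqP; split=> t; rewrite /J /= in_itv /= ge_max le_min.
    by move=> [/andP[-> ->]]; rewrite ler_distlC => /andP[-> ->].
  by move=> /andP[/andP[-> h1] /andP[-> h2]]; rewrite ler_distlC h1 h2.
have cJ : compact J by rewrite JE; exact: segment_compact.
have J01 t : J t -> 0 <= t <= 1 by case.
pose W := [set y | forall t, J t -> U (flow y t)].
have Wx : nbhs x W.
  apply/nbhs_XhatE; exists W; split=> //; first exact: flow_uniform_open.
  move=> t [t01 st]; apply: (Ueps a x t ax t01); first by rewrite cell_distxx.
  by apply: le_lt_trans st _; rewrite ltr_pdivrMr// ltr_pMr// ltr1n.
exists (W, ball s (eps / 2)) => /=.
  by split=> //; apply: nbhsx_ballx; rewrite divr_gt0.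
move=> [y t] [/= Wy st] t01; apply: UV; apply: Wy; split=> //.
exact: ltW.
Qed.

End Continuity.

(** * The closure of $Y_n$ *)

Section Degeneration.
Variables (R : realType) (G : graph) (k : nat).
Variables (lev : edge G -> nat) (len : edge G -> R).
Hypothesis adm : admissible k lev len.
Implicit Types (C : {set edge G}) (L : nat) (e : edge G) (d : R).

(** The relative metric on [C] of the sum of the d^i m_i, with d^L divided out so that d = 0 makes
    sense. When [L] is the level of [C], the subtraction truncates only at edges of length 0. *)
Definition weighted_share C L e d : R :=
  d ^+ (lev e - L) * len e / \sum_(f in C) (d ^+ (lev f - L) * len f).

(* A metric of volume 1 on the whole graph, of relative order d^l on level l. *)
Definition weight d e : R := weighted_share finset.setT 0 e d.

Lemma pow0_len C L e : is_level lev len C L -> e \in C ->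
  0 ^+ (lev e - L) * len e = len_at lev len L e.
Proof.
move=> [minL _] eC; rewrite /len_at expr0n subn_eq0.
have [->|e0] := eqVneq (len e) 0; first by rewrite mulr0 if_same.
rewrite eqn_leq (minL _ eC e0) andbT.
by case: leqP => _; rewrite ?mul1r ?mul0r.
Qed.

Lemma weighted_share0 C L e : is_level lev len C L -> e \in C ->
  weighted_share C L e 0 = relative_len lev len L C e.
Proof.
move=> lC eC; rewrite /weighted_share /relative_len (pow0_len lC)//.
by congr (_ / _); apply: eq_bigr => f fC; exact: (pow0_len lC fC).
Qed.

Lemma cvg_weighted_share C L e : is_level lev len C L -> e \in C ->
  weighted_share C L e d @[d --> (0 : R)] --> relative_len lev len L C e.
Proof.
move=> lC eC; rewrite -weighted_share0//.
have cvg_pow f : d ^+ (lev f - L) * len f @[d --> (0 : R)] --> 0 ^+ (lev f - L) * len f.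
  by apply: cvgM; [exact: exprn_continuous|exact: cvg_cst].
apply: cvgM; first exact: cvg_pow.
apply: cvgV.
  rewrite (eq_bigr _ (fun f fC => pow0_len lC fC)).
  by rewrite gt_eqF//; exact: (len_at_gt0 adm lC).
by apply: cvg_big => //; exact: add_continuous.
Qed.

Lemma weighted_sum_gt0 C L d : 0 < d -> is_level lev len C L ->
  0 < \sum_(f in C) (d ^+ (lev f - L) * len f).
Proof.
move=> d0 [minL [e [eC e0 le]]]; rewrite (bigD1 e)//=; apply: ltr_pwDl.
  by rewrite le subnn mul1r lt_def e0 (adm_ge0 adm).
by apply: sumr_ge0 => f _; rewrite mulr_ge0 ?exprn_ge0 ?(adm_ge0 adm)// ltW.
Qed.

Lemma weight_eq0 d e : 0 < d -> (weight d e == 0) = (len e == 0).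
Proof.
move=> d0; rewrite /weight /weighted_share subn0 !mulf_eq0 invr_eq0.
rewrite [X in _ || X]gt_eqF; last exact: (weighted_sum_gt0 d0 (is_level_setT adm)).
by rewrite expf_eq0 (gt_eqF d0) andbF /= orbF.
Qed.

Lemma weight_admissible d : 0 < d -> admissible 0 (fun=> 0%N) (weight d).
Proof.
move=> d0; have S0 := weighted_sum_gt0 d0 (is_level_setT adm); split=> //.
- move=> e; rewrite divr_ge0 ?(ltW S0)// mulr_ge0 ?(adm_ge0 adm)//.
  by rewrite exprn_ge0// ltW.
- have -> : [set e | weight d e == 0]%SET = [set e | len e == 0]%SET.
    by apply/setP => e; rewrite !inE weight_eq0.
  exact: adm_acyclic adm.
- move=> i; rewrite leqn0 => /eqP->; rewrite /weight /weighted_share -mulr_suml.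
  rewrite (eq_bigl (mem finset.setT)) => [|e]; last by rewrite !inE eqxx.
  by rewrite divff// gt_eqF.
- by move=> [].
Qed.

Lemma relative_weight C L e d : 0 < d -> is_level lev len C L -> e \in C ->
  is_level (fun=> 0%N) (weight d) C 0 /\
  relative_len (fun=> 0%N) (weight d) 0 C e = weighted_share C L e d.
Proof.
move=> d0 lC eC; have [minL [g [gC g0 lg]]] := lC; split.
  by split=> //; exists g; rewrite weight_eq0.
have S0 := weighted_sum_gt0 d0 (is_level_setT adm).
set K := d ^+ L / \sum_(f in [set: edge G]%SET) (d ^+ (lev f - 0) * len f).
have K0 : K != 0 by rewrite mulf_neq0 ?invr_eq0 ?expf_neq0// gt_eqF.
have wE f : f \in C -> len_at (fun=> 0%N) (weight d) 0 f = K * (d ^+ (lev f - L) * len f).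
  move=> fC; rewrite /len_at eqxx /weight /weighted_share subn0.
  have [->|f0] := eqVneq (len f) 0; first by rewrite !mulr0 mul0r.
  by rewrite -{1}(subnK (minL _ fC f0)) exprD /K; ring.
rewrite /relative_len wE// (eq_bigr _ wE) -mulr_sumr /weighted_share.
by rewrite invfM mulrACA divff// mul1r.
Qed.

End Degeneration.

Section Closure.
Variables (R : realType) (n : nat).
Implicit Types (x y : Xhat R n).

Lemma bridged_open : Xhat_open [set x : Xhat R n | ~ bridgeless x].
Proof.
move=> T a x ax /= nB; have px := coord_presents ax; have adm := presents_admissible px.
have [e eB e0] : exists2 e : edge T, e \in bridges T & tlen a e != 0.
  apply: contrapT => none; apply: nB; apply/(presents_bridgeless px) => e eB.
  by apply/eqP/negPn/negP => e0; apply: none; exists e.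
have relE (b : cell_coord R T) y : coord_of b y ->
    rel_len b [set: edge T]%SET e = tlen b e.
  move=> bY; have admb := coord_admissible bY.
  rewrite (rel_lenE bY (is_level_setT admb)) ?inE// (relative_len_setT admb) /len_at.
  by have [->|be0] := eqVneq (tlen b e) 0; rewrite ?if_same// (admissible_bridge admb).
(* The length of the bridge [e] is one term of the distance on the whole graph, so any point of the
   cell with length 0 on [e] is at least this far away. *)
exists (tlen a e); first by rewrite lt_def e0 (adm_ge0 adm).
move=> b y bY dab; rewrite /= (presents_bridgeless (coord_presents bY)) => /(_ e eB) be0.
move: dab; apply/negP; rewrite -leNgt.
apply: le_trans (dist_at_le a b (C := [set: edge T]%SET) _); last by rewrite eqxx orbT.
rewrite /dist_at (bigD1 e) ?inE//= (relE _ _ ax) (relE _ _ bY) be0 subr0.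
rewrite (ger0_norm (adm_ge0 adm e)) lerDl.
by apply: sumr_ge0 => f _; exact: normr_ge0.
Qed.

Lemma YhatE x : Yhat x <-> bridgeless x.
Proof.
split=> [clx|Bx V /nbhs_XhatE[U [oU Ux UV]]].
  apply: contrapT => nB.
  have /clx[y [/YnE[_ By]]] : nbhs x [set x : Xhat R n | ~ bridgeless x].
    by apply/nbhs_XhatE; exists [set x : Xhat R n | ~ bridgeless x]; split => //; exact: bridged_open.
  by [].
have [T [a ax]] := coord_cover x.
have px := coord_presents ax; have adm := presents_admissible px.
have [eps eps0 Ueps] := oU T a x ax Ux.
pose index (C : {set edge T}) :=
  (C != finset.set0) && core C || (C == [set: edge T]%SET).
have /choice[Lf LfP] C : exists L, index C -> is_level (tlev a) (tlen a) C L.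
  have [|] := boolP (index C); last by exists 0%N.
  case/orP => [/andP[C0 cC]|/eqP->]; last by exists 0%N => _; exact: is_level_setT adm.
  by have [L lC] := is_level_core adm cC C0; exists L.
(* The cell distance from [a] to the point of metric [weight d], written as a function of d before
   coordinates of that point are chosen. *)
pose D (d : R) := \sum_(C | index C) \sum_(e in C)
  `|rel_len a C e - weighted_share (tlev a) (tlen a) C (Lf C) e d|.
have D0 : D d @[d --> (0 : R)] --> (0 : R).
  have E0 : \sum_(C | index C) \sum_(e in C)
      `|rel_len a C e - relative_len (tlev a) (tlen a) (Lf C) C e| = 0.
    apply: big1 => C IC; apply: big1 => e eC.
    by rewrite (rel_lenE ax (LfP C IC) eC) subrr normr0.
  have : D d @[d --> (0 : R)] --> \sum_(C | index C) \sum_(e in C)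
      `|rel_len a C e - relative_len (tlev a) (tlen a) (Lf C) C e|; last by rewrite E0.
  apply: cvg_big => [|C IC]; first exact: add_continuous.
  apply: cvg_big => [|e eC]; first exact: add_continuous.
  apply: cvg_norm; apply: cvgB; first exact: cvg_cst.
  exact: (cvg_weighted_share adm (LfP C IC) eC).
have [d [Dd d0]] : exists d, D d < eps /\ 0 < d.
  apply: (@filter_ex _ (0 : R)^'+); apply: filterI; last exact: nbhs_right_gt.
  exact: cvgr_lt (cvg_at_right_filter D0) _ eps0.
have [y py] := presents_exists (tgraph_connected T) (@trivalent_valence n T)
  (tmarking_equivalence T) (weight_admissible adm d0).
exists y; split.
  apply/YnE; split; first exact/(XnE py).
  apply/(presents_bridgeless py) => e eB; apply/eqP; rewrite (weight_eq0 adm)//; apply/eqP.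
  by apply: (presents_bridgeless px).1 eB.
have [b bY bE] := coord_exists_rel py; apply/UV/(Ueps b y bY).
apply: le_lt_trans Dd; rewrite /cell_dist /D; apply: ler_sum => C IC.
apply: ler_sum => e eC.
have [lC <-] := relative_weight adm d0 (LfP C IC) eC.
by rewrite (bE _ _ _ lC eC).
Qed.

End Closure.

(** * The image of the boundary *)

Section Image.
Variables (R : realType) (n : nat).
Implicit Types (x y : Xhat R n).

Let t01 : 0 <= (1 : R) <= 1.
Proof. by rewrite ler01 lexx. Qed.

Lemma flow_boundary x : ~ Xn x ->
  (@boundary_Yhat R n `|` @Yn_cut R n) (flow x 1).
Proof.
move=> nX; have px := presents_repr x; have pf := flow_presents t01 px.
have adm := presents_admissible px; have nb := presents_nonbridge px.
have By : bridgeless (flow x 1) by exact: bridgeless_flow1.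
have [Yy|nYy] := pselect (Yn (flow x 1)); last by left; split; first exact/YhatE.
right; have [Xy _] := (YnE _).1 Yy.
have := (XnE pf).1 Xy; set r := repr x in px pf adm nb *; set y := flow x 1 in pf By Yy Xy *.
have k0 : depth r != 0%N by apply/negP => /eqP k0; apply: nX; exact/(XnE px).
(* The depth was positive and becomes 0, so a level was dropped and the point is full. *)
rewrite /flow_drop; have [full _|_] := boolP (flow_full (slev r) (slen r)); last first.
  by rewrite subn0 => /eqP; rewrite (negbTE k0).
have val3 := marked_valence (point_valid r).
have [e eB] : exists e, e \in bridges (mgraph r).
  apply: contrapT => none; have := bridge_len_full adm full.
  rewrite /bridge_len big1 => [/esym/eqP|e eB]; first by rewrite oner_eq0.
  by case: none; exists e.
have [r' [c [r'y pc]]] := pf; have cE := presented_collapsed pc.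
have nonbr f : f \notin bridges (mgraph r) -> exists f', f = ci c f'.
  move=> fB; have [|//] := collapsedP c f.
  rewrite cE inE => f0; have := flow_len_neq0 adm nb t01 fB.
  by rewrite f0 gt_eqF// slen_gt0//; exact: point_graded.
have eF : e \in collapsed c by rewrite cE inE /flow_len eB subrr mul0r.
(* Each side of the bridge contains a nonbridge; these edges survive at t = 1 and lie in different
   components off the image of [e]. *)
have [f1 [/nonbr[f1' ->] _ s1]] := bridge_side (d := (e, false)) val3 eB.
have [f2 [/nonbr[f2' ->] _ s2]] := bridge_side (d := (e, true)) val3 eB.
exists r' => //; split.
- by rewrite (presents_depth pf r'y); exact: (XnE pf).1 Xy.
- by apply/bridgelessP; rewrite r'y.
- exists (cv c (src e)); exact: (cut_vertex_collapse eF eB s1 s2).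
Qed.

Lemma Yn_cut_flow y : Yn_cut y -> exists2 x, ~ Xn x & flow x 1 = y.
Proof.
move=> [r [r0 rB [v /existsP[a /existsP[b /and3P[av bv ab]]]]] ry].
have [conn val3 eqv rs] := point_valid r; have gr := point_graded r.
have nB (e : edge (mgraph r)) : e \notin bridges (mgraph r) by rewrite inE.
set D : pred (dart (mgraph r)) := fun d => connect (incident_off v) a (inr d.1).
set G' := split_graph v D; pose c := split_collapse v D.
have bE : bridges G' = [set None]%SET by exact: cut_split_bridges.
have val3' w : (3 <= valence [set: edge G']%SET w)%N by exact: cut_split_valence ab w.
have aF : acyclic (collapsed c) := acyclic_split v D.
have [g [gc cg]] := collapsing_inverse aF.
(* The new edge carries all of level 0, and the metric of [r] moves to level 1. *)
pose lev (e : edge G') : nat := if e is Some _ then 1 else 0.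
pose len (e : edge G') : R := if e is Some e' then slen r e' else 1.
have len0 e : 0 < len e by case: e => [e|] //=; exact: slen_gt0.
have adm : admissible 1 lev len.
  split=> //.
  - by move=> e; exact: ltW.
  - by case.
  - rewrite (_ : [set e | _]%SET = finset.set0) ?acyclic0//.
    by apply/setP => e; rewrite !inE gt_eqF.
  - move=> [|[|//]] _.
      by rewrite (big_pred1 None)// => -[].
    rewrite -(slev_volume rs (leq0n _)).
    have -> : \sum_(e | lev e == 1%N) len e =
        \sum_(e | (e \notin collapsed c) && xpredT e) len e.
      apply: eq_bigl => e; rewrite collapsed_split in_set1 andbT.
      by case: e.
    rewrite (big_collapse c +%R xpredT); apply: eq_bigl => e.
    by rewrite -leqn0 -r0 slev_le.
  - move=> i [e|] i0 ie _; last by case: i i0 ie.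
    have /coreP/(_ (Some e)) := core_bridgesC G'.
    rewrite in_setC bE in_set1 => /(_ isT); apply: connect_adjS; apply: setSD.
    apply/fintype.subsetP => f; rewrite !inE; case: f => // f _.
    by rewrite ie orbT.
pose m := gcomp g (marking r).
have hm : homotopy_equivalence m.
  by apply: homotopy_equivalence_comp => //; exists c.
have conn' : connected_graph G' by rewrite -(connected_collapse c).
have [x px] := presents_exists conn' val3' hm adm.
exists x; first by move/(XnE px).
have nb := presents_nonbridge px.
have full : flow_full lev len.
  by apply/forallP => -[e|]; rewrite ?implybT// bE in_set1 eqxx.
have dropE : flow_drop (1 : R) lev len = 1%N by rewrite /flow_drop full oner_eq0.
have pf := flow_presents t01 px; rewrite dropE subnn in pf.
apply: presents_inj pf _.
have pr := presents_self r; rewrite ry r0 in pr.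
apply: (presents_comp (c := c)) pr => [//||e|e|e].
- apply: homotopic_trans (gcompA _ _ _) _.
  apply: homotopic_trans (gcomp_id_l _).
  exact: gcomp_homotopic cg (homotopic_refl _).
- rewrite /flow_lev dropE subnn.
  by apply/eqP; rewrite -leqn0 -r0 slev_le.
(* At t = 1 the point drops one level and [base_len] is 1, so the factor is 1 and the metric of [r]
   comes back unchanged. *)
- have eB : ci c e \notin bridges G' by rewrite bE in_set1.
  rewrite /flow_len (negbTE eB) /flow_lev dropE subnn eqxx.
  by rewrite (base_lenE _ adm nb) full oner_eq0 subrr mul0r subr0 divr1 mul1r.
- by rewrite collapsed_split in_set1 => /eqP->; rewrite /flow_len bE in_set1 eqxx subrr mul0r.
Qed.

End Image.

Theorem theorem3p2 (R : realType) (n : nat) (hn : (2 <= n)%N) :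
  exists H : Xhat R n * R -> Xhat R n,
    [/\ deformation_retraction (@Yhat R n) H,
        forall (x : Xhat R n) (t : R) (phi : Out n), 0 <= t <= 1 ->
          H (out_act x phi, t) = out_act (H (x, t)) phi
      & [set H (x, 1) | x in @boundary_Xhat R n]
        = @boundary_Yhat R n `|` @Yn_cut R n].
Proof.
exists (fun p => flow p.1 p.2); split.
- split=> [|x|x|x t /YhatE Bx t01] /=.
  + exact: flow_continuous.
  + exact: flow_start.
  + exact/YhatE/bridgeless_flow1.
  + exact: flow_fixed.
- by move=> x t phi; exact: flow_equivariant.
- apply/seteqP; split=> [_ [x nX <-]|y [[Yy nY]|/Yn_cut_flow[x nX <-]]] /=.
  + exact: flow_boundary.
  (* A point of the boundary of [Yhat] is its own preimage: it is bridgeless, hence fixed, and lies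
     outside [Xn] since otherwise it would be in [Yn]. *)
  + have By := (YhatE y).1 Yy; exists y; first by move=> Xy; exact/nY/YnE.
    by apply: flow_fixed => //; rewrite ler01 lexx.
  + by exists x.
Qed.
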